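(* Let $f:\Omega\times[0,T]\times\mathbb R\times\mathbb R^N\to\mathbb R$ be $\mathcal P\times\mathcal B(\mathbb R^{1+N})$-measurable, and suppose that there are constants $c',c''>0$ such that for all $t\in[0,T]$, $v_1,v_2\in\mathbb R$, $z_1,z_2\in\mathbb R^N$, $$|f(t,v_1,z_1)-f(t,v_2,z_2)|\le c'|v_1-v_2|+c''\|z_1-z_2\|_{X_t},$$ and that $E\big[\int_0^T|f^2(t,0,0)|\,dt\big]<\infty$. For $i=1,2$ let $\xi_i\in L^2(\mathcal F_T)$, let $\{\varphi^{(i)}_t;\ t\in[0,T]\}$ be a real-valued predictable process with $E\big[\int_0^T|\varphi^{(i)}_t|^2dt\big]<\infty$, and let $(Y^{(i)},Z^{(i)})$ be the solution of the BSDE $$Y^{(i)}_t=\xi_i+\int_t^T\big(f(s,Y^{(i)}_s,Z^{(i)}_s)+\varphi^{(i)}_s\big)ds-\int_t^T(Z^{(i)}_s)'\,dM_s,\qquad t\in[0,T].$$ Set $y=Y^{(1)}-Y^{(2)}$ and $z=Z^{(1)}-Z^{(2)}$. Then there exists a constant $\bar C'>0$, depending on the Lipschitz constant $c=\max\{c',c''\}$ of $f$ and on $T$ only, such that $$E\Big[\sup_{t\in[0,T]}|y_t|^2+\int_0^T\|z_t\|_{X_t}^2dt\Big]\le\bar C'\,E\Big[|\xi_1-\xi_2|^2+\Big(\int_0^T|\varphi^{(1)}_t-\varphi^{(2)}_t|\,dt\Big)^2\Big].$$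
   Context: Fix $T>0$. $X=\{X_t,t\ge0\}$ is a right-continuous, left-limited (RCLL) finite-state Markov chain on a probability space $(\Omega,\mathcal F,P)$ with state space the set of unit column vectors $\{e_1,\dots,e_N\}$ of $\mathbb R^N$; $\{\mathcal F_t\}$ is the completed natural filtration of $X$. $X$ has the semimartingale representation $X_t=X_0+\int_0^tA_sX_s\,ds+M_t$, where $A=\{A_t\}$ is the rate matrix of the chain, with bounded entries, and $M$ is an $\mathbb R^N$-valued (square-integrable) martingale. Prime on vectors and matrices denotes transpose. Put $\Psi_t=\mathrm{diag}(A_tX_{t-})-\mathrm{diag}(X_{t-})A_t'-A_t\,\mathrm{diag}(X_{t-})$, so that $d\langle X,X\rangle_t=\Psi_t\,dt$ for the predictable quadratic variation. For $C\in\mathbb R^N$ define the semi-norm $\|C\|_{X_t}$ by $\|C\|_{X_t}^2=C'\Psi_tC$. $\mathcal P$ is the predictable $\sigma$-field. $L^2(\mathcal F_t)$ is the set of real-valued $\mathcal F_t$-measurable $\xi$ with $E[|\xi|^2]<\infty$; $L^2_{\mathcal F}(0,T;\mathbb R)$ is the set of real-valued adapted RCLL processes $\phi$ with $E[\int_0^T|\phi(s)|^2ds]<\infty$; $P^2_{\mathcal F}(0,T;\mathbb R^N)$ is the set of $\mathbb R^N$-valued predictable processes $\phi$ with $E[\int_0^T\|\phi(s)\|_{X_s}^2ds]<\infty$. A solution $(Y,Z)$ of a BSDE is understood with $Y\in L^2_{\mathcal F}(0,T;\mathbb R)$ and $Z\in P^2_{\mathcal F}(0,T;\mathbb R^N)$;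 uniqueness is up to indistinguishability for $Y$ and $d\langle X,X\rangle_t\times P$-a.s. equality for $Z$. *)

(* Defs.v *)
From HB Require Import structures.
From mathcomp Require Import all_boot all_order all_algebra.
From mathcomp Require Import all_classical all_reals all_analysis.

Set Implicit Arguments.
Unset Strict Implicit.
Unset Printing Implicit Defensive.

Import Order.TTheory GRing.Theory Num.Theory.
Import numFieldNormedType.Exports.

Local Open Scope classical_set_scope.
Local Open Scope ring_scope.

(* Processes are functions [R -> Om -> V] of time and outcome; only their values
   at times in [0, +oo[ (or in [0, T]) are ever constrained or used. *)

Definition measurable_wrt (R : realType) (E : pointedType) (G : set (set E))
    (D : set E) (g : E -> R) : Prop :=
  measurable_fun (D : set (g_sigma_algebraType G)) g.

Definition rcll (R : realType) (V : ptopologicalType) (T : R) (x : R -> V) : Prop :=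
  (forall t : R, 0 <= t < T -> x s @[s --> t^'+] --> x t) /\
  (forall t : R, 0 < t <= T -> cvg (x s @[s --> t^'-])).

Section Chain.
Context (R : realType) (d : measure_display) (Om : measurableType d).
Context (P : probability Om R) (N : nat).

Local Notation mu := (@lebesgue_measure R).

Definition unit_vector (i : 'I_N) : 'cV[R]_N := delta_mx i 0.

(* Natural filtration of [X], augmented with the [P]-null events; on a complete
   probability space these are all the subsets of null sets. *)
Definition filtration (X : R -> Om -> 'cV[R]_N) (t : R) : set (set Om) :=
  <<s [set B | exists (s : R) i, 0 <= s <= t /\ B = X s @^-1` [set unit_vector i]]
      `|` [set B | measurable B /\ P B = 0%E] >>.

Definition square_integrable_martingale (F : R -> set (set Om))
    (m : R -> Om -> R) : Prop :=
  [/\ forall t : R, 0 <= t -> measurable_wrt (F t) setT (m t),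
      forall t : R, 0 <= t -> (\int[P]_w ((m t w) ^+ 2)%:E < +oo)%E &
      forall (s t : R) B, 0 <= s <= t -> F s B ->
        (\int[P]_(w in B) (m t w)%:E = \int[P]_(w in B) (m s w)%:E)%E].

(* Column convention: [A t j i] is the rate of the jumps from [e_i] to [e_j]. *)
Definition rate_matrix (A : R -> 'M[R]_N) : Prop :=
  [/\ forall i j, measurable_fun (`[0, +oo[ : set R) (fun t => A t i j),
      exists K : R, forall (t : R) i j, 0 <= t -> `|A t i j| <= K,
      forall (t : R) (i j : 'I_N), 0 <= t -> i != j -> 0 <= A t i j &
      forall (t : R) j, 0 <= t -> \sum_i A t i j = 0].

Definition markov_property (X : R -> Om -> 'cV[R]_N) : Prop :=
  forall (s t : R) (i j : 'I_N) B, 0 <= s <= t -> filtration X s B ->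
    let Xs := X s @^-1` [set unit_vector i] in
    let Xt := X t @^-1` [set unit_vector j] in
    (P (B `&` Xs `&` Xt) * P Xs = P (B `&` Xs) * P (Xs `&` Xt))%E.

Definition rcll_markov_chain (X : R -> Om -> 'cV[R]_N) : Prop :=
  [/\ forall (t : R) w, 0 <= t -> exists i, X t w = unit_vector i,
      forall (t : R) i, 0 <= t -> measurable (X t @^-1` [set unit_vector i]),
      forall T w, rcll T (X ^~ w) &
      markov_property X].

Definition semimartingale_representation (A : R -> 'M[R]_N)
    (X M : R -> Om -> 'cV[R]_N) : Prop :=
  (forall i,
     square_integrable_martingale (filtration X) (fun t w => M t w i 0)) /\
  {ae P, forall w, forall t : R, 0 <= t ->
    X t w = X 0 w + (\col_i \int[mu]_(s in `[0, t]) (A s *m X s w) i 0) + M t w}.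

(* [X_{t-}], with the usual convention [X_{0-} = X_0] *)
Definition left_limit (X : R -> Om -> 'cV[R]_N) (t : R) (w : Om) : 'cV[R]_N :=
  if t <= 0 then X 0 w else lim (X s w @[s --> t^'-]).

Definition Psi (A : R -> 'M[R]_N) (X : R -> Om -> 'cV[R]_N) (t : R) (w : Om) :
    'M[R]_N :=
  let D := diag_mx (left_limit X t w)^T in
  diag_mx (A t *m left_limit X t w)^T - D *m (A t)^T - A t *m D.

Definition seminorm (A : R -> 'M[R]_N) (X : R -> Om -> 'cV[R]_N)
    (t : R) (w : Om) (C : 'cV[R]_N) : R :=
  Num.sqrt ((C^T *m Psi A X t w *m C) 0 0).

(* Predictable sigma-field. As a sigma-field on [R * Om] it also contains the
   complement of [0, +oo[ * Om; only its trace on [0, T] * Om is used. *)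
Definition predictable_sets (X : R -> Om -> 'cV[R]_N) : set (set (R * Om)) :=
  <<s [set C | exists2 B, filtration X 0 B & C = [set 0] `*` B] `|`
      [set C | exists (s t : R) B, [/\ 0 <= s, s < t, filtration X s B &
                                 C = `]s, t] `*` B]] >>.

Definition predictable (T : R) (X : R -> Om -> 'cV[R]_N) (phi : R -> Om -> R) :
    Prop :=
  measurable_wrt (predictable_sets X) (`[0, T] `*` setT)
    (fun p => phi p.1 p.2).

Definition predictable_borel_sets (X : R -> Om -> 'cV[R]_N) :
    set (set ((R * Om) * (R * 'cV[R]_N))) :=
  <<s [set C | exists B1 B2, [/\ predictable_sets X B1,
         (<<s [set O : set (R * 'cV[R]_N) | open O] >>) B2 &
         C = B1 `*` B2]] >>.

Definition predictable_borel (T : R) (X : R -> Om -> 'cV[R]_N)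
    (f : R -> Om -> R -> 'cV[R]_N -> R) : Prop :=
  measurable_wrt (predictable_borel_sets X) ((`[0, T] `*` setT) `*` setT)
    (fun p => f p.1.1 p.1.2 p.2.1 p.2.2).

Definition L2_terminal (T : R) (X : R -> Om -> 'cV[R]_N) (xi : Om -> R) : Prop :=
  measurable_wrt (filtration X T) setT xi /\
  (\int[P]_w ((xi w) ^+ 2)%:E < +oo)%E.

Definition finite_energy (T : R) (phi : R -> Om -> R) : Prop :=
  (\int[P]_w \int[mu]_(t in `[0%R, T]) ((phi t w) ^+ 2)%:E < +oo)%E.

Definition adapted_rcll (T : R) (X : R -> Om -> 'cV[R]_N) (Y : R -> Om -> R) :
    Prop :=
  (forall t : R, 0 <= t <= T -> measurable_wrt (filtration X t) setT (Y t)) /\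
  (forall w, rcll T (Y ^~ w)).

Definition L2_adapted (T : R) (X : R -> Om -> 'cV[R]_N) (Y : R -> Om -> R) :
    Prop :=
  adapted_rcll T X Y /\ finite_energy T Y.

Definition P2_predictable (T : R) (A : R -> 'M[R]_N)
    (X : R -> Om -> 'cV[R]_N) (Z : R -> Om -> 'cV[R]_N) : Prop :=
  (forall i, predictable T X (fun t w => Z t w i 0)) /\
  finite_energy T (fun t w => seminorm A X t w (Z t w)).

(* The simple integrand [\sum_(k < n) h_k 1_{]t_k, t_(k+1)]}] *)
Record simple_process := SimpleProcess {
  simple_size : nat;
  simple_time : nat -> R;
  simple_coef : nat -> Om -> 'cV[R]_N }.

Definition simple_predictable (X : R -> Om -> 'cV[R]_N) (H : simple_process) :
    Prop :=
  [/\ 0 <= simple_time H 0%N,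
      forall k, (k < simple_size H)%N ->
        simple_time H k <= simple_time H k.+1,
      forall k i, (k < simple_size H)%N ->
        measurable_wrt (filtration X (simple_time H k)) setT
          (fun w => simple_coef H k w i 0) &
      forall k, (k < simple_size H)%N ->
        exists K : R, forall w i, `|simple_coef H k w i 0| <= K].

Definition simple_value (H : simple_process) (t : R) (w : Om) : 'cV[R]_N :=
  \sum_(k < simple_size H)
    (if simple_time H k < t <= simple_time H k.+1
     then simple_coef H k w else 0).

Definition simple_integral (M : R -> Om -> 'cV[R]_N) (H : simple_process)
    (t : R) (w : Om) : R :=
  \sum_(k < simple_size H)
    ((simple_coef H k w)^T *m
     (M (Num.min (simple_time H k.+1) t) w -
      M (Num.min (simple_time H k) t) w)) 0 0.

(* [I] is (a right-continuous version of) the Ito integral process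
   [t |-> \int_0^t Z_s' dM_s] of [Z] in P^2 on [0, T]: the L^2-limit of the
   integrals of simple predictable processes that converge to [Z] in
   L^2(d<X,X> x P). *)
Definition stochastic_integral (T : R) (A : R -> 'M[R]_N)
    (X M : R -> Om -> 'cV[R]_N) (Z : R -> Om -> 'cV[R]_N)
    (I : R -> Om -> R) : Prop :=
  adapted_rcll T X I /\
  exists H : nat -> simple_process,
    [/\ forall n, simple_predictable X (H n),
        (\int[P]_w \int[mu]_(t in `[0%R, T])
           ((seminorm A X t w (simple_value (H n) t w - Z t w)) ^+ 2)%:E)%E
          @[n --> \oo] --> 0%E &
        forall t : R, 0 <= t <= T ->
          (\int[P]_w ((simple_integral M (H n) t w - I t w) ^+ 2)%:E)%E
            @[n --> \oo] --> 0%E].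

(* [Y_t = xi + \int_t^T g(s, Y_s, Z_s) ds - \int_t^T Z_s' dM_s] on [0, T] *)
Definition bsde_solution (T : R) (A : R -> 'M[R]_N) (X M : R -> Om -> 'cV[R]_N)
    (g : R -> Om -> R -> 'cV[R]_N -> R) (xi : Om -> R)
    (Y : R -> Om -> R) (Z : R -> Om -> 'cV[R]_N) : Prop :=
  [/\ L2_adapted T X Y, P2_predictable T A X Z &
      exists2 I, stochastic_integral T A X M Z I &
        {ae P, forall w, forall t : R, 0 <= t <= T ->
          Y t w = xi w + (\int[mu]_(s in `[t, T]) g s w (Y s w) (Z s w))
                  - (I T w - I t w)}].

Definition lipschitz_driver (T : R) (A : R -> 'M[R]_N)
    (X : R -> Om -> 'cV[R]_N) (f : R -> Om -> R -> 'cV[R]_N -> R)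
    (c1 c2 : R) : Prop :=
  {ae P, forall w, forall (t v1 v2 : R) (z1 z2 : 'cV[R]_N), 0 <= t <= T ->
    `|f t w v1 z1 - f t w v2 z2| <=
      c1 * `|v1 - v2| + c2 * seminorm A X t w (z1 - z2)}.

End Chain.

(* Main.v *)
Require Import Defs.
From HB Require Import structures.
From mathcomp Require Import all_boot all_order all_algebra.
From mathcomp Require Import all_classical all_reals all_analysis.
From mathcomp Require Import measurable_realfun.
From mathcomp Require Import ring lra.
Set Implicit Arguments.
Unset Strict Implicit.
Unset Printing Implicit Defensive.
Import Order.TTheory GRing.Theory Num.Theory.
Import numFieldNormedType.Exports.
Local Open Scope classical_set_scope.
Local Open Scope ring_scope.

(** Write y, z, I and g for the differences of the two solutions, of their
    integrands, of their stochastic integrals and of their drivers. On an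
    interval [a, b] the two equations give
      y_a + (I_b - I_a) = y_b + int_a^b g.
    The variable y_a is known at time a and the increment of I is orthogonal to
    everything known at time a, so that the two terms on the left are orthogonal
    in L^2 and
      E (I_b - I_a)^2 <= 2 E y_b^2 + 2 E (int_a^b |g|)^2.
    The isometry bounds E int_a^b |z|^2 by a multiple of the left side, and
    Doob's inequality bounds in the same way the running maximum of I, hence,
    by the equation again, that of y ([martingale_increment_le],
    [short_interval_estimate]).

    The Lipschitz condition bounds |g| by c |y| + c |z| + |phi1 - phi2|, and the
    Cauchy-Schwarz inequality puts a factor c^2 (b - a) in front of the energies
    of y and z. When b - a is small with respect to c these energies are absorbed
    on the left, which leaves y_b and phi1 - phi2 on the right. A number of steps
    that depends only on T and c covers [0, T] backwards from the terminal time;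
    each step multiplies the constant by 429 ([bounded_from_step],
    [backward_estimate]).

    The facts on stochastic integrals come from the chain itself. The compensated
    chain X_t - X_0 - int_0^t A X ds is bounded on bounded time intervals and
    almost surely equal to the martingale part M. The coordinates of X satisfy
    X^i X^j = (i == j) X^i; integrating by parts in the products of two increments
    of the compensated chain shows that Psi is the rate of their conditional
    covariance ([increment_product], [bracket_isometry]). The isometry
    follows for simple integrands ([family_isometry]), and the L^2 limits that
    define the stochastic integral inherit from it the martingale property and an
    energy bound ([stochastic_integral_martingale], [energy_le_increment]).

    Finally, the seminorm is defined with the left limits of the chain, which
    differ from its values only at countably many times on each path. So under
    time integrals the squared seminorm is the form [chain_form] of the current
    state, which is
      sum_i A_ik (C_i - C_k)^2
    when the state is the k-th unit vector: a nonnegative quadratic form. *)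

(** * Orthogonality to a sub-sigma-field *)

Section IndicatorProducts.
Context (R : realType) (d : measure_display) (T : measurableType d).
Context (mu : {measure set T -> \bar R}).
Implicit Types (f : T -> R) (B : set T).

Lemma indicM_restrict f B :
  (fun x => (\1_B x * f x)%:E) = (EFin \o f) \_ B.
Proof.
apply/funext => x; rewrite patchE indicE; case: ifPn => _ /=.
  by rewrite mul1r.
by rewrite mul0r.
Qed.

Lemma integral_indicM f B :
  (\int[mu]_x (\1_B x * f x)%:E = \int[mu]_(x in B) (f x)%:E)%E.
Proof. by rewrite [RHS]integral_mkcond -indicM_restrict. Qed.

Lemma integrable_indicM f B : measurable B ->
  mu.-integrable setT (EFin \o f) ->
  mu.-integrable setT (fun x => (\1_B x * f x)%:E).
Proof.
move=> mB fi; rewrite indicM_restrict; apply/(integrable_mkcond _ mB).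
exact: (integrableS measurableT).
Qed.

End IndicatorProducts.

Section Orthogonality.
Context (R : realType) (d : measure_display) (Om : measurableType d).
Context (P : {measure set Om -> \bar R}).
Variables (G : set (set Om)).
Hypothesis sG : sigma_algebra setT G.
Hypothesis GM : G `<=` measurable.

Lemma g_sigma_measurable (B : set Om) :
  measurable (B : set (g_sigma_algebraType G)) -> measurable B.
Proof. by rewrite /measurable /= sigma_algebra_id// => /GM. Qed.

Lemma sub_sigma_algebraT : G setT.
Proof. by case: sG => G0 GC _; rewrite -[setT]setD0; exact: GC. Qed.

Lemma measurable_wrt_fun (D : set Om) (g : Om -> R) : G D ->
  measurable_wrt G D g -> measurable_fun D g.
Proof.
move=> GD mg mD Y mY; apply: g_sigma_measurable; apply: mg => //.
by rewrite /measurable /= sigma_algebra_id.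
Qed.

Variable f : Om -> R.
Hypothesis fi : P.-integrable setT (EFin \o f).
Hypothesis f0 : forall B, G B -> (\int[P]_(w in B) (f w)%:E = 0)%E.

Import HBNNSimple.

Lemma orth_nnsfun (h : {nnsfun (g_sigma_algebraType G) >-> R}) :
  (\int[P]_w (h w * f w)%:E = 0)%E.
Proof.
have mB y : measurable (h @^-1` [set y] : set Om).
  by apply: g_sigma_measurable; exact: measurable_sfunP.
have GB y : G (h @^-1` [set y]).
  have : measurable (h @^-1` [set y] : set (g_sigma_algebraType G)).
    exact: measurable_sfunP.
  by rewrite /measurable /= sigma_algebra_id.
have i1 y : P.-integrable setT (fun w => (\1_(h @^-1` [set y]) w * f w)%:E).
  exact: integrable_indicM.
have ii y : P.-integrable setT (fun w => (y * \1_(h @^-1` [set y]) w * f w)%:E).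
  by under eq_fun do rewrite -mulrA EFinM; exact: integrableZl.
transitivity (\int[P]_w (\sum_(y <- finmap.enum_fset (fset_set (range h))) (y * \1_(h @^-1` [set y]) w * f w)%:E))%E.
  apply: eq_integral => w _; rewrite sumEFin -mulr_suml; congr (_ * _)%:E.
  by rewrite fimfunE fsbig_finite.
rewrite integral_sum//; apply: big1 => y _.
under eq_integral do rewrite -mulrA EFinM.
rewrite integralZl//.
by rewrite integral_indicM f0// mule0.
Qed.

Lemma orth_ge0 (eta : Om -> R) : measurable_wrt G setT eta -> (forall w, 0 <= eta w) ->
  P.-integrable setT (fun w => (eta w * f w)%:E) ->
  (\int[P]_w (eta w * f w)%:E = 0)%E.
Proof.
move=> meta eta0 etafi.
have meta' : @measurable_fun _ _ (g_sigma_algebraType G) (\bar R) setT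
    (EFin \o eta).
  exact/measurable_EFinP.
pose h := nnsfun_approx measurableT meta'.
have mf : measurable_fun setT f by exact/measurable_EFinP/(measurable_int P).
have mh n : measurable_fun (setT : set Om) (h n : Om -> R).
  exact: (measurable_wrt_fun sub_sigma_algebraT (measurable_funPT (h n))).
have [] := @dominated_convergence _ Om R P setT measurableT
  (fun n w => (h n w * f w)%:E) (fun w => (eta w * f w)%:E)
  (fun w => `|(eta w * f w)%:E|%E).
- by move=> n; apply/measurable_EFinP; apply: measurable_funM.
- exact: (measurable_int P).
- apply: aeW => w _.
  rewrite EFinM; under eq_fun do rewrite EFinM.
  apply: cvgeM; first by rewrite mule_def_fin.
    have := cvg_nnsfun_approx measurableT meta' _ (I : setT w); apply => x _ /=.
    by rewrite lee_fin.
  exact: cvg_cst.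
- exact: integrable_abse.
- apply: aeW => w n _; rewrite !abse_EFin lee_fin !normrM ler_wpM2r//.
  rewrite (ger0_norm (eta0 w)) ger0_norm; last exact: (@fun_ge0 _ _ (h n)).
  have le_h := le_approx (D := setT) (f := EFin \o eta) n (fun x _ => eta0 x) (I : setT w).
  by rewrite -lee_fin /h nnsfun_approxE; exact: le_h.
move=> _ _ /cvg_lim <-//.
under [X in limn X]eq_fun do rewrite orth_nnsfun.
exact: lim_cst.
Qed.

(** A function whose integral over every event of [G] vanishes is orthogonal to
    every [G]-measurable multiplier for which the product is integrable: this holds
    for simple functions by linearity, then for nonnegative ones by dominated
    convergence, then for the two parts of the multiplier. *)
Lemma orth_measurable_wrt (eta : Om -> R) : measurable_wrt G setT eta ->
  P.-integrable setT (fun w => (eta w * f w)%:E) ->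
  (\int[P]_w (eta w * f w)%:E = 0)%E.
Proof.
move=> meta etafi.
have mf : measurable_fun setT f by exact/measurable_EFinP/(measurable_int P).
have GT := sub_sigma_algebraT.
have mp : measurable_wrt G setT (eta^\+)%R by exact: measurable_funrpos.
have mn : measurable_wrt G setT (eta^\-)%R by exact: measurable_funrneg.
have ip : P.-integrable setT (fun w => (eta^\+ w * f w)%:E).
  apply: (le_integrable _ _ _ etafi) => //.
    by apply/measurable_EFinP/measurable_funM => //; exact: measurable_wrt_fun.
  move=> w _; rewrite !abse_EFin lee_fin !normrM ler_wpM2r//.
  rewrite /funrpos/= ger0_norm ?le_max ?lexx ?orbT//.
  by rewrite ge_max ler_norm normr_ge0.
have im : P.-integrable setT (fun w => (eta^\- w * f w)%:E).
  apply: (le_integrable _ _ _ etafi) => //.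
    by apply/measurable_EFinP/measurable_funM => //; exact: measurable_wrt_fun.
  move=> w _; rewrite !abse_EFin lee_fin !normrM ler_wpM2r//.
  rewrite /funrneg/= ger0_norm ?le_max ?lexx ?orbT//.
  by rewrite ge_max normr_ge0 andbT -normrN ler_norm.
transitivity (\int[P]_w ((eta^\+ w * f w)%:E - (eta^\- w * f w)%:E))%E.
  apply: eq_integral => w _; rewrite -EFinB -mulrBl; congr (_ * _)%:E.
  by rewrite -[X in X w]funrposBneg.
by rewrite integralB// !orth_ge0// sube0.
Qed.

End Orthogonality.

(** * Square-integrable functions *)

Section CauchySchwarz.
Context (R : realType) (d : measure_display) (T : measurableType d).
Context (nu : {measure set T -> \bar R}).

(** Cauchy-Schwarz against the constant 1, valid also when the right side is
    infinite. It comes from integrating [0 <= (|f| - k)^2] with the best [k]. *)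
Lemma sqr_integral_le (D : set T) (delta : R) (f : T -> R) :
  measurable D -> nu D = delta%:E -> 0 < delta -> measurable_fun D f ->
  ((\int[nu]_(x in D) `|f x|%:E) ^+ 2 <=
    delta%:E * \int[nu]_(x in D) ((f x) ^+ 2)%:E)%E.
Proof.
move=> mD nuD delta0 mf.
have mabs : measurable_fun D (fun x => `|f x|%:E).
  exact/measurable_EFinP/measurableT_comp.
have msq : measurable_fun D (fun x => ((f x) ^+ 2)%:E).
  by apply/measurable_EFinP; apply: measurable_funX.
set m := (\int[nu]_(x in D) `|f x|%:E)%E; set V := (\int[nu]_(x in D) _)%E.
have m0 : (0 <= m)%E by apply: integral_ge0 => x _; rewrite lee_fin.
have V0 : (0 <= V)%E by apply: integral_ge0 => x _; rewrite lee_fin sqr_ge0.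
have key (k : R) : 0 <= k -> ((2 * k)%R%:E * m <= V + (k ^+ 2 * delta)%R%:E)%E.
  move=> k0; rewrite -ge0_integralZl ?lee_fin ?mulr_ge0//.
  have -> : (k ^+ 2 * delta)%:E = (\int[nu]_(x in D) (k ^+ 2)%:E)%E.
    by rewrite integral_cst//= nuD.
  rewrite -ge0_integralD//; last 2 first.
    by move=> x _; rewrite lee_fin sqr_ge0.
    by move=> x _; rewrite lee_fin sqr_ge0.
  apply: ge0_le_integral => //.
  - by move=> x _; rewrite -EFinM lee_fin !mulr_ge0.
  - exact: measurable_funeM.
  - exact: emeasurable_funD.
  - move=> x _; rewrite -EFinM -EFinD lee_fin -(real_normK (num_real (f x))).
    by have := sqr_ge0 (`|f x| - k); nra.
have [Vy|] := eqVneq V +oo%E; first by rewrite Vy gt0_muley ?lte_fin// leey.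
rewrite -ltey => Vy.
have Vfin : V \is a fin_num by rewrite ge0_fin_numE.
have mfin : m \is a fin_num.
  rewrite ge0_fin_numE//.
  (* with k = 1/2 the mean is finite as soon as V is *)
  have := key 2^-1; rewrite invr_ge0 divff// mul1e => /(_ (ler0n _ _)) /le_lt_trans; apply.
  by rewrite lte_add_pinfty// ltry.
(* the optimal k: the mean value of |f| *)
have := key (fine m / delta).
rewrite -(fineK mfin) -(fineK Vfin) -!EFinM -EFinD !lee_fin.
have mm : 0 <= fine m by exact: fine_ge0.
move=> /(_ (divr_ge0 mm (ltW delta0))).
set M := fine m; set W := fine V => h.
have e1 : 2 * (M / delta) * M = 2 * (M ^+ 2 / delta) by field; rewrite gt_eqF.
have e2 : (M / delta) ^+ 2 * delta = M ^+ 2 / delta by field; rewrite gt_eqF.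
move: h; rewrite e1 e2 => h.
have : M ^+ 2 / delta <= W by lra.
by rewrite ler_pdivrMr// mulrC.
Qed.

End CauchySchwarz.

Section SquareIntegrable.
Context (R : realType) (d : measure_display) (Om : measurableType d).
Context (P : probability Om R).
Implicit Types f g : Om -> R.

Definition sqint f := measurable_fun setT f /\ (\int[P]_w ((f w) ^+ 2)%:E < +oo)%E.

Lemma sqint_measurable f : sqint f -> measurable_fun setT f.
Proof. by case. Qed.

Lemma sqint_sqr f : sqint f -> P.-integrable setT (fun w => ((f w) ^+ 2)%:E).
Proof.
move=> [mf fi]; apply/integrableP; split.
  by apply/measurable_EFinP; apply: measurable_funX.
by under eq_integral do rewrite abse_EFin ger0_norm ?sqr_ge0//.
Qed.

Lemma le_sqint f g : measurable_fun setT g -> P.-integrable setT (EFin \o f) ->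
  (forall w, (g w) ^+ 2 <= f w) -> sqint g.
Proof.
move=> mg /integrableP[mf fi] fg; split => //; apply: le_lt_trans fi.
apply: ge0_le_integral => //.
- by move=> w _; rewrite lee_fin sqr_ge0.
- by apply/measurable_EFinP; apply: measurable_funX.
- exact: measurableT_comp.
- by move=> w _; rewrite /= lee_fin; apply: le_trans (fg w) (ler_norm _).
Qed.

Lemma integrableD_EFin f g : P.-integrable setT (EFin \o f) ->
  P.-integrable setT (EFin \o g) -> P.-integrable setT (fun w => (f w + g w)%:E).
Proof. by move=> fi gi; under eq_fun do rewrite EFinD; exact: integrableD. Qed.

Lemma integrableZ_EFin k f : P.-integrable setT (EFin \o f) ->
  P.-integrable setT (fun w => (k * f w)%:E).
Proof. by move=> fi; under eq_fun do rewrite EFinM; exact: integrableZl. Qed.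

Lemma sqintM_integrable f g : sqint f -> sqint g ->
  P.-integrable setT (fun w => (f w * g w)%:E).
Proof.
move=> sf sg.
have := integrableD_EFin (sqint_sqr sf) (sqint_sqr sg).
apply: le_integrable => //.
  by apply/measurable_EFinP/measurable_funM; apply: sqint_measurable.
move=> w _; rewrite !abse_EFin lee_fin normrM.
rewrite (ger0_norm (addr_ge0 (sqr_ge0 _) (sqr_ge0 _))).
rewrite -(real_normK (num_real (f w))) -(real_normK (num_real (g w))).
by have := sqr_ge0 (`|f w| - `|g w|); have := normr_ge0 (f w);
  have := normr_ge0 (g w); nra.
Qed.

Lemma bounded_sqint (K : R) f : measurable_fun setT f -> (forall w, `|f w| <= K) ->
  sqint f.
Proof.
move=> mf fK; apply: (@le_sqint (fun=> K ^+ 2)) => //.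
  exact: finite_measure_integrable_cst.
move=> w; rewrite -(real_normK (num_real (f w))).
by rewrite lerXn2r ?nnegrE// (le_trans _ (fK w)).
Qed.

Lemma sqint_cst (k : R) : sqint (fun=> k).
Proof. by apply: (@bounded_sqint `|k|). Qed.

Lemma sqint_integrable f : sqint f -> P.-integrable setT (EFin \o f).
Proof.
move=> sf; have := sqintM_integrable sf (sqint_cst 1).
by under eq_fun do rewrite mulr1.
Qed.

Lemma sqintD f g : sqint f -> sqint g -> sqint (fun w => f w + g w).
Proof.
move=> sf sg.
apply: (@le_sqint (fun w => 2 * (f w ^+ 2 + g w ^+ 2))).
- by apply: measurable_funD; apply: sqint_measurable.
- by apply: integrableZ_EFin; apply: integrableD_EFin; apply: sqint_sqr.
- by move=> w; have := sqr_ge0 (f w - g w); nra.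
Qed.

Lemma sqintMb (K : R) (h f : Om -> R) : measurable_fun setT h -> (forall w, `|h w| <= K) ->
  sqint f -> sqint (fun w => h w * f w).
Proof.
move=> mh hK sf; apply: (@le_sqint (fun w => K ^+ 2 * f w ^+ 2)).
- by apply: measurable_funM => //; apply: sqint_measurable.
- by apply: integrableZ_EFin; exact: sqint_sqr.
- move=> w; rewrite exprMn ler_wpM2r ?sqr_ge0// -(real_normK (num_real (h w))).
  by rewrite lerXn2r ?nnegrE// (le_trans _ (hK w)).
Qed.

Lemma sqintZ (k : R) f : sqint f -> sqint (fun w => k * f w).
Proof. by move=> sf; apply: (@sqintMb `|k|). Qed.

Lemma sqintN f : sqint f -> sqint (fun w => - f w).
Proof. by move=> /(sqintZ (-1)); under eq_fun do rewrite mulN1r. Qed.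

Lemma sqintB f g : sqint f -> sqint g -> sqint (fun w => f w - g w).
Proof. by move=> sf /sqintN; exact: sqintD. Qed.

Lemma sqint_norm f : sqint f -> sqint (fun w => `|f w|).
Proof.
move=> sf; apply: (@le_sqint (fun w => f w ^+ 2)).
- by apply: measurableT_comp => //; apply: sqint_measurable.
- exact: sqint_sqr.
- by move=> w; rewrite real_normK// num_real.
Qed.

Lemma sqint_sum (I : Type) (s : seq I) (F : I -> Om -> R) :
  (forall i, sqint (F i)) -> sqint (fun w => \sum_(i <- s) F i w).
Proof.
move=> sF; elim: s => [|i s IH].
  by under eq_fun do rewrite big_nil; exact: sqint_cst.
by under eq_fun do rewrite big_cons; exact: sqintD.
Qed.

Lemma sqr_integral_prob f : measurable_fun setT f ->
  ((\int[P]_w `|f w|%:E) ^+ 2 <= \int[P]_w ((f w) ^+ 2)%:E)%E.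
Proof.
by move=> mf; have := sqr_integral_le measurableT (probability_setT P) ltr01 mf; rewrite mul1e.
Qed.

Lemma integral_sqr_EFin f : sqint f ->
  (\int[P]_w ((f w) ^+ 2)%:E = (\int[P]_w ((f w) ^+ 2))%:E)%E.
Proof. by move=> sf; rewrite /Rintegral fineK//; exact/integrable_fin_num/sqint_sqr. Qed.

End SquareIntegrable.

(** * Integration over times and outcomes *)

Section TimeFubini.
Context (R : realType) (d : measure_display) (Om : measurableType d).
Context (P : probability Om R) (a b : R).
Local Notation mu := (@lebesgue_measure R).
Local Notation D := (`[a, b]%classic `*` [set: Om] : set (R * Om)).

Lemma measurable_strip : measurable D.
Proof. by apply: measurableX. Qed.

Lemma measurable_strip_time d' (U : measurableType d') (F : R * Om -> U) :
  measurable_fun D F ->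
  forall w, measurable_fun (`[a, b]%classic : set R) (fun t => F (t, w)).
Proof.
move=> mF w; apply: (measurable_comp measurable_strip _ mF) => //.
  by move=> _ [t tab <-]; split.
by apply: measurable_funTS; exact: pair2_measurable.
Qed.

Lemma measurable_strip_outcome d' (U : measurableType d') (F : R * Om -> U) :
  measurable_fun D F ->
  forall t, a <= t <= b -> measurable_fun setT (fun w => F (t, w)).
Proof.
move=> mF t tab; apply: (measurable_comp measurable_strip _ mF) => //.
  by move=> _ [w _ <-]; split => //=; rewrite in_itv.
Qed.

Lemma patch_strip_time (F : R * Om -> \bar R) w :
  (fun t => (F \_ D) (t, w)) = (fun t => F (t, w)) \_ `[a, b].
Proof.
apply/funext => t; rewrite !patchE; congr (if _ then _ else _).
apply/idP/idP => /set_mem h; apply/mem_set; first by case: h.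
by split.
Qed.

Lemma integral_patch_time (F : R * Om -> \bar R) w :
  (\int[mu]_t (F \_ D) (t, w) = \int[mu]_(t in `[a, b]) F (t, w))%E.
Proof. by rewrite [RHS]integral_mkcond -patch_strip_time. Qed.

Lemma integral_patch_outcome (F : R * Om -> \bar R) t :
  (\int[P]_w (F \_ D) (t, w) =
    ((fun t => \int[P]_w F (t, w)) \_ `[a, b]) t)%E.
Proof.
rewrite patchE; case: ifPn => tab.
  apply: eq_integral => w _; rewrite patchE mem_set//.
  by move: tab => /set_mem.
rewrite integral0_eq// => w _; rewrite patchE memNset//.
by move=> [/= tab' _]; move/negP: tab; apply; apply/mem_set.
Qed.

Section Nonnegative.
Variable F : R * Om -> \bar R.
Hypothesis mF : measurable_fun D F.
Hypothesis F0 : forall t w, a <= t <= b -> (0 <= F (t, w))%E.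

Let mFD : measurable_fun setT (F \_ D).
Proof. by apply/(measurable_restrictT _ _).1 => //; exact: measurable_strip. Qed.

Let FD0 x : (0 <= (F \_ D) x)%E.
Proof.
rewrite patchE; case: ifPn => //; case: x => t w /set_mem[/= tab _].
by apply: F0; move: tab; rewrite in_itv.
Qed.

Lemma measurable_integral_time :
  measurable_fun setT (fun w => \int[mu]_(t in `[a, b]) F (t, w))%E.
Proof.
have := @measurable_fun_fubini_tonelli_G _ _ _ Om R mu _ mFD FD0.
by rewrite /fubini_G; under eq_fun do rewrite integral_patch_time.
Qed.

Lemma measurable_integral_outcome :
  measurable_fun (`[a, b]%classic : set R) (fun t => \int[P]_w F (t, w))%E.
Proof.
have := @measurable_fun_fubini_tonelli_F _ _ _ Om R P _ mFD FD0.
rewrite /fubini_F; under eq_fun do rewrite integral_patch_outcome.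
by move/(measurable_restrictT _ (measurable_itv _)).2.
Qed.

End Nonnegative.

Lemma measurable_Rintegral_time (F : R * Om -> R) : measurable_fun D F ->
  measurable_fun setT (fun w => \int[mu]_(t in `[a, b]) F (t, w)).
Proof.
move=> mF; rewrite /Rintegral.
apply: (measurableT_comp (fine_measurable measurableT)) => //.
have mE : measurable_fun D (EFin \o F) by exact/measurable_EFinP.
under eq_fun do rewrite integralE.
apply: emeasurable_funB.
- have := @measurable_integral_time (EFin \o F)^\+%E (measurable_funepos mE).
  move=> /(_ (fun _ _ _ => funepos_ge0 _ _)); apply: eq_measurable_fun => w _.
  by apply: eq_integral => t _; rewrite !funeposE.
- have := @measurable_integral_time (EFin \o F)^\-%E (measurable_funeneg mE).
  move=> /(_ (fun _ _ _ => funeneg_ge0 _ _)); apply: eq_measurable_fun => w _.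
  by apply: eq_integral => t _; rewrite !funenegE.
Qed.

Section Bounded.
Variables (F : R * Om -> R) (K : R).
Hypothesis mF : measurable_fun D F.
Hypothesis FK : forall t w, a <= t <= b -> `|F (t, w)| <= K.

Let mE : measurable_fun D (EFin \o F). Proof. exact/measurable_EFinP. Qed.

Lemma bounded_integrable_time w : mu.-integrable `[a, b] (fun t => (F (t, w))%:E).
Proof.
apply: measurable_bounded_integrable => //.
- by rewrite /= lebesgue_measure_itv/=; case: ifP => _; rewrite ?ltry.
- exact: measurable_strip_time.
- exists K; split; first exact: num_real.
  by move=> x Kx t; rewrite /= in_itv/= => tab; apply: le_trans (FK _ tab) (ltW Kx).
Qed.

Lemma bounded_integrable_outcome t : a <= t <= b ->
  P.-integrable setT (fun w => (F (t, w))%:E).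
Proof.
move=> tab; apply/sqint_integrable/(@bounded_sqint _ _ _ _ K) => //.
- exact: measurable_strip_outcome.
- by move=> w; exact: FK.
Qed.

Lemma bounded_Rintegral_time w : a <= b ->
  `|\int[mu]_(t in `[a, b]) F (t, w)| <= K * (b - a).
Proof.
move=> ab; apply: le_trans (le_normr_Rintegral _ _) _ => //.
  exact: bounded_integrable_time.
have : \int[mu]_(t in `[a, b]) K = K * (b - a).
  by rewrite Rintegral_cst//= lebesgue_measure_itv/= lte_fin; case: ltgtP ab => //= ->; rewrite subrr.
move=> <-; apply: le_Rintegral => //.
- by apply/integrable_norm; exact: bounded_integrable_time.
- apply: measurable_bounded_integrable => //.
    by rewrite /= lebesgue_measure_itv/=; case: ifP => _; rewrite ?ltry.
  by exists `|K|; split; [exact: num_real|move=> x Kx t _; exact: ltW].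
- by move=> t; rewrite /= in_itv/=; exact: FK.
Qed.

Lemma bounded_Rintegral_swap :
  \int[P]_w \int[mu]_(t in `[a, b]) F (t, w) =
  \int[mu]_(t in `[a, b]) \int[P]_w F (t, w).
Proof.
have mFD : measurable_fun setT ((EFin \o F) \_ D).
  by apply/(measurable_restrictT _ _).1 => //; exact: measurable_strip.
have iFD : (mu \x P)%E.-integrable setT ((EFin \o F) \_ D).
  apply/(@integrable12ltyP _ _ _ Om R mu P) => //.
  have absD p : `|((EFin \o F) \_ D) p|%E = ((fun p => `|(EFin \o F) p|%E) \_ D) p.
    by rewrite !patchE; case: ifPn => // _; rewrite abse0.
  under eq_integral do under eq_integral do rewrite absD.
  under eq_integral do rewrite (integral_patch_outcome (fun p => `|(EFin \o F) p|%E)).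
  rewrite -integral_mkcond.
  apply: (@le_lt_trans _ _ (\int[mu]_(t in `[a, b]) K%:E)%E).
    apply: ge0_le_integral => //.
    - by move=> t _; apply: integral_ge0.
    - apply: (@measurable_integral_outcome (fun p => `|(EFin \o F) p|%E)) => //.
      exact: measurableT_comp.
    - move=> t; rewrite /= in_itv/= => tab.
      have -> : (K%:E = \int[P]_w K%:E)%E.
        by rewrite integral_cst//= probability_setT mule1.
      apply: ge0_le_integral => //.
      + apply/measurable_EFinP/measurableT_comp => //.
        exact: (measurable_strip_outcome mF).
      + by move=> w _; rewrite lee_fin; exact: FK.
  rewrite integral_cst//= lebesgue_measure_itv/=.
  by case: ifP => _; rewrite ?mule0 ?ltry// -EFinB -EFinM ltry.
have := @Fubini _ _ _ Om R mu P _ iFD.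
under eq_integral do rewrite integral_patch_outcome.
rewrite -integral_mkcond; under [X in _ = X -> _]eq_integral do rewrite integral_patch_time.
rewrite /= => E.
rewrite /Rintegral; congr fine.
transitivity (\int[P]_w \int[mu]_(t in `[a, b]) (F (t, w))%:E)%E.
  apply: eq_integral => w _; rewrite fineK//.
  by apply: integrable_fin_num => //; exact: bounded_integrable_time.
rewrite -E; apply: eq_integral => t; rewrite inE /= in_itv/= => tab.
by rewrite fineK//; apply: integrable_fin_num => //; exact: bounded_integrable_outcome.
Qed.

End Bounded.

End TimeFubini.

(** * Right-continuous processes and running maxima *)

Section Grid.
Context (R : realType) (a b : R).

Definition grid (n k : nat) : R := Num.min b (a + k%:R / n.+1%:R).

(** The index of the first grid point strictly after [t]. *)
Definition grid_succ (n : nat) (t : R) : nat := (Num.truncn ((t - a) * n.+1%:R)).+1.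

Definition grid_size (n : nat) : nat := grid_succ n b.

Lemma grid_le n k l : (k <= l)%N -> grid n k <= grid n l.
Proof.
by move=> kl; apply: le_min2 => //; rewrite lerD2l ler_wpM2r// ler_nat.
Qed.

Lemma grid_itv n k : a <= b -> a <= grid n k <= b.
Proof.
move=> ab; rewrite /grid ge_min lexx/= andbT le_min ab/= lerDl.
by rewrite divr_ge0.
Qed.

Lemma grid_succ_gt n t : a <= t -> t < a + (grid_succ n t)%:R / n.+1%:R.
Proof.
move=> at_; have /truncn_itv/andP[_] : 0 <= (t - a) * n.+1%:R.
  by rewrite mulr_ge0// subr_ge0.
by rewrite -ltrBlDl ltr_pdivlMr.
Qed.

Lemma grid_succ_le n t : a <= t -> a + (grid_succ n t)%:R / n.+1%:R <= t + n.+1%:R^-1.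
Proof.
move=> at_; have /truncn_itv/andP[+ _] : 0 <= (t - a) * n.+1%:R.
  by rewrite mulr_ge0// subr_ge0.
rewrite -ler_pdivrMr// /grid_succ; set k := Num.truncn _ => h.
by rewrite -[k.+1%:R]natr1 mulrDl mul1r addrA lerD2r -lerBrDl.
Qed.

Lemma grid_size_end n : a <= b -> grid n (grid_size n) = b.
Proof. by move=> ab; apply/min_idPl/ltW/grid_succ_gt. Qed.

Lemma grid_succ_size n t : a <= t <= b -> (grid_succ n t <= grid_size n)%N.
Proof.
move=> /andP[at_ tb]; rewrite /grid_size /grid_succ ltnS le_truncn//.
by rewrite ler_wpM2r// lerB.
Qed.

(** The approximating points are strictly to the right of [t], except at the
    end [b] where they are equal to it, so right continuity is enough. *)
Lemma grid_succ_cvg (y : R -> R) t : a <= t <= b ->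
  (t < b -> y s @[s --> t^'+] --> y t) ->
  y (grid n (grid_succ n t)) @[n --> \oo] --> y t.
Proof.
move=> /andP[at_]; rewrite le_eqVlt => /predU1P[tb _|tb /(_ tb) /cvg_at_rightP].
  move: at_; rewrite tb => ab.
  under eq_fun do rewrite -/(grid_size _) (grid_size_end _ ab).
  exact: cvg_cst.
apply; split => [n|].
  by rewrite /grid lt_min tb grid_succ_gt.
apply: (@squeeze_cvgr _ _ _ _ (fun=> t) (fun n => t + n.+1%:R^-1)).
- near=> n; rewrite /grid le_min (ltW tb) (ltW (grid_succ_gt _ at_)) ge_min.
  by rewrite grid_succ_le// orbT.
- exact: cvg_cst.
- by rewrite -[X in _ --> X]addr0; apply: cvgD; [exact: cvg_cst|exact: cvg_harmonic].
Unshelve. all: by end_near. Qed.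

End Grid.

Section RightContinuous.
Context (R : realType) (d : measure_display) (Om : measurableType d) (a b : R).
Variable Y : R -> Om -> R.
Hypothesis mY : forall t, a <= t <= b -> measurable_fun setT (Y t).
Hypothesis rY : forall w t, a <= t < b -> Y s w @[s --> t^'+] --> Y t w.

(** A right-continuous process is a limit of processes that are piecewise
    constant in time. *)
Lemma measurable_right_continuous : a <= b ->
  measurable_fun (`[a, b]%classic `*` [set: Om] : set (R * Om))
    (fun p => Y p.1 p.2).
Proof.
move=> ab.
apply: (@measurable_fun_cvg _ _ _ _
  (fun n p => Y (grid a b n (grid_succ a n p.1)) p.2)); last first.
  move=> [t w] [/= + _]; rewrite in_itv/= => tab.
  apply: (@grid_succ_cvg _ _ _ (Y ^~ w) _ tab) => tb.
  by apply: rY; rewrite tb andbT; case/andP: tab.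
move=> n mD U mU.
have -> : (`[a, b]%classic `*` [set: Om] : set (R * Om)) `&`
    (fun p => Y (grid a b n (grid_succ a n p.1)) p.2) @^-1` U =
  \bigcup_k ((`[a, b]%classic `&` `[a + k%:R / n.+1%:R, a + k.+1%:R / n.+1%:R[%classic)
     `*` (Y (grid a b n k.+1) @^-1` U)).
  apply/seteqP; split => [[t w] [[/= tab _] YU]|[t w] [k _ [/= [tab tk] YU]]].
    move: (tab); rewrite in_itv/= => /andP[at_ tb].
    exists (grid_succ a n t).-1 => //; split => //=; split => //.
    rewrite in_itv/= grid_succ_gt// andbT -lerBrDl ler_pdivrMr//.
    by have /truncn_itv/andP[] : 0 <= (t - a) * n.+1%:R by rewrite mulr_ge0// subr_ge0.
  split => //=; rewrite (_ : grid_succ a n t = k.+1)//; congr S.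
  apply: truncn_def; move: tk; rewrite in_itv/= => /andP[h1 h2].
  by rewrite -ler_pdivrMr// -ltr_pdivlMr// lerBrDl ltrBlDl h1 h2.
apply: bigcupT_measurable => k; apply: measurableX.
  exact: measurableI.
by rewrite -[X in measurable X]setTI; apply: mY => //; exact: grid_itv.
Qed.

End RightContinuous.

Section RunningMaximum.
Context (R : realType).
Implicit Types (s : nat -> R) (n : nat).

Fixpoint runmax s n : R :=
  if n is n'.+1 then Num.max (runmax s n') `|s n| else `|s 0%N|.

Lemma runmax_ge0 s n : 0 <= runmax s n.
Proof. by elim: n => [|n IH]; rewrite //= le_max IH. Qed.

Lemma runmax_le s n k : (k <= n)%N -> `|s k| <= runmax s n.
Proof.
elim: n => [|n IH]; first by rewrite leqn0 => /eqP ->.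
rewrite leq_eqVlt => /predU1P[->|]; first by rewrite /= le_max lexx orbT.
by rewrite ltnS => /IH h; rewrite /= le_max h.
Qed.

(** Pathwise form of Doob's inequality: the running maximum is integrated
    against the increments, and it can only grow at its own current value. *)
Lemma runmax_sqr_le s n :
  (runmax s n) ^+ 2 + 4 * (\sum_(i < n) (runmax s i * Num.sg (s i)) * (s i.+1 - s i))
    <= 4 * (s n) ^+ 2.
Proof.
set S := \sum_(i < n) _.
suff H : 2 * S <= 2 * (runmax s n * `|s n|) - (runmax s n) ^+ 2.
  have := sqr_ge0 (runmax s n - 2 * `|s n|).
  by have := real_normK (num_real (s n)); nra.
rewrite {}/S; elim: n => [|n IH].
  by rewrite big_ord0 mulr0 /=; have := sqr_ge0 `|s 0%N|; nra.
rewrite big_ord_recr/= mulrDr.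
have H0 := runmax_ge0 s n; have Hn := runmax_le s (leqnn n).
set m := runmax s n in IH H0 Hn *.
have sg1 : Num.sg (s n) * s n.+1 <= `|s n.+1|.
  by apply: le_trans (ler_norm _) _; rewrite normrM ler_piMl// normr_sg; case: (_ != _).
have sg2 : Num.sg (s n) * s n = `|s n| by rewrite [`|s n|]normrEsg.
have sgm : m * Num.sg (s n) * (s n.+1 - s n) <= m * (`|s n.+1| - `|s n|).
  by rewrite -mulrA ler_wpM2l// mulrBr sg2 lerB.
have a0 := normr_ge0 (s n.+1).
rewrite /= -/m; case: (leP m `|s n.+1|) => h; nra.
Qed.

End RunningMaximum.

(** * Doob's maximal inequality in the mean square *)

Section MeasurableWrt.
Context (R : realType) (Om : pointedType).
Implicit Types (G : set (set Om)) (f g : Om -> R).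

Lemma measurable_wrtS G G' f : sigma_algebra setT G -> sigma_algebra setT G' ->
  G `<=` G' -> measurable_wrt G setT f -> measurable_wrt G' setT f.
Proof.
move=> sG sG' GG' mf _ U mU; rewrite /measurable/= sigma_algebra_id//; apply: GG'.
by have := mf measurableT _ mU; rewrite /measurable/= sigma_algebra_id.
Qed.

Lemma measurable_sgr (d : measure_display) (T : measurableType d) (D : set T)
  (f : T -> R) : measurable_fun D f -> measurable_fun D (fun x => Num.sg (f x)).
Proof.
move=> mf.
have msg : measurable_fun [set: R] (Num.sg : R -> R).
  apply: nondecreasing_measurable => // x y xy.
  case: (ltrgtP x 0) => x0; case: (ltrgtP y 0) => y0.
  all: rewrite ?x0 ?y0 ?(gtr0_sg x0) ?(ltr0_sg x0) ?(gtr0_sg y0) ?(ltr0_sg y0) ?sgr0.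
  all: try lra.
exact: measurableT_comp.
Qed.

End MeasurableWrt.

Section Doob.
Context (R : realType) (d : measure_display) (Om : measurableType d).
Context (P : probability Om R) (a b : R) (F : R -> set (set Om)).
Hypothesis ab : a <= b.
Hypothesis sF : forall t, a <= t <= b -> sigma_algebra setT (F t).
Hypothesis FM : forall t, a <= t <= b -> F t `<=` measurable.
Hypothesis FS : forall s t, a <= s -> s <= t -> t <= b -> F s `<=` F t.
Variable m : R -> Om -> R.
Hypothesis mF : forall t, a <= t <= b -> measurable_wrt (F t) setT (m t).
Hypothesis m2 : forall t, a <= t <= b -> sqint P (m t).
Hypothesis mM : forall s t B, a <= s -> s <= t -> t <= b -> F s B ->
  (\int[P]_(w in B) (m t w - m s w)%:E = 0)%E.

Lemma runmax_adapted (n k : nat) :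
  measurable_wrt (F (grid a b n k)) setT (fun w => runmax (fun i => m (grid a b n i) w) k).
Proof.
have gi i := grid_itv n i ab.
elim: k => [|k IH] /=; first by apply: measurableT_comp => //; exact: mF.
apply: measurable_maxr; last by apply: measurableT_comp => //; exact: mF.
apply: measurable_wrtS IH; [exact: sF|exact: sF|].
by apply: FS; rewrite ?grid_le//; [case/andP: (gi k)|case/andP: (gi k.+1)].
Qed.

Lemma runmax_sqint (n k : nat) : sqint P (fun w => runmax (fun i => m (grid a b n i) w) k).
Proof.
have gi i := grid_itv n i ab.
elim: k => [|k IH] /=; first by apply: sqint_norm; exact: m2.
have sk := sqint_norm (m2 (gi k.+1)).
apply: (le_sqint _ (integrableD_EFin (sqint_sqr IH) (sqint_sqr sk))).
  by apply: measurable_maxr; [exact: (sqint_measurable IH)|exact: (sqint_measurable sk)].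
move=> w; rewrite maxEle; case: ifP => _; rewrite ?lerDl ?lerDr sqr_ge0//.
Qed.

(** Doob's inequality along a grid: the sum in [runmax_sqr_le] is a martingale
    transform, of mean zero. *)
Lemma doob_grid (n : nat) :
  (\int[P]_w ((runmax (fun i => m (grid a b n i) w) (grid_size a b n)) ^+ 2)%:E
   <= 4%:E * \int[P]_w ((m b w) ^+ 2)%:E)%E.
Proof.
have gi i := grid_itv n i ab.
have bb : a <= b <= b by rewrite ab lexx.
set N := grid_size a b n.
have mono i : a <= grid a b n i /\ grid a b n i <= grid a b n i.+1 /\ grid a b n i.+1 <= b.
  by split; [case/andP: (gi i)|split; [exact: grid_le|case/andP: (gi i.+1)]].
pose H i w := runmax (fun i => m (grid a b n i) w) i * Num.sg (m (grid a b n i) w).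
pose dm i w := m (grid a b n i.+1) w - m (grid a b n i) w.
have dm2 i : sqint P (dm i) by apply: sqintB; apply: m2.
have HF i : measurable_wrt (F (grid a b n i)) setT (H i).
  by apply: measurable_funM; [exact: runmax_adapted|apply: measurable_sgr; exact: mF].
have H2 i : sqint P (H i).
  have := runmax_sqint n i => h.
  have -> : H i = fun w => Num.sg (m (grid a b n i) w) * runmax (fun i => m (grid a b n i) w) i.
    by apply/funext => w; rewrite mulrC.
  apply: (@sqintMb _ _ _ _ 1) => //.
    by apply: measurable_sgr; apply: sqint_measurable; apply: m2.
  by move=> w; rewrite normr_sg; case: (_ != _) => /=; rewrite ?ler01.
have Hdm i : P.-integrable setT (fun w => (H i w * dm i w)%:E) by exact: sqintM_integrable.
have E0 i : (\int[P]_w (H i w * dm i w)%:E = 0)%E.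
  apply: (orth_measurable_wrt (sF (gi i)) (FM (gi i))) => //.
  - exact: sqint_integrable.
  - by move=> B FB; have [? [? ?]] := mono i; exact: mM.
have isum : P.-integrable setT (fun w => (4 * \sum_(i < N) H i w * dm i w)%:E).
  apply: (@integrableZ_EFin _ _ _ _ 4 (fun w => \sum_(i < N) H i w * dm i w)).
  rewrite /comp; under eq_fun do rewrite -sumEFin.
  by apply: integrable_sum => // i _; exact: Hdm.
have im := sqint_sqr (runmax_sqint n N).
have imb := sqint_sqr (m2 bb).
have -> : (4%:E * \int[P]_w (m b w ^+ 2)%:E = \int[P]_w (4 * m b w ^+ 2)%:E)%E.
  by under [RHS]eq_integral do rewrite EFinM; rewrite integralZl.
rewrite -[leLHS]adde0.
have <- : (\int[P]_w (4 * \sum_(i < N) H i w * dm i w)%:E = 0)%E.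
  under eq_integral do rewrite EFinM -sumEFin.
  rewrite integralZl//; last by apply: integrable_sum => // i _; exact: Hdm.
  rewrite integral_sum//.
  by rewrite [X in (_ * X)%E](_ : _ = 0%E) ?mule0 //; apply: big1 => i _; exact: E0.
rewrite -integralD//.
apply: le_integral => //.
- exact: integrableD.
- exact: integrableZ_EFin.
- move=> w _; rewrite -EFinD lee_fin.
  have := @runmax_sqr_le _ (fun i => m (grid a b n i) w) N.
  by rewrite /N (grid_size_end _ ab).
Qed.

Hypothesis mr : forall w t, a <= t < b -> m s w @[s --> t^'+] --> m t w.

(** The lower limit of the squared maxima along finer and finer grids dominates
    the whole path by right continuity, and Fatou's lemma bounds its mean. The
    bound [S] stands for the supremum of the path: it is measurable by
    construction. *)
Lemma doob_maximal_inequality : exists S : Om -> \bar R,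
  [/\ measurable_fun setT S, forall w, (0 <= S w)%E,
      forall w t, a <= t <= b -> (((m t w) ^+ 2)%:E <= S w)%E &
      (\int[P]_w S w <= 4%:E * \int[P]_w ((m b w) ^+ 2)%:E)%E].
Proof.
pose M n w := ((runmax (fun i => m (grid a b n i) w) (grid_size a b n)) ^+ 2)%:E.
have mM' n : measurable_fun setT (M n).
  by apply/measurable_EFinP/measurable_funX; apply: sqint_measurable; apply: runmax_sqint.
have M0 n w : (0 <= M n w)%E by rewrite lee_fin sqr_ge0.
have einf0 w n : (0 <= einfs (M ^~ w) n)%E.
  by apply: le_ereal_inf_tmp => _ [k _ <-]; exact: M0.
exists (fun w => limn_einf (M ^~ w)); split.
- under eq_fun do rewrite limn_einf_lim.
  apply: (@emeasurable_fun_cvg _ _ _ _ (fun n w => einfs (M ^~ w) n)).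
    by move=> n; exact: measurable_fun_einfs.
  by move=> w _; exact: is_cvg_einfs.
- move=> w; rewrite limn_einf_lim; apply: lime_ge; first exact: is_cvg_einfs.
  by near=> n; exact: einf0.
- move=> w t tab.
  pose v n := ((m (grid a b n (grid_succ a n t)) w) ^+ 2)%:E.
  have vl : v n @[n --> \oo] --> ((m t w) ^+ 2)%:E.
    apply/fine_cvgP; split; first by near=> n.
    rewrite /comp /=; under eq_fun do rewrite expr2; rewrite expr2.
    by apply: cvgM; apply: (@grid_succ_cvg _ _ _ (m ^~ w) _ tab) => tb;
      apply: mr; rewrite tb andbT; case/andP: tab.
  have vM n : (v n <= M n w)%E.
    rewrite lee_fin -[leLHS]real_normK ?num_real// lerXn2r ?nnegrE ?runmax_ge0//.
    exact: (@runmax_le _ (fun i => m (grid a b n i) w) _ _ (grid_succ_size n tab)).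
  rewrite -(cvg_lim _ (cvg_einfs vl))// limn_einf_lim.
  apply: lee_lim; [exact: is_cvg_einfs|exact: is_cvg_einfs|].
  near=> n; apply: le_ereal_inf_tmp => _ [k /= nk <-].
  by apply: le_trans (vM k); apply: ereal_inf_lbound; exists k.
- apply: le_trans (fatou P measurableT mM' (fun n w _ => M0 n w)) _ => //.
  rewrite limn_einf_lim; apply: lime_le; first exact: is_cvg_einfs.
  near=> n; apply: le_trans (doob_grid n).
  by apply: ereal_inf_lbound; exists n => /=.
Unshelve. all: by end_near. Qed.

End Doob.

(** * The filtration and the paths of the chain *)

Section Filtration.
Context (R : realType) (d : measure_display) (Om : measurableType d).
Context (P : probability Om R) (N : nat) (X : R -> Om -> 'cV[R]_N).
Hypothesis HX : rcll_markov_chain P X.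
Local Notation F := (filtration P X).

Lemma filtration_sigma t : sigma_algebra setT (F t).
Proof. exact: smallest_sigma_algebra. Qed.

Lemma filtration_measurable t : F t `<=` measurable.
Proof.
apply: smallest_sub; first exact: sigma_algebra_measurable.
move=> B [[s [i [/andP[s0 _] ->]]]|[//]].
by case: HX => _ mX _ _; exact: mX.
Qed.

Lemma filtration_measurable_fun t (f : Om -> R) :
  measurable_wrt (F t) setT f -> measurable_fun setT f.
Proof.
apply: (measurable_wrt_fun (filtration_sigma t) (@filtration_measurable t)).
by case: (filtration_sigma t) => F0 FC _; rewrite -[setT]setD0; exact: FC.
Qed.

Lemma filtrationS s t : s <= t -> F s `<=` F t.
Proof.
move=> st; apply: sub_sigma_algebra2 => B [[u [i [/andP[u0 us] ->]]]|nB].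
  by left; exists u, i; rewrite u0 (le_trans us).
by right.
Qed.

Lemma filtration_null t B : measurable B -> P B = 0%E -> F t B.
Proof. by move=> mB PB; apply: sub_sigma_algebra; right. Qed.

(** The filtration contains the null events, so an adapted value may be changed
    on a null event without losing adaptedness. *)
Lemma measurable_wrt_ae t (f g : Om -> R) (B : set Om) :
  measurable B -> P B = 0%E -> (forall w, ~ B w -> f w = g w) ->
  measurable_fun setT g ->
  measurable_wrt (F t) setT f -> measurable_wrt (F t) setT g.
Proof.
move=> mB PB fg mg mf _ U mU.
rewrite /measurable/= (sigma_algebra_id (filtration_sigma t)) setTI.
have -> : g @^-1` U = ((f @^-1` U) `\` B) `|` (g @^-1` U `&` B).
  apply/seteqP; split => [w gU|w [[fU nB]|[]//]].
    by have [Bw|nB] := pselect (B w); [right|left; split => //=; rewrite fg].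
  by rewrite /= -fg.
pose T' := g_sigma_algebraType (F t).
have id_ (C : set Om) : F t C = measurable (C : set T').
  by rewrite /measurable/= (sigma_algebra_id (filtration_sigma t)).
rewrite id_; apply: measurableU.
  apply: measurableD; last by rewrite -id_; exact: filtration_null.
  by have := mf measurableT U mU; rewrite setTI.
rewrite -id_; apply: filtration_null.
  by apply: measurableI => //; rewrite -[X in measurable X]setTI; exact: mg.
apply/eqP; rewrite eq_le measure_ge0 andbT -PB le_measure ?inE//.
by apply: measurableI => //; rewrite -[X in measurable X]setTI; exact: mg.
Qed.

End Filtration.

Section ChainPaths.
Context (R : realType) (d : measure_display) (Om : measurableType d).
Context (P : probability Om R) (N : nat) (X : R -> Om -> 'cV[R]_N).
Hypothesis HX : rcll_markov_chain P X.
Local Notation F := (filtration P X).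

Lemma chain_unit t w : 0 <= t -> exists i, X t w = unit_vector R i.
Proof. by case: HX => h _ _ _; exact: h. Qed.

Lemma chain_coordE i t w : 0 <= t ->
  X t w i 0 = (X t w == unit_vector R i)%:R.
Proof.
move=> t0; have [j ->] := chain_unit w t0.
rewrite /unit_vector mxE eqxx andbT; congr (nat_of_bool _)%:R; apply/idP/eqP.
  by move=> /eqP ->.
by move/matrixP/(_ i 0); rewrite !mxE !eqxx !andbT; case: (i =P j) => // _ /esym/eqP; rewrite oner_eq0.
Qed.

Lemma chain_coord_mul i j t w : 0 <= t ->
  X t w i 0 * X t w j 0 = (i == j)%:R * X t w i 0.
Proof.
move=> t0; have [k ->] := chain_unit w t0; rewrite /unit_vector !mxE eqxx !andbT.
case: (eqVneq i k) => [->|]; last by rewrite mul0r mulr0.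
by rewrite mul1r mulr1 eq_sym.
Qed.

Lemma chain_coord_itv i t w : 0 <= t -> 0 <= X t w i 0 <= 1.
Proof. by move=> t0; rewrite chain_coordE//; case: (_ == _); rewrite ?lexx ?ler01. Qed.

Lemma chain_coord_adapted i s t : 0 <= s <= t -> measurable_wrt (F t) setT (fun w => X s w i 0).
Proof.
move=> /andP[s0 st].
have -> : (fun w => X s w i 0) = \1_(X s @^-1` [set unit_vector R i]).
  apply/funext => w; rewrite chain_coordE// indicE; congr (nat_of_bool _)%:R.
  by apply/eqP/idP => [h|/set_mem]; [exact/mem_set|].
apply: measurable_indic; rewrite /measurable/= (sigma_algebra_id (filtration_sigma P X t)).
by apply: sub_sigma_algebra; left; exists s, i; rewrite s0.
Qed.

Lemma chain_coord_measurable i t : 0 <= t -> measurable_fun setT (fun w => X t w i 0).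
Proof.
move=> t0; apply: (filtration_measurable_fun HX (t := t)).
by apply: chain_coord_adapted; rewrite t0 lexx.
Qed.

Lemma chain_coord_right_continuous i t w : 0 <= t -> X s w i 0 @[s --> t^'+] --> X t w i 0.
Proof.
move=> t0; have [_ _ rX _] := HX; have [r _] := rX (t + 1) w.
have tt : 0 <= t < t + 1 by rewrite t0 ltrDl ltr01.
have := @cvg_comp _ _ _ (X ^~ w) (fun M : 'cV[R]_N => M i 0) _ _ _ (r t tt).
by apply; exact: (@coord_continuous _ N 1 i 0).
Qed.

Lemma chain_coord_joint i T : 0 <= T ->
  measurable_fun (`[0, T]%classic `*` [set: Om] : set (R * Om))
    (fun p => X p.1 p.2 i 0).
Proof.
move=> T0; apply: (@measurable_right_continuous _ _ _ 0 T (fun t w => X t w i 0)) => //.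
- by move=> t /andP[t0 _]; exact: chain_coord_measurable.
- by move=> w t /andP[t0 _]; exact: chain_coord_right_continuous.
Qed.

(** The unit vectors are isolated from each other. *)
Lemma chain_locally_constant t w : 0 <= t ->
  exists2 e : R, 0 < e & forall s, t < s < t + e -> X s w = X t w.
Proof.
move=> t0; have [i Xi] := chain_unit w t0.
have := @chain_coord_right_continuous i t w t0.
rewrite Xi /unit_vector mxE !eqxx/= => /cvgrPdist_lt /(_ 1 ltr01).
move=> /nbhs_ballP[e /= e0 h]; exists e => // s /andP[ts ste].
have s0 : 0 <= s by exact: le_trans t0 (ltW ts).
have := h s; rewrite /ball/= ltr0_norm ?subr_lt0// opprB ltrBlDl => /(_ ste ts).
rewrite chain_coordE//; case: eqP => [//|_].
by rewrite subr0 normr1 ltxx.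
Qed.

Definition jump_times (w : Om) : set R :=
  [set t | 0 <= t /\ left_limit X t w != X t w].

(** After each time the chain stays constant for a while, and these intervals
    contain no jump: choosing a rational in each of them labels the jump times
    injectively. *)
Lemma countable_jump_times w : countable (jump_times w).
Proof.
have /choice [e eP] : forall t : R, exists e : R, 0 <= t -> 0 < e /\ forall s, t < s < t + e -> X s w = X t w.
  move=> t; have [t0|t0] := leP 0 t; last by exists 0.
  by have [e e0 h] := chain_locally_constant w t0; exists e.
have nojump t s : 0 <= t -> t < s < t + e t -> ~ jump_times w s.
  move=> t0 /andP[ts ste] [s0 /eqP]; apply.
  rewrite /left_limit leNgt (le_lt_trans t0 ts)/=.
  have [e0 eX] := eP _ t0.
  rewrite (eX s) ?ts//.
  apply: cvg_lim; first exact: norm_hausdorff.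
  apply: cvg_near_cst; near=> u; apply: eX.
  apply/andP; split; first by near: u; exact: nbhs_left_gt.
  by apply: lt_trans ste; near: u; exact: nbhs_left_lt.
have /choice [q qP] : forall t : R, exists q : rat, 0 <= t -> t < ratr q < t + e t.
  move=> t; have [t0|t0] := leP 0 t; last by exists 0.
  have [e0 _] := eP _ t0.
  have /rat_in_itvoo[q] : t < t + e t by rewrite ltrDl.
  by rewrite in_itv/= => h; exists q.
apply/countable_injP; exists (pickle \o q) => s t /set_mem Js /set_mem Jt /=.
move=> /(pcan_inj pickleK) qst; have [s0 _] := Js; have [t0 _] := Jt.
have /andP[sq qs] := qP _ s0; have /andP[tq qt] := qP _ t0.
case: (ltrgtP s t) => // h; exfalso.
- by apply: (@nojump s t) => //; rewrite h (lt_trans _ qs)// qst.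
- by apply: (@nojump t s) => //; rewrite h (lt_trans _ qt)// -qst.
Unshelve. all: by end_near. Qed.

End ChainPaths.

(** * Countable exceptional sets and the bracket matrix *)

Section CountableException.
Context (R : realType).
Local Notation mu := (@lebesgue_measure R).

Lemma measurable_fun_countable d (U : measurableType d) (D N : set R) (f g : R -> U) :
  countable N -> (forall x, D x -> ~ N x -> f x = g x) ->
  measurable_fun D g -> measurable_fun D f.
Proof.
move=> cN fg mg mD Y mY.
have mN (B : set R) : B `<=` N -> measurable B.
  move=> BN; apply: countable_measurable => //.
  exact: sub_countable (subset_card_le BN) cN.
have -> : D `&` f @^-1` Y =
    ((D `&` g @^-1` Y) `\` N) `|` ((D `&` f @^-1` Y) `&` N).
  apply/seteqP; split => [x [Dx fY]|x [[[Dx gY] nN]|[]//]].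
    have [Nx|nNx] := pselect (N x); [by right|left; split => //; split => //=].
    by rewrite -fg.
  by split => //=; rewrite fg.
apply: measurableU; last by apply: mN.
by apply: measurableD; [exact: mg|exact: mN].
Qed.

Lemma integral_countable (D N : set R) (f g : R -> \bar R) :
  measurable D -> countable N -> (forall x, D x -> ~ N x -> f x = g x) ->
  measurable_fun D g ->
  (\int[mu]_(x in D) f x = \int[mu]_(x in D) g x)%E.
Proof.
move=> mD cN fg mg; apply: ae_eq_integral => //.
  exact: measurable_fun_countable fg mg.
exists N; split; [|exact: countable_lebesgue_measure0|].
  by apply: countable_measurable.
by move=> x /= h; apply: contrapT => nN; apply: h => Dx; exact: fg.
Qed.

End CountableException.

Section Bracket.
Context (R : realType) (N : nat).
Implicit Types (A : 'M[R]_N) (x C D : 'cV[R]_N).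

(** [Psi] as a function of the rate matrix and of the state of the chain. *)
Definition bracket A x : 'M[R]_N :=
  diag_mx (A *m x)^T - diag_mx x^T *m A^T - A *m diag_mx x^T.

Lemma bracketE A x i j : bracket A x i j =
  (i == j)%:R * (A *m x) i 0 - x i 0 * A j i - A i j * x j 0.
Proof.
by rewrite /bracket mul_diag_mx mul_mx_diag !mxE -[X in X - _ - _]mulr_natl.
Qed.

Definition bracket_form A x C : R := (C^T *m bracket A x *m C) 0 0.

Lemma bracket_formE A x C :
  bracket_form A x C = \sum_i \sum_j C i 0 * C j 0 * bracket A x i j.
Proof.
rewrite /bracket_form mxE; under eq_bigr do rewrite mxE mulr_suml.
rewrite exchange_big/=; apply: eq_bigr => i _; apply: eq_bigr => j _.
by rewrite mxE; ring.
Qed.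

Definition rate A := (forall i j, i != j -> 0 <= A i j) /\ (forall j, \sum_i A i j = 0).

(** In state [k] the bracket is the covariance rate of the jumps from [k], so
    the quadratic form averages the squared jumps of [C]. *)
Lemma bracket_form_unit A k C : rate A ->
  bracket_form A (unit_vector R k) C = \sum_i A i k * (C i 0 - C k 0) ^+ 2.
Proof.
move=> [_ /(_ k) A0]; rewrite bracket_formE.
have E i : (A *m unit_vector R k) i 0 = A i k by rewrite -colE mxE.
have U i : unit_vector R k i 0 = (i == k)%:R by rewrite mxE eqxx andbT.
have delta (l : 'I_N) (f : 'I_N -> R) : \sum_i (i == l)%:R * f i = f l.
  rewrite (bigD1 l)//= eqxx mul1r big1 ?addr0// => i /negbTE ->.
  by rewrite mul0r.
have inner i : \sum_j C i 0 * C j 0 * bracket A (unit_vector R k) i j =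
    A i k * (C i 0) ^+ 2 - (i == k)%:R * (C i 0 * \sum_j C j 0 * A j k)
    - C i 0 * C k 0 * A i k.
  transitivity (\sum_j ((j == i)%:R * (C i 0 * C j 0 * A i k)
      - (i == k)%:R * (C i 0 * (C j 0 * A j k))
      - (j == k)%:R * (C i 0 * C j 0 * A i j))).
    apply: eq_bigr => j _; rewrite bracketE E !U (eq_sym i j).
    by have [->|_] := eqVneq i k; rewrite ?mulr1n ?mulr0n; ring.
  by rewrite !sumrB !delta -!mulr_sumr; ring.
under eq_bigr do rewrite inner.
rewrite !sumrB delta mulr_sumr -!sumrB.
have Z : \sum_i (C k 0) ^+ 2 * A i k = 0 by rewrite -mulr_sumr A0 mulr0.
rewrite -[LHS]addr0 -[X in _ + X]Z -big_split/=.
by apply: eq_bigr => i _; ring.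
Qed.

Lemma bracket_form_ge0 A k C : rate A -> 0 <= bracket_form A (unit_vector R k) C.
Proof.
move=> rA; rewrite bracket_form_unit//; apply: sumr_ge0 => i _.
have [->|ik] := eqVneq i k; first by rewrite subrr expr0n mulr0.
by rewrite mulr_ge0 ?sqr_ge0//; case: rA => h _; exact: h.
Qed.

Lemma bracket_formD A k C D : rate A ->
  bracket_form A (unit_vector R k) (C + D) <=
    2 * bracket_form A (unit_vector R k) C + 2 * bracket_form A (unit_vector R k) D.
Proof.
move=> rA; rewrite !bracket_form_unit// !mulr_sumr -big_split/=.
apply: ler_sum => i _; rewrite !mxE.
have [->|ik] := eqVneq i k; first by rewrite !subrr expr0n !mulr0 addr0.
have Aik : 0 <= A i k by case: rA => h _; exact: h.
rewrite !mulrA ![2 * _]mulrC -!mulrA -mulrDr ler_wpM2l//.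
by have := sqr_ge0 ((C i 0 - C k 0) - (D i 0 - D k 0)); nra.
Qed.

Lemma bracket_formN A x C : bracket_form A x (- C) = bracket_form A x C.
Proof.
rewrite !bracket_formE; apply: eq_bigr => i _; apply: eq_bigr => j _.
by rewrite !mxE mulrNN.
Qed.

End Bracket.

(** * The bracket along the paths of the chain *)

Section ChainBracket.
Context (R : realType) (d : measure_display) (Om : measurableType d).
Context (P : probability Om R) (N : nat) (A : R -> 'M[R]_N) (X : R -> Om -> 'cV[R]_N).
Hypothesis HX : rcll_markov_chain P X.
Hypothesis HA : rate_matrix A.
Local Notation F := (filtration P X).
Local Notation mu := (@lebesgue_measure R).
Local Notation strip a b := (`[a, b]%classic `*` [set: Om] : set (R * Om)).

Lemma rate_matrix_rate t : 0 <= t -> rate (A t).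
Proof. by case: HA => _ _ h1 h2 t0; split => [i j|j]; [exact: h1|exact: h2]. Qed.

(** The squared seminorm with the current state in place of the left limit. *)
Definition chain_form t w C := bracket_form (A t) (X t w) C.

Lemma chain_form_ge0 t w C : 0 <= t -> 0 <= chain_form t w C.
Proof.
move=> t0; rewrite /chain_form; have [k ->] := chain_unit HX w t0.
exact/bracket_form_ge0/rate_matrix_rate.
Qed.

Lemma chain_formD t w C D : 0 <= t ->
  chain_form t w (C + D) <= 2 * chain_form t w C + 2 * chain_form t w D.
Proof.
move=> t0; rewrite /chain_form; have [k ->] := chain_unit HX w t0.
exact/bracket_formD/rate_matrix_rate.
Qed.

Lemma chain_formN t w C : chain_form t w (- C) = chain_form t w C.
Proof. exact: bracket_formN. Qed.

Lemma chain_formB t w C D : 0 <= t ->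
  chain_form t w (C - D) <= 2 * chain_form t w C + 2 * chain_form t w D.
Proof. by move=> t0; rewrite -(chain_formN t w D); exact: chain_formD. Qed.

Lemma seminorm_sqr t w C : 0 <= t -> ~ jump_times X w t ->
  (seminorm A X t w C) ^+ 2 = chain_form t w C.
Proof.
move=> t0 nJ; have lX : left_limit X t w = X t w.
  by apply/eqP; apply: contrapT => h; apply: nJ; split => //; exact/negP.
rewrite /seminorm sqr_sqrtr; first by rewrite /Psi lX.
by rewrite /Psi lX; exact: chain_form_ge0.
Qed.

Lemma measurable_rate a b i j : 0 <= a ->
  measurable_fun (strip a b) (fun p => A p.1 i j).
Proof.
move=> a0; have [mA _ _ _] := HA.
apply: (measurable_comp (measurable_itv `[0, +oo[) _ (mA i j)) => //.
  by move=> _ [[t w] [/= + _] <-]; rewrite /= !in_itv/= andbT => /andP[/(le_trans a0)].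
by apply: measurable_funTS; exact: measurable_fst.
Qed.

Lemma measurable_coord a b i : 0 <= a ->
  measurable_fun (strip a b) (fun p => X p.1 p.2 i 0).
Proof.
move=> a0; have [ab|ba] := leP a b.
  apply: measurable_funS (chain_coord_joint HX i (le_trans a0 ab)).
    exact: measurable_strip.
  move=> [t w] [/= + _]; rewrite in_itv/= => /andP[ta tb]; split => //=.
  by rewrite in_itv/= (le_trans a0 ta).
have -> : strip a b = set0.
  apply/seteqP; split => // -[t w] [/= + _]; rewrite in_itv/= => /andP[ta tb].
  by move: (le_trans ta tb); rewrite leNgt ba.
exact: measurable_fun_set0.
Qed.

Definition drift i t w : R := (A t *m X t w) i 0.

Lemma measurable_drift a b i : 0 <= a ->
  measurable_fun (strip a b) (fun p => drift i p.1 p.2).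
Proof.
move=> a0; under [X in measurable_fun _ X]eq_fun do rewrite /drift mxE.
apply: measurable_sum => k; apply: measurable_funM.
  exact: measurable_rate.
exact: measurable_coord.
Qed.

Lemma measurable_bracket a b i j : 0 <= a ->
  measurable_fun (strip a b) (fun p => bracket (A p.1) (X p.1 p.2) i j).
Proof.
move=> a0; under [X in measurable_fun _ X]eq_fun do rewrite bracketE.
apply: measurable_funB; first apply: measurable_funB.
- by apply: measurable_funM => //; exact: measurable_drift.
- by apply: measurable_funM; [exact: measurable_coord|exact: measurable_rate].
- by apply: measurable_funM; [exact: measurable_rate|exact: measurable_coord].
Qed.

Lemma measurable_chain_form a b (C : R -> Om -> 'cV[R]_N) : 0 <= a ->
  (forall i, measurable_fun (strip a b) (fun p => C p.1 p.2 i 0)) ->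
  measurable_fun (strip a b) (fun p => chain_form p.1 p.2 (C p.1 p.2)).
Proof.
move=> a0 mC.
under [X in measurable_fun _ X]eq_fun do rewrite /chain_form bracket_formE.
apply: measurable_sum => i; apply: measurable_sum => j.
by apply: measurable_funM; [exact: measurable_funM|exact: measurable_bracket].
Qed.

(** The left limits differ from the states only at the countably many jump
    times. *)
Lemma integral_seminorm_sqr a b (C : R -> Om -> 'cV[R]_N) w : 0 <= a ->
  (forall i, measurable_fun (strip a b) (fun p => C p.1 p.2 i 0)) ->
  (\int[mu]_(t in `[a, b]) ((seminorm A X t w (C t w)) ^+ 2)%:E =
   \int[mu]_(t in `[a, b]) (chain_form t w (C t w))%:E)%E.
Proof.
move=> a0 mC; apply: (@integral_countable _ _ (jump_times X w)) => //.
- exact: (countable_jump_times HX).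
- move=> t; rewrite /= in_itv/= => /andP[ta _] nJ.
  by rewrite seminorm_sqr// (le_trans a0).
- apply/measurable_EFinP.
  exact: (measurable_strip_time (measurable_chain_form a0 mC) w).
Qed.

Definition rate_bound (K : R) := 0 <= K /\ forall t i j, 0 <= t -> `|A t i j| <= K.

Lemma rate_bound_exists : exists K, rate_bound K.
Proof.
have [_ [K hK] _ _] := HA; exists `|K|; split => // t i j t0.
exact: le_trans (hK t i j t0) (ler_norm _).
Qed.

Lemma drift_bound K i t w : rate_bound K -> 0 <= t -> `|drift i t w| <= K.
Proof.
move=> [_ hK] t0; rewrite /drift; have [k ->] := chain_unit HX w t0.
by rewrite -colE mxE; exact: hK.
Qed.

Lemma chain_coord_bound i t w : 0 <= t -> `|X t w i 0| <= 1.
Proof.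
by move=> t0; have /andP[h0 h1] := chain_coord_itv HX i w t0; rewrite ger0_norm.
Qed.

Lemma bracket_bound K i j t w : rate_bound K -> 0 <= t ->
  `|bracket (A t) (X t w) i j| <= 3 * K.
Proof.
move=> hK t0; rewrite bracketE.
have b1 : `|(i == j)%:R * (A t *m X t w) i 0| <= K.
  by rewrite normrM -[leRHS]mul1r ler_pM// ?drift_bound//; case: (i == j); rewrite ?normr1 ?normr0.
have b2 : `|X t w i 0 * A t j i| <= K.
  by rewrite normrM -[leRHS]mul1r ler_pM// ?chain_coord_bound//; exact: hK.2.
have b3 : `|A t i j * X t w j 0| <= K.
  by rewrite normrM -[leRHS]mulr1 ler_pM// ?chain_coord_bound//; exact: hK.2.
move: b1 b2 b3; set u := (_%:R * _); set v := X t w i 0 * _; set z := _ * X t w j 0.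
rewrite !ler_norml => /andP[? ?] /andP[? ?] /andP[? ?]; lra.
Qed.

End ChainBracket.

(** * The product rule for Lebesgue integrals *)

Section BoundedIntegrals.
Context (R : realType).
Local Notation mu := (@lebesgue_measure R).

Lemma bounded_integrable_itv (h : R -> R) (a b L : R) : measurable_fun (`[a, b]%classic : set R) h ->
  (forall u, a <= u <= b -> `|h u| <= L) ->
  mu.-integrable `[a, b] (EFin \o h).
Proof.
move=> mh hL; apply: measurable_bounded_integrable => //.
- by rewrite /= lebesgue_measure_itv/=; case: ifP => _; rewrite ?ltry.
- exists L; split; first exact: num_real.
  by move=> x Kx u; rewrite /= in_itv/= => /hL hu; apply: le_trans hu (ltW Kx).
Qed.

Lemma bounded_Rintegral_itv (h : R -> R) (a b L : R) : a <= b ->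
  measurable_fun (`[a, b]%classic : set R) h ->
  (forall u, a <= u <= b -> `|h u| <= L) ->
  `|\int[mu]_(u in `[a, b]) h u| <= L * (b - a).
Proof.
move=> ab mh hL; have ih := bounded_integrable_itv mh hL.
apply: le_trans (le_normr_Rintegral _ ih) _ => //.
have -> : L * (b - a) = \int[mu]_(u in `[a, b]) L.
  rewrite Rintegral_cst//= lebesgue_measure_itv/= lte_fin.
  by case: ltgtP ab => //= ->; rewrite subrr.
apply: le_Rintegral => //; [exact: integrable_norm|].
have L0 : 0 <= L by apply: le_trans (hL a _); rewrite ?lexx.
by apply: (@bounded_integrable_itv (cst L) _ _ L) => // u _; rewrite ger0_norm.
Qed.

End BoundedIntegrals.

Section ProductRule.
Context (R : realType) (s t K : R) (f g : R -> R).
Local Notation mu := (@lebesgue_measure R).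
Local Notation I := (`[s, t]%classic : set R).
Hypothesis st : s <= t.
Hypothesis mf : measurable_fun I f.
Hypothesis mg : measurable_fun I g.
Hypothesis fK : forall u, s <= u <= t -> `|f u| <= K.
Hypothesis gK : forall u, s <= u <= t -> `|g u| <= K.

Lemma Rintegral_itv_cut (h : R -> R) (u : R) : s <= u <= t ->
  mu.-integrable I (EFin \o h) ->
  \int[mu]_(v in `[u, t]) h v = \int[mu]_(v in I) h v - \int[mu]_(v in `[s, u]) h v.
Proof.
move=> /andP[su ut] ih.
rewrite (@Rintegral_itvB _ _ (BLeft s) (BRight t) u)//.
symmetry; apply: Rintegral_itv_obnd_cbnd.
apply: integrableS ih => // x; rewrite /= !in_itv/= => /andP[ux ->].
by rewrite (le_trans su (ltW ux)).
Qed.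

Local Notation sq := ((I `*` I) : set (R * R)).

Let F (p : R * R) : R := if p.2 <= p.1 then f p.1 * g p.2 else 0.

Let mF : measurable_fun sq F.
Proof.
have m1 : measurable_fun sq (fun p => f p.1).
  apply: (measurable_comp (measurable_itv _) _ mf) => //; first by move=> _ [p [? ?] <-].
  by apply: measurable_funTS; exact: measurable_fst.
have m2 : measurable_fun sq (fun p => g p.2).
  apply: (measurable_comp (measurable_itv _) _ mg) => //; first by move=> _ [p [? ?] <-].
  by apply: measurable_funTS; exact: measurable_snd.
have msq : measurable sq by exact: measurableX.
apply: measurable_fun_if => //.
- apply: measurable_fun_ler; apply: measurable_funTS.
    exact: measurable_snd.
  exact: measurable_fst.
- apply: (@measurable_funS _ _ _ _ sq) => //.
  exact: measurable_funM.
Qed.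

Let iF : (mu \x mu)%E.-integrable setT ((EFin \o F) \_ sq).
Proof.
have msq : measurable (sq : set (measurableTypeR R * measurableTypeR R)).
  exact: measurableX.
suff : (mu \x mu)%E.-integrable sq (EFin \o F) by move=> h; exact: ((integrable_mkcond _ msq).1 h).
apply: measurable_bounded_integrable => //.
- rewrite /= product_measure1E//= !lebesgue_measure_itv/=.
  by case: ifP => _; rewrite ?mule0 ?ltry// -EFinB -EFinM ltry.
- exists (K * K); split; first exact: num_real.
  move=> x Kx [u v] [/=]; rewrite !in_itv/= => us vs; rewrite /F /=.
  have K0 : 0 <= K by apply: le_trans (fK us).
  apply: (le_trans _ (ltW Kx)); case: ifP => _; last by rewrite normr0 mulr_ge0.
  by rewrite normrM ler_pM// ?fK ?gK.
Qed.

(** Fubini on the triangle below the diagonal of the square. *)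
Lemma swap_triangle :
  \int[mu]_(u in I) (f u * \int[mu]_(v in `[s, u]) g v) =
  \int[mu]_(v in I) (g v * \int[mu]_(u in `[v, t]) f u).
Proof.
have pF (h : R -> R) (a b : R) : measurable_fun I h ->
    (forall u, s <= u <= t -> `|h u| <= K) -> s <= a -> b <= t ->
    mu.-integrable `[a, b] (EFin \o h).
  move=> mh hK sa bt; apply: integrableS (bounded_integrable_itv mh hK) => //.
  by move=> x; rewrite /= !in_itv/= => /andP[/(le_trans sa) -> xb]; rewrite (le_trans xb).
have E1 u : (\int[mu]_v ((EFin \o F) \_ sq) (u, v) =
    ((EFin \o (fun u => f u * \int[mu]_(v in `[s, u]) g v)%R) \_ I) u)%E.
  rewrite patchE; case: ifPn => [/set_mem uI|nI]; last first.
    rewrite integral0_eq// => v _; rewrite patchE memNset// => -[/= uI _].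
    by move/negP: nI; apply; exact/mem_set.
  move: (uI); rewrite /= in_itv/= => /andP[su ut].
  transitivity (\int[mu]_(v in `[s, u]) ((f u)%:E * (g v)%:E))%E.
    rewrite [RHS]integral_mkcond; apply: eq_integral => v _.
    rewrite !patchE /F /=; have [vI|nvI] := boolP (v \in (`[s, u]%classic : set R)).
      have : (`[s, u]%classic : set R) v by exact/set_mem.
      rewrite /= in_itv/= => /andP[sv vu].
      by rewrite mem_set ?vu ?EFinM//; split => //=; rewrite in_itv/= sv (le_trans vu).
    case: ifPn => // /set_mem[_ /=]; rewrite in_itv/= => /andP[sv vt].
    case: ifPn => // vu; move/negP: nvI; case; apply/mem_set.
    by rewrite /= in_itv/= sv.
  rewrite integralZl//; last exact: pF.
  by rewrite /Rintegral EFinM fineK//; apply: integrable_fin_num => //; exact: pF.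
have E2 v : (\int[mu]_u ((EFin \o F) \_ sq) (u, v) =
    ((EFin \o (fun v => g v * \int[mu]_(u in `[v, t]) f u)%R) \_ I) v)%E.
  rewrite patchE; case: ifPn => [/set_mem vI|nI]; last first.
    rewrite integral0_eq// => u _; rewrite patchE memNset// => -[/= _ vI].
    by move/negP: nI; apply; exact/mem_set.
  move: (vI); rewrite /= in_itv/= => /andP[sv vt].
  transitivity (\int[mu]_(u in `[v, t]) ((g v)%:E * (f u)%:E))%E.
    rewrite [RHS]integral_mkcond; apply: eq_integral => u _.
    rewrite !patchE /F /=; have [uI|nuI] := boolP (u \in (`[v, t]%classic : set R)).
      have : (`[v, t]%classic : set R) u by exact/set_mem.
      rewrite /= in_itv/= => /andP[vu ut].
      by rewrite mem_set ?vu 1?mulrC ?EFinM//; split => //=; rewrite in_itv/= ut (le_trans sv).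
    case: ifPn => // /set_mem[/=]; rewrite !in_itv/= => /andP[su ut] _.
    case: ifPn => // vu; move/negP: nuI; case; apply/mem_set.
    by rewrite /= in_itv/= vu.
  rewrite integralZl//; last exact: pF.
  by rewrite /Rintegral EFinM fineK//; apply: integrable_fin_num => //; exact: pF.
have := @Fubini _ _ _ _ R mu mu _ iF.
under eq_integral do rewrite E1.
under [X in _ = X -> _]eq_integral do rewrite E2.
by rewrite -!integral_mkcond /Rintegral => ->.
Qed.

End ProductRule.

Section ProductRule2.
Context (R : realType) (s t K : R) (f g : R -> R).
Local Notation mu := (@lebesgue_measure R).
Local Notation I := (`[s, t]%classic : set R).
Hypothesis st : s <= t.
Hypothesis mf : measurable_fun I f.
Hypothesis mg : measurable_fun I g.
Hypothesis fK : forall u, s <= u <= t -> `|f u| <= K.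
Hypothesis gK : forall u, s <= u <= t -> `|g u| <= K.

(** The product of two indefinite integrals, cut along the diagonal. *)
Lemma integral_product_rule :
  measurable_fun I (fun u => \int[mu]_(v in `[s, u]) f v) ->
  measurable_fun I (fun u => \int[mu]_(v in `[s, u]) g v) ->
  (\int[mu]_(u in I) f u) * (\int[mu]_(u in I) g u) =
  \int[mu]_(u in I) (f u * \int[mu]_(v in `[s, u]) g v
                     + g u * \int[mu]_(v in `[s, u]) f v).
Proof.
move=> mIf mIg.
have bI (h : R -> R) u : measurable_fun I h -> (forall u, s <= u <= t -> `|h u| <= K) ->
    s <= u <= t -> `|\int[mu]_(v in `[s, u]) h v| <= K * (t - s).
  move=> mh hK /andP[su ut]; have K0 : 0 <= K by apply: le_trans (hK s _); rewrite ?lexx.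
  apply: (@le_trans _ _ (K * (u - s))); last by rewrite ler_wpM2l// lerB.
  apply: bounded_Rintegral_itv => //.
    by apply: measurable_funS mh => // x; rewrite /= !in_itv/= => /andP[-> /le_trans]; apply.
  by move=> x /andP[sx xu]; apply: hK; rewrite sx (le_trans xu).
have jp (h k : R -> R) : measurable_fun I h -> measurable_fun I k ->
    (forall u, s <= u <= t -> `|h u| <= K) -> (forall u, s <= u <= t -> `|k u| <= K) ->
    measurable_fun I (fun u => \int[mu]_(v in `[s, u]) k v) ->
    mu.-integrable I (fun u => (h u * \int[mu]_(v in `[s, u]) k v)%:E).
  move=> mh mk hK kK mIk.
  apply: (@bounded_integrable_itv _ (fun u => h u * \int[mu]_(v in `[s, u]) k v)
    s t (K * (K * (t - s)))); first exact: measurable_funM.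
  by move=> u ut; rewrite normrM ler_pM// ?hK// bI.
have jf : mu.-integrable I (EFin \o f) by exact: (@bounded_integrable_itv _ _ _ _ K).
have jg : mu.-integrable I (EFin \o g) by exact: (@bounded_integrable_itv _ _ _ _ K).
have i2 := jp f g mf mg fK gK mIg; have i3 := jp g f mg mf gK fK mIf.
rewrite RintegralD// (swap_triangle mf mg fK gK).
have -> : \int[mu]_(v in I) (g v * \int[mu]_(u in `[v, t]) f u) =
   \int[mu]_(v in I) (g v * (\int[mu]_(u in I) f u) - g v * \int[mu]_(u in `[s, v]) f u).
  apply: eq_Rintegral => v; rewrite inE/= in_itv/= => vI.
  by rewrite (Rintegral_itv_cut vI)// mulrBr.
rewrite RintegralB//; last first.
  set C := \int[mu]_(u in I) f u.
  by apply: eq_integrable (integrableZr _ C jg) => // v _; rewrite /= EFinM.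
by rewrite subrK RintegralZr// mulrC.
Qed.

End ProductRule2.

(** * The compensated chain *)

Section CompensatedMartingale.
Context (R : realType) (d : measure_display) (Om : measurableType d).
Context (P : probability Om R) (N : nat) (A : R -> 'M[R]_N) (X M : R -> Om -> 'cV[R]_N).
Hypothesis HX : rcll_markov_chain P X.
Hypothesis HA : rate_matrix A.
Hypothesis HM : semimartingale_representation P A X M.
Local Notation F := (filtration P X).
Local Notation mu := (@lebesgue_measure R).
Local Notation strip a b := (`[a, b]%classic `*` [set: Om] : set (R * Om)).
Local Notation drift := (drift A X).
Implicit Types (a b s t K : R) (i j : 'I_N) (w : Om).

(** The process [M] recomputed from the path. It agrees with [M] off one null
    event, and unlike [M] it is bounded, right continuous and jointly measurable. *)
Definition compensated i t w : R :=
  X t w i 0 - X 0 w i 0 - \int[mu]_(s in `[0, t]) drift i s w.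

Lemma measurable_drift_time a b i w : 0 <= a ->
  measurable_fun (`[a, b]%classic : set R) (fun t => drift i t w).
Proof. by move=> a0; exact: (measurable_strip_time (measurable_drift HX HA i a0) w). Qed.

Lemma integrable_drift a b i w : 0 <= a ->
  mu.-integrable `[a, b] (fun t => (drift i t w)%:E).
Proof.
move=> a0; have [K hK] := rate_bound_exists HA.
apply: (bounded_integrable_itv (L := K) (measurable_drift_time i w a0)).
by move=> u /andP[au _]; apply: (drift_bound HX) => //; exact: le_trans au.
Qed.

Lemma drift_integral_bound K a b i w : rate_bound A K -> 0 <= a -> a <= b ->
  `|\int[mu]_(t in `[a, b]) drift i t w| <= K * (b - a).
Proof.
move=> hK a0 ab; apply: bounded_Rintegral_itv => //; first exact: measurable_drift_time.
by move=> u /andP[au _]; apply: (drift_bound HX) => //; exact: le_trans au.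
Qed.

Lemma drift_integralB i w s t : 0 <= s -> s <= t ->
  \int[mu]_(u in `[0, t]) drift i u w - \int[mu]_(u in `[0, s]) drift i u w =
  \int[mu]_(u in `[s, t]) drift i u w.
Proof.
move=> s0 st; have s0t : 0 <= s <= t by rewrite s0.
by rewrite (Rintegral_itv_cut s0t (integrable_drift t i w (lexx 0))).
Qed.

Lemma compensatedB i s t w : 0 <= s -> s <= t ->
  compensated i t w - compensated i s w =
  X t w i 0 - X s w i 0 - \int[mu]_(u in `[s, t]) drift i u w.
Proof. by move=> s0 st; rewrite -(drift_integralB i w s0 st) /compensated; ring. Qed.

Lemma compensated_bound K i t w : rate_bound A K -> 0 <= t ->
  `|compensated i t w| <= 2 + K * t.
Proof.
move=> hK t0; have := drift_integral_bound i w hK (lexx 0) t0; rewrite subr0 => h.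
have h1 := chain_coord_bound HX i w t0; have h2 := chain_coord_bound HX i w (lexx 0).
rewrite /compensated; move: h h1 h2; rewrite !ler_norml => /andP[? ?] /andP[? ?] /andP[? ?].
by apply/andP; split; lra.
Qed.

Lemma compensated_right_continuous i w t : 0 <= t ->
  compensated i s w @[s --> t^'+] --> compensated i t w.
Proof.
move=> t0; have [K hK] := rate_bound_exists HA.
apply: cvgB; first by apply: cvgB; [exact: chain_coord_right_continuous HX _ _ _ t0|exact: cvg_cst].
have K1 : 0 < K + 1 by rewrite ltr_wpDl//; case: hK.
apply/cvgrPdist_le => /= e e0; near=> s.
have ts : t <= s by near: s; exact: nbhs_right_ge.
rewrite distrC drift_integralB//; apply: le_trans (drift_integral_bound i w hK t0 ts) _.
apply: (@le_trans _ _ ((K + 1) * (s - t))).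
  by rewrite ler_wpM2r ?subr_ge0// lerDl.
rewrite mulrC -ler_pdivlMr// ltW//; near: s; apply: nbhs_right_ltDr.
exact: divr_gt0.
Unshelve. all: by end_near. Qed.

Lemma measurable_compensated_outcome i t : 0 <= t -> measurable_fun setT (compensated i t).
Proof.
move=> t0; apply: measurable_funB.
  by apply: measurable_funB; exact: (chain_coord_measurable HX).
apply: (measurable_Rintegral_time (F := fun p => drift i p.1 p.2)).
exact: (measurable_drift HX HA).
Qed.

Lemma measurable_compensated a b i : 0 <= a ->
  measurable_fun (strip a b) (fun p => compensated i p.1 p.2).
Proof.
move=> a0; have [ab|ba] := leP a b.
  apply: (@measurable_right_continuous _ _ _ a b (compensated i)) => //.
  - move=> t /andP[a_t _]; apply: measurable_compensated_outcome; exact: le_trans a_t.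
  - by move=> w t /andP[a_t _]; apply: compensated_right_continuous; exact: le_trans a_t.
have -> : strip a b = set0.
  apply/seteqP; split => // -[t w] [/= + _]; rewrite in_itv/= => /andP[ta tb].
  by move: (le_trans ta tb); rewrite leNgt ba.
exact: measurable_fun_set0.
Qed.

Lemma compensated_ae : exists B : set Om, [/\ measurable B, P B = 0%E &
  forall w t i, ~ B w -> 0 <= t -> M t w i 0 = compensated i t w].
Proof.
have [_ [B [mB PB hB]]] := HM; exists B; split => // w t i nB t0.
have : (forall t : R, 0 <= t ->
    X t w = X 0 w + (\col_i \int[mu]_(s in `[0, t]) (A s *m X s w) i 0) + M t w).
  by apply: contrapT => h; apply: nB; apply: hB.
move=> /(_ t t0)/(congr1 (fun Z : 'cV[R]_N => Z i 0)); rewrite !mxE.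
by rewrite /compensated => ->; rewrite /drift; ring.
Qed.

Lemma compensated_adapted i t : 0 <= t -> measurable_wrt (F t) setT (compensated i t).
Proof.
move=> t0; have [B [mB PB hB]] := compensated_ae; have [/(_ i)[mM _ _] _] := HM.
apply: (measurable_wrt_ae mB PB _ _ (mM t t0)).
  by move=> w nB; exact: hB.
exact: measurable_compensated_outcome.
Qed.

Lemma compensated_sqint i t : 0 <= t -> sqint P (compensated i t).
Proof.
move=> t0; have [K hK] := rate_bound_exists HA.
apply: (@bounded_sqint _ _ _ _ (2 + K * t)); first exact: measurable_compensated_outcome.
by move=> w; exact: compensated_bound.
Qed.

Lemma compensated_martingale i s t B : 0 <= s -> s <= t -> F s B ->
  (\int[P]_(w in B) (compensated i t w - compensated i s w)%:E = 0)%E.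
Proof.
move=> s0 st FB; have t0 := le_trans s0 st.
have mB := filtration_measurable HX FB.
have iB u : 0 <= u -> P.-integrable B (EFin \o compensated i u).
  by move=> u0; apply: (integrableS measurableT) => //; exact/sqint_integrable/compensated_sqint.
have [C [mC PC hC]] := compensated_ae; have [/(_ i)[mM _ martM] _] := HM.
have E u : 0 <= u -> (\int[P]_(w in B) (compensated i u w)%:E =
    \int[P]_(w in B) (M u w i 0)%:E)%E.
  move=> u0; apply: ae_eq_integral => //.
  - exact: (measurable_int P (iB u u0)).
  - apply/measurable_EFinP/measurable_funTS.
    exact: (filtration_measurable_fun HX (mM u u0)).
  - exists C; split => // w /= h; apply: contrapT => nC; apply: h => _.
    by rewrite (hC w u i nC u0).
under eq_integral do rewrite EFinB.
rewrite integralB//; [|exact: iB|exact: iB].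
rewrite !E// (martM s t B)//; last by rewrite s0.
rewrite subee// -E//.
by apply: integrable_fin_num => //; exact: iB.
Qed.

Lemma compensated_orth i s t (eta : Om -> R) : 0 <= s -> s <= t ->
  sqint P eta -> measurable_wrt (F s) setT eta ->
  \int[P]_w (eta w * (compensated i t w - compensated i s w)) = 0.
Proof.
move=> s0 st eta2 meta.
have t0 := le_trans s0 st.
have d2 : sqint P (fun w => compensated i t w - compensated i s w).
  by apply: sqintB; exact: compensated_sqint.
rewrite /Rintegral (orth_measurable_wrt (filtration_sigma P X s) (@filtration_measurable _ _ _ _ _ _ HX s)
   (sqint_integrable d2) _ meta)//.
- by move=> B FB; exact: compensated_martingale.
- exact: (sqintM_integrable eta2 d2).
Qed.

End CompensatedMartingale.

(** * Products of increments of the compensated chain *)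

Section RealIntegrable.
Context (R : realType) (d : measure_display) (T : measurableType d).
Context (mu : {measure set T -> \bar R}) (D : set T).
Hypothesis mD : measurable D.
Implicit Types f g : T -> R.

Lemma integrableD_in f g : mu.-integrable D (EFin \o f) ->
  mu.-integrable D (EFin \o g) -> mu.-integrable D (EFin \o (fun w => f w + g w)).
Proof. by move=> fi gi; apply: eq_integrable (integrableD mD fi gi). Qed.

Lemma integrableB_in f g : mu.-integrable D (EFin \o f) ->
  mu.-integrable D (EFin \o g) -> mu.-integrable D (EFin \o (fun w => f w - g w)).
Proof. by move=> fi gi; apply: eq_integrable (integrableB mD fi gi). Qed.

Lemma integrableZ_in k f : mu.-integrable D (EFin \o f) ->
  mu.-integrable D (EFin \o (fun w => k * f w)).
Proof. by move=> fi; apply: eq_integrable (integrableZl mD k fi). Qed.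

End RealIntegrable.

Section QuadraticVariation.
Context (R : realType) (d : measure_display) (Om : measurableType d).
Context (P : probability Om R) (N : nat) (A : R -> 'M[R]_N) (X M : R -> Om -> 'cV[R]_N).
Hypothesis HX : rcll_markov_chain P X.
Hypothesis HA : rate_matrix A.
Hypothesis HM : semimartingale_representation P A X M.
Local Notation F := (filtration P X).
Local Notation mu := (@lebesgue_measure R).
Local Notation strip a b := (`[a, b]%classic `*` [set: Om] : set (R * Om)).
Local Notation drift := (drift A X).
Local Notation compensated := (compensated A X).
Implicit Types (a b s t K : R) (i j : 'I_N) (w : Om).

(** The state is a unit vector, so [X_i] times the drift of the coordinate [j]
    keeps the single term [A_ji X_i]. *)
Lemma bracket_drift i j t w : 0 <= t -> bracket (A t) (X t w) i j =
  (i == j)%:R * drift i t w - X t w i 0 * drift j t w - X t w j 0 * drift i t w.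
Proof.
move=> t0; rewrite bracketE /drift; have [k ->] := chain_unit HX w t0.
have U l : unit_vector R k l 0 = (l == k)%:R by rewrite mxE eqxx andbT.
rewrite -!colE !U !mxE; congr (_ - _ - _).
  by case: (eqVneq i k) => [->|]; rewrite ?mul0r.
by rewrite mulrC; case: (eqVneq j k) => [->|]; rewrite ?mul0r.
Qed.

(** What is left of the product of two increments once the bracket is removed:
    at time [u] it involves only the future increments from [u] to [t]. *)
Definition bracket_remainder i j t (p : R * Om) : R :=
  drift i p.1 p.2 * (compensated j t p.2 - compensated j p.1 p.2)
  + drift j p.1 p.2 * (compensated i t p.2 - compensated i p.1 p.2).

Lemma measurable_remainder i j s t : 0 <= s -> s <= t ->
  measurable_fun (strip s t) (bracket_remainder i j t).
Proof.
move=> s0 st; have t0 := le_trans s0 st.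
have mc k : measurable_fun (strip s t) (fun p => compensated k t p.2).
  apply: (measurableT_comp (measurable_compensated_outcome HX HA k t0)).
  by apply: measurable_funTS; exact: measurable_snd.
apply: measurable_funD; apply: measurable_funM.
- exact: (measurable_drift HX HA).
- by apply: measurable_funB => //; exact: (measurable_compensated HX HA).
- exact: (measurable_drift HX HA).
- by apply: measurable_funB => //; exact: (measurable_compensated HX HA).
Qed.

Lemma remainder_bound K i j s t u w : rate_bound A K -> 0 <= s -> s <= u <= t ->
  `|bracket_remainder i j t (u, w)| <= 4 * K * (2 + K * t).
Proof.
move=> hK s0 /andP[su ut]; have u0 := le_trans s0 su; have t0 := le_trans u0 ut.
have K0 : 0 <= K by case: hK.
have cb k : `|compensated k t w - compensated k u w| <= 2 * (2 + K * t).
  apply: le_trans (ler_normB _ _) _.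
  have h1 := compensated_bound HX HA k w hK t0; have h2 := compensated_bound HX HA k w hK u0.
  have : K * u <= K * t by rewrite ler_wpM2l.
  by lra.
rewrite /bracket_remainder /=; apply: le_trans (ler_normD _ _) _; rewrite !normrM.
have e : 4 * K * (2 + K * t) = K * (2 * (2 + K * t)) + K * (2 * (2 + K * t)) by ring.
by rewrite e lerD// ler_pM// (drift_bound HX).
Qed.

(** Integration by parts for the products of the coordinates of the chain, in
    which the diagonal relation [X^i X^j = (i == j) X^i] produces the bracket. *)
Lemma increment_product i j s t w : 0 <= s -> s <= t ->
  (compensated i t w - compensated i s w) * (compensated j t w - compensated j s w)
  - \int[mu]_(u in `[s, t]) bracket (A u) (X u w) i j =
  ((i == j)%:R - X s w j 0) * (compensated i t w - compensated i s w)
  - X s w i 0 * (compensated j t w - compensated j s w)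
  - \int[mu]_(u in `[s, t]) bracket_remainder i j t (u, w).
Proof.
move=> s0 st; have t0 := le_trans s0 st; have [K hK] := rate_bound_exists HA.
have K0 : 0 <= K by case: hK.
have mI : measurable (`[s, t]%classic : set R) by [].
have idr k : mu.-integrable `[s, t] (EFin \o (fun u => drift k u w)).
  exact: (integrable_drift HX HA).
have ibr : mu.-integrable `[s, t] (EFin \o (fun u => bracket (A u) (X u w) i j)).
  apply: (bounded_integrable_itv (L := 3 * K)).
    exact: (measurable_strip_time (measurable_bracket HX HA i j s0) w).
  by move=> u /andP[su _]; apply: (bracket_bound HX) => //; exact: le_trans su.
have irem : mu.-integrable `[s, t] (EFin \o (fun u => bracket_remainder i j t (u, w))).
  apply: (bounded_integrable_itv (L := 4 * K * (2 + K * t))).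
    exact: (measurable_strip_time (measurable_remainder i j s0 st) w).
  by move=> u su; exact: (remainder_bound _ _ _ hK s0).
set di := compensated i t w - compensated i s w.
set dj := compensated j t w - compensated j s w.
pose b k u := \int[mu]_(v in `[s, u]) drift k v w.
have mb k : measurable_fun (`[s, t]%classic : set R) (b k).
  have h : measurable_fun (`[s, t]%classic : set R)
      (fun u => X u w k 0 - X s w k 0 - (compensated k u w - compensated k s w)).
    apply: measurable_funB; apply: measurable_funB => //.
      exact: (measurable_strip_time (measurable_coord HX k s0) w).
    exact: (measurable_strip_time (measurable_compensated HX HA k s0) w).
  apply: eq_measurable_fun h => u; rewrite inE/= in_itv/= => /andP[su _].
  by rewrite (compensatedB HX HA)// /b; ring.
have pr := integral_product_rule st (measurable_drift_time HX HA i w s0)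
  (measurable_drift_time HX HA j w s0) _ _ (mb i) (mb j).
have {pr} := pr K.
have dK k u : s <= u <= t -> `|drift k u w| <= K.
  by move=> /andP[su _]; apply: (drift_bound HX) => //; exact: le_trans su.
move=> /(_ (dK i) (dK j)) pr.
have main : \int[mu]_(u in `[s, t]) bracket (A u) (X u w) i j
    - \int[mu]_(u in `[s, t]) bracket_remainder i j t (u, w)
  = (i == j)%:R * b i t - (dj + X s w j 0) * b i t - (di + X s w i 0) * b j t - b i t * b j t.
  rewrite -RintegralB//.
  have -> : \int[mu]_(u in `[s, t]) (bracket (A u) (X u w) i j - bracket_remainder i j t (u, w))
     = \int[mu]_(u in `[s, t]) (((i == j)%:R * drift i u w - (dj + X s w j 0) * drift i u w
          - (di + X s w i 0) * drift j u w)
       - (drift i u w * b j u + drift j u w * b i u)).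
    apply: eq_Rintegral => u; rewrite inE/= in_itv/= => /andP[su ut].
    have u0 := le_trans s0 su.
    have ci k : compensated k u w = compensated k s w + (X u w k 0 - X s w k 0 - b k u).
      by rewrite -(compensatedB HX HA k w s0 su) addrC subrK.
    rewrite (bracket_drift i j w u0) /bracket_remainder /= !ci /di /dj; ring.
  rewrite RintegralB//; last 2 first.
  - apply: integrableB_in => //; last exact: integrableZ_in.
    by apply: integrableB_in => //; exact: integrableZ_in.
  - have bb k u : s <= u <= t -> `|b k u| <= K * (t - s).
      move=> /andP[su ut]; apply: le_trans (drift_integral_bound HX HA k w hK s0 su) _.
      by rewrite ler_wpM2l// lerB.
    apply: (bounded_integrable_itv (L := K * (K * (t - s)) + K * (K * (t - s)))).
      by apply: measurable_funD; apply: measurable_funM => //; exact: (measurable_drift_time HX HA).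
    move=> u ut; apply: le_trans (ler_normD _ _) _.
    by rewrite !normrM lerD// ler_pM// ?dK// bb.
  rewrite -pr RintegralB//; last 2 first.
  - by apply: integrableB_in => //; apply: integrableZ_in.
  - exact: integrableZ_in.
  rewrite RintegralB//; [|exact: integrableZ_in|exact: integrableZ_in].
  by rewrite !RintegralZl.
have di_b : di = X t w i 0 - X s w i 0 - b i t by rewrite /di (compensatedB HX HA).
have dj_b : dj = X t w j 0 - X s w j 0 - b j t by rewrite /dj (compensatedB HX HA).
have xt := chain_coord_mul HX i j w t0; have xs := chain_coord_mul HX i j w s0.
set Br := \int[mu]_(u in _) bracket _ _ _ _ in main *.
set Rm := \int[mu]_(u in _) _ in main *.
have -> : Br = Rm + ((i == j)%:R * b i t - (dj + X s w j 0) * b i t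
    - (di + X s w i 0) * b j t - b i t * b j t).
  by rewrite -main addrC subrK.
apply/eqP; rewrite -subr_eq0.
have -> : di * dj - (Rm + ((i == j)%:R * b i t - (dj + X s w j 0) * b i t
    - (di + X s w i 0) * b j t - b i t * b j t))
    - (((i == j)%:R - X s w j 0) * di - X s w i 0 * dj - Rm)
   = (X t w i 0 * X t w j 0 - (i == j)%:R * X t w i 0)
     - (X s w i 0 * X s w j 0 - (i == j)%:R * X s w i 0).
  by rewrite di_b dj_b; ring.
by rewrite xt xs !subrr.
Qed.

End QuadraticVariation.

(** * Conditional covariance of increments *)

Section Covariance.
Context (R : realType) (d : measure_display) (Om : measurableType d).
Context (P : probability Om R) (N : nat) (A : R -> 'M[R]_N) (X M : R -> Om -> 'cV[R]_N).
Hypothesis HX : rcll_markov_chain P X.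
Hypothesis HA : rate_matrix A.
Hypothesis HM : semimartingale_representation P A X M.
Local Notation F := (filtration P X).
Local Notation mu := (@lebesgue_measure R).
Local Notation strip a b := (`[a, b]%classic `*` [set: Om] : set (R * Om)).
Local Notation drift := (drift A X).
Local Notation compensated := (compensated A X).
Implicit Types (a b s t r K L : R) (i j : 'I_N) (w : Om) (eta theta : Om -> R).

Definition bounded_adapted t eta :=
  measurable_wrt (F t) setT eta /\ exists L, forall w, `|eta w| <= L.

Lemma bounded_adapted_sqint t eta : bounded_adapted t eta -> sqint P eta.
Proof.
move=> [me [L hL]]; apply: (@bounded_sqint _ _ _ _ L) => //.
exact: (filtration_measurable_fun HX me).
Qed.

Lemma bounded_adaptedS s t eta : s <= t -> bounded_adapted s eta -> bounded_adapted t eta.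
Proof.
move=> st [me hL]; split => //.
apply: measurable_wrtS me; [exact: filtration_sigma|exact: filtration_sigma|].
exact: filtrationS.
Qed.

Lemma bounded_adaptedM t eta theta : bounded_adapted t eta -> bounded_adapted t theta ->
  bounded_adapted t (fun w => eta w * theta w).
Proof.
move=> [me [L hL]] [mt [L' hL']]; split; first exact: measurable_funM.
by exists (L * L') => w; rewrite normrM ler_pM.
Qed.

Lemma bounded_adaptedB t eta theta : bounded_adapted t eta -> bounded_adapted t theta ->
  bounded_adapted t (fun w => eta w - theta w).
Proof.
move=> [me [L hL]] [mt [L' hL']]; split; first exact: measurable_funB.
by exists (L + L') => w; rewrite (le_trans (ler_normB _ _))// lerD.
Qed.

Lemma bounded_adapted_cst t L : bounded_adapted t (fun=> L).
Proof. by split; [exact: measurable_cst|exists `|L|]. Qed.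

Lemma bounded_adapted_coord i t : 0 <= t -> bounded_adapted t (fun w => X t w i 0).
Proof.
move=> t0; split; first by apply: (chain_coord_adapted HX); rewrite t0 lexx.
by exists 1 => w; exact: (chain_coord_bound HX).
Qed.

Lemma bounded_adapted_drift i t : 0 <= t -> bounded_adapted t (drift i t).
Proof.
move=> t0; have [K hK] := rate_bound_exists HA; split; last first.
  by exists K => w; exact: (drift_bound HX).
rewrite /drift (_ : (fun w => _) = fun w => \sum_k A t i k * X t w k 0); last first.
  by apply/funext => w; rewrite mxE.
apply: measurable_sum => k; apply: measurable_funM => //.
exact: (bounded_adapted_coord k t0).1.
Qed.

Lemma bounded_adapted_compensated i s t : 0 <= s -> s <= t ->
  bounded_adapted t (compensated i s).
Proof.
move=> s0 st; apply: (bounded_adaptedS st); have [K hK] := rate_bound_exists HA.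
split; first exact: (compensated_adapted HX HA HM).
by exists (2 + K * s) => w; exact: (compensated_bound HX HA).
Qed.

Lemma bounded_adapted_integrable t eta : bounded_adapted t eta ->
  P.-integrable setT (EFin \o eta).
Proof. by move=> h; exact/sqint_integrable/bounded_adapted_sqint/h. Qed.

Lemma increment_orth i s t eta : 0 <= s -> s <= t -> bounded_adapted s eta ->
  \int[P]_w (eta w * (compensated i t w - compensated i s w)) = 0.
Proof.
move=> s0 st bs; apply: (compensated_orth HX HA HM) => //; last exact: bs.1.
exact: bounded_adapted_sqint bs.
Qed.

Lemma integrable_mul_time s t K eta (G : R * Om -> R) : s <= t ->
  bounded_adapted t eta -> measurable_fun (strip s t) G ->
  (forall u w, s <= u <= t -> `|G (u, w)| <= K) ->
  P.-integrable setT (EFin \o (fun w => eta w * \int[mu]_(u in `[s, t]) G (u, w))).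
Proof.
move=> st be mG GK; have se := bounded_adapted_sqint be.
apply: sqintM_integrable => //.
apply: (@bounded_sqint _ _ _ _ (K * (t - s))); first exact: measurable_Rintegral_time.
by move=> w; exact: bounded_Rintegral_time.
Qed.

(** By Fubini the mean is taken time by time, and at each time the remainder is
    a sum of future increments with multipliers known at that time. *)
Lemma remainder_orth i j s t eta : 0 <= s -> s <= t -> bounded_adapted s eta ->
  \int[P]_w (eta w * \int[mu]_(u in `[s, t]) bracket_remainder A X i j t (u, w)) = 0.
Proof.
move=> s0 st bs; have [K hK] := rate_bound_exists HA; have t0 := le_trans s0 st.
have [me [L hL]] := bs.
have L0 : 0 <= L by have := hL point; apply: le_trans.
have mr := measurable_remainder HX HA i j s0 st.
have rb u w : s <= u <= t -> `|bracket_remainder A X i j t (u, w)| <= 4 * K * (2 + K * t).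
  by move=> su; exact: (remainder_bound HX HA i j w hK s0 su).
have mG : measurable_fun (strip s t) (fun p => eta p.2 * bracket_remainder A X i j t p).
  apply: measurable_funM => //.
  apply: (measurableT_comp (filtration_measurable_fun HX me)).
  by apply: measurable_funTS; exact: measurable_snd.
have bG u w : s <= u <= t ->
    `|eta w * bracket_remainder A X i j t (u, w)| <= L * (4 * K * (2 + K * t)).
  by move=> su; rewrite normrM ler_pM// rb.
transitivity (\int[P]_w \int[mu]_(u in `[s, t])
    (eta w * bracket_remainder A X i j t (u, w))).
  apply: eq_Rintegral => w _; rewrite RintegralZl//.
  exact: (bounded_integrable_time mr rb).
rewrite (bounded_Rintegral_swap P mG bG).
have -> : \int[mu]_(u in `[s, t]) \int[P]_w (eta w * bracket_remainder A X i j t (u, w))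
    = \int[mu]_(u in `[s, t]) (0 : R); last by rewrite Rintegral_cst// mul0r.
apply: eq_Rintegral => u; rewrite inE/= in_itv/= => /andP[su ut].
have u0 := le_trans s0 su.
have bu := bounded_adaptedS su bs.
have bi k := bounded_adaptedM bu (bounded_adapted_drift k u0).
have bc k : bounded_adapted t (fun w => compensated k t w - compensated k u w).
  by apply: bounded_adaptedB; apply: bounded_adapted_compensated.
have -> : \int[P]_w (eta w * bracket_remainder A X i j t (u, w)) =
   \int[P]_w (eta w * drift i u w * (compensated j t w - compensated j u w)
     + eta w * drift j u w * (compensated i t w - compensated i u w)).
  by apply: eq_Rintegral => w _; rewrite /bracket_remainder /= mulrDr !mulrA.
rewrite RintegralD//.
- by rewrite !increment_orth// addr0.
- exact: (bounded_adapted_integrable (bounded_adaptedM (bounded_adaptedS ut (bi i)) (bc j))).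
- exact: (bounded_adapted_integrable (bounded_adaptedM (bounded_adaptedS ut (bi j)) (bc i))).
Qed.

(** In [increment_product] every term other than the bracket has zero mean
    against a multiplier known at time [s]. *)
Lemma bracket_isometry i j s t eta : 0 <= s -> s <= t -> bounded_adapted s eta ->
  \int[P]_w (eta w * ((compensated i t w - compensated i s w) *
                      (compensated j t w - compensated j s w))) =
  \int[P]_w (eta w * \int[mu]_(u in `[s, t]) bracket (A u) (X u w) i j).
Proof.
move=> s0 st bs; have [K hK] := rate_bound_exists HA; have t0 := le_trans s0 st.
have bt := bounded_adaptedS st bs.
have bd k : bounded_adapted t (fun w => compensated k t w - compensated k s w).
  by apply: bounded_adaptedB; apply: bounded_adapted_compensated.
have bb : bounded_adapted s (fun w => eta w * ((i == j)%:R - X s w j 0)).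
  apply: bounded_adaptedM => //; apply: bounded_adaptedB; last exact: bounded_adapted_coord.
  exact: bounded_adapted_cst.
have bx : bounded_adapted s (fun w => eta w * X s w i 0).
  by apply: bounded_adaptedM => //; exact: bounded_adapted_coord.
have ib : P.-integrable setT (EFin \o
    (fun w => eta w * \int[mu]_(u in `[s, t]) bracket (A u) (X u w) i j)).
  apply: (integrable_mul_time (K := 3 * K) st bt (measurable_bracket HX HA i j s0)).
  by move=> u w /andP[su _]; apply: (bracket_bound HX) => //; exact: le_trans su.
have ir : P.-integrable setT (EFin \o
    (fun w => eta w * \int[mu]_(u in `[s, t]) bracket_remainder A X i j t (u, w))).
  apply: (integrable_mul_time (K := 4 * K * (2 + K * t)) st bt (measurable_remainder HX HA i j s0 st)).
  by move=> u w su; exact: (remainder_bound HX HA i j w hK s0 su).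
have i1 := bounded_adapted_integrable (bounded_adaptedM (bounded_adaptedS st bb) (bd i)).
have i2 := bounded_adapted_integrable (bounded_adaptedM (bounded_adaptedS st bx) (bd j)).
have i0 := bounded_adapted_integrable (bounded_adaptedM bt (bounded_adaptedM (bd i) (bd j))).
apply/eqP; rewrite -subr_eq0 -RintegralB//.
have -> : \int[P]_w (eta w * ((compensated i t w - compensated i s w) *
       (compensated j t w - compensated j s w)) -
     eta w * \int[mu]_(u in `[s, t]) bracket (A u) (X u w) i j) =
  \int[P]_w (eta w * ((i == j)%:R - X s w j 0) * (compensated i t w - compensated i s w)
    - eta w * X s w i 0 * (compensated j t w - compensated j s w)
    - eta w * \int[mu]_(u in `[s, t]) bracket_remainder A X i j t (u, w)).
  apply: eq_Rintegral => w _.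
  by rewrite -mulrBr (increment_product HX HA)//; ring.
rewrite RintegralB//; last exact: integrableB_in.
by rewrite RintegralB// !increment_orth// remainder_orth// !subr0.
Qed.

End Covariance.

(** * Covariance of elementary integrals *)

Section RintegralSum.
Context (R : realType) (d : measure_display) (T : measurableType d).
Context (mu : {measure set T -> \bar R}) (D : set T).
Hypothesis mD : measurable D.

Lemma integrable_sum_in (I : Type) (s : seq I) (f : I -> T -> R) :
  (forall i, mu.-integrable D (EFin \o f i)) ->
  mu.-integrable D (EFin \o (fun x => \sum_(i <- s) f i x)).
Proof.
move=> fi; elim: s => [|i s IH].
  by apply: eq_integrable (integrable0 mu D) => // x _; rewrite /= big_nil.
by apply: eq_integrable (integrableD_in mD (fi i) IH) => // x _; rewrite /= big_cons.
Qed.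

Lemma Rintegral_sum (I : Type) (s : seq I) (f : I -> T -> R) :
  (forall i, mu.-integrable D (EFin \o f i)) ->
  \int[mu]_(x in D) (\sum_(i <- s) f i x) = \sum_(i <- s) \int[mu]_(x in D) f i x.
Proof.
move=> fi; elim: s => [|i s IH].
  by under eq_Rintegral do rewrite big_nil; rewrite Rintegral_cst// mul0r big_nil.
under eq_Rintegral do rewrite big_cons; rewrite big_cons RintegralD// ?IH//.
exact: integrable_sum_in.
Qed.

End RintegralSum.

Section Covariance.
Context (R : realType) (d : measure_display) (Om : measurableType d).
Context (P : probability Om R) (N : nat) (A : R -> 'M[R]_N) (X M : R -> Om -> 'cV[R]_N).
Hypothesis HX : rcll_markov_chain P X.
Hypothesis HA : rate_matrix A.
Hypothesis HM : semimartingale_representation P A X M.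
Local Notation F := (filtration P X).
Local Notation mu := (@lebesgue_measure R).
Local Notation strip a b := (`[a, b]%classic `*` [set: Om] : set (R * Om)).
Local Notation compensated := (compensated A X).
Local Notation bad := (bounded_adapted P X).
Implicit Types (a b s t r K L : R) (i j : 'I_N) (w : Om) (eta theta : Om -> R).

Definition piece s s' eta t w : R := if s < t <= s' then eta w else 0.

Definition increment i s s' w : R := compensated i s' w - compensated i s w.

Lemma bad_increment i s s' t : 0 <= s -> s <= s' -> s' <= t -> bad t (increment i s s').
Proof.
move=> s0 ss' s't; apply: bounded_adaptedB;
  apply: (bounded_adapted_compensated HX HA HM) => //.
- exact: le_trans ss'.
- exact: le_trans s't.
Qed.

Lemma bracketC i j t w : 0 <= t -> bracket (A t) (X t w) i j = bracket (A t) (X t w) j i.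
Proof.
move=> t0; rewrite !(bracket_drift A HX)// eq_sym.
by case: (eqVneq j i) => [->|_]; rewrite ?mul0r//; ring.
Qed.

Let cov_le i j s s' r r' T eta theta :
  0 <= s -> s <= r -> s <= s' -> r <= r' -> s' <= T -> r' <= T ->
  bad s eta -> bad r theta ->
  \int[P]_w ((eta w * increment i s s' w) * (theta w * increment j r r' w)) =
  \int[P]_w \int[mu]_(u in `[0, T])
    (piece s s' eta u w * piece r r' theta u w * bracket (A u) (X u w) i j).
Proof.
move=> s0 sr ss' rr' s'T r'T bs br; have r0 := le_trans s0 sr.
have bsr := bounded_adaptedS sr bs.
have bet := bounded_adaptedM bsr br.
have [s'r|rs'] := leP s' r.
  transitivity (0 : R).
    transitivity (\int[P]_w (eta w * theta w * increment i s s' w * increment j r r' w)).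
      by apply: eq_Rintegral => w _; ring.
    rewrite /(increment j) (increment_orth HX HA HM)//.
    by apply: bounded_adaptedM => //; exact: bad_increment.
  have -> : (fun w => \int[mu]_(u in `[0, T])
      (piece s s' eta u w * piece r r' theta u w * bracket (A u) (X u w) i j)) = fun=> 0.
    apply/funext => w; rewrite -[RHS](mul0r (fine (mu `[0%R, T]))) -Rintegral_cst//.
    apply: eq_Rintegral => u _; rewrite /piece.
    case: ifPn => [/andP[_ us']|_]; last by rewrite mul0r mul0r.
    by rewrite ltNge (le_trans us' s'r)/= mulr0 mul0r.
  by rewrite Rintegral_cst// mul0r.
(* ]r, q] is the common part of the two intervals *)
pose q := Num.min s' r'.
have rq : r <= q by rewrite le_min rr' ltW.
have q0 := le_trans r0 rq.
have qs' : q <= s' by rewrite ge_min lexx.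
have qr' : q <= r' by rewrite ge_min lexx orbT.
have qT := le_trans qs' s'T.
have betq := bounded_adaptedS rq bet.
transitivity (\int[P]_w
   ((eta w * theta w * increment i s r w * increment j r r' w
   + eta w * theta w * (increment i r q w * increment j r q w))
   + (eta w * theta w * increment i r q w * increment j q r' w
   + eta w * theta w * increment j r q w * increment i q s' w))).
  apply: eq_Rintegral => w _; rewrite /increment.
  have [e|e] : q = s' \/ q = r' by rewrite /q minEle; case: ifP; [left|right].
    by rewrite !e; ring.
  by rewrite !e; ring.
have betT := bounded_adaptedS (le_trans rq qT) bet.
have j1 : P.-integrable setT (EFin \o (fun w => eta w * theta w * increment i s r w * increment j r r' w)).
  apply: (bounded_adapted_integrable HX (t := T)).
  apply: bounded_adaptedM; last exact: bad_increment.
  by apply: bounded_adaptedM => //; apply: bad_increment => //; exact: le_trans qT.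
have j2 : P.-integrable setT (EFin \o (fun w => eta w * theta w * (increment i r q w * increment j r q w))).
  apply: (bounded_adapted_integrable HX (t := T)).
  by apply: bounded_adaptedM => //; apply: bounded_adaptedM; exact: bad_increment.
have j3 : P.-integrable setT (EFin \o (fun w => eta w * theta w * increment i r q w * increment j q r' w)).
  apply: (bounded_adapted_integrable HX (t := T)).
  by apply: bounded_adaptedM; [apply: bounded_adaptedM => //|]; exact: bad_increment.
have j4 : P.-integrable setT (EFin \o (fun w => eta w * theta w * increment j r q w * increment i q s' w)).
  apply: (bounded_adapted_integrable HX (t := T)).
  by apply: bounded_adaptedM; [apply: bounded_adaptedM => //|]; exact: bad_increment.
rewrite RintegralD//; [|exact: integrableD_in|exact: integrableD_in].
rewrite (RintegralD _ j1 j2)// (RintegralD _ j3 j4)//.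
have -> : \int[P]_w (eta w * theta w * increment i s r w * increment j r r' w) = 0.
  by apply: (increment_orth HX HA HM) => //; apply: bounded_adaptedM => //; exact: bad_increment.
have -> : \int[P]_w (eta w * theta w * increment i r q w * increment j q r' w) = 0.
  by apply: (increment_orth HX HA HM) => //; apply: bounded_adaptedM => //; exact: bad_increment.
have -> : \int[P]_w (eta w * theta w * increment j r q w * increment i q s' w) = 0.
  by apply: (increment_orth HX HA HM) => //; apply: bounded_adaptedM => //; exact: bad_increment.
rewrite add0r !addr0 (bracket_isometry HX HA HM)//.
apply: eq_Rintegral => w _.
have [K hK] := rate_bound_exists HA.
have ibr a b : 0 <= a -> mu.-integrable `[a, b] (EFin \o (fun u => bracket (A u) (X u w) i j)).
  move=> a0; apply: (bounded_integrable_itv (L := 3 * K)).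
    exact: (measurable_strip_time (measurable_bracket HX HA i j a0) w).
  by move=> u /andP[su _]; apply: (bracket_bound HX) => //; exact: le_trans su.
rewrite -RintegralZl//; last exact: ibr.
have irq : mu.-integrable `]r, q] (EFin \o (fun u => eta w * theta w * bracket (A u) (X u w) i j)).
  apply: integrableZ_in => //; apply: integrableS (ibr r q r0) => //.
  by move=> u; rewrite /= !in_itv/= => /andP[/ltW -> ->].
rewrite -Rintegral_itv_obnd_cbnd//.
rewrite [LHS]Rintegral_mkcond [RHS]Rintegral_mkcond; apply: eq_Rintegral => u _.
rewrite !patchE /piece.
have [/set_mem urq|nurq] := boolP (u \in (`]r, q]%classic : set R)).
  move: (urq); rewrite /= in_itv/= => /andP[ru uq].
  rewrite mem_set; last by rewrite /= in_itv/= (le_trans r0 (ltW ru)) (le_trans uq).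
  by rewrite (le_lt_trans sr ru) (le_trans uq qs') ru (le_trans uq qr').
case: ifPn => // _; case: ifPn => [/andP[su us']|_]; last by rewrite !mul0r.
case: ifPn => [/andP[ru ur']|_]; last by rewrite mulr0 mul0r.
by move/negP: nurq; case; apply/mem_set; rewrite /= in_itv/= ru le_min us' ur'.
Qed.

(** The two elementary integrands need not live on the same interval. The
    increments are cut at the ends of the common part: the parts outside it are
    orthogonal to the others, and the common part is [bracket_isometry]. *)
Lemma covariance i j s s' r r' T eta theta :
  0 <= s -> 0 <= r -> s <= s' -> r <= r' -> s' <= T -> r' <= T ->
  bad s eta -> bad r theta ->
  \int[P]_w ((eta w * increment i s s' w) * (theta w * increment j r r' w)) =
  \int[P]_w \int[mu]_(u in `[0, T])
    (piece s s' eta u w * piece r r' theta u w * bracket (A u) (X u w) i j).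
Proof.
move=> s0 r0 ss' rr' s'T r'T bs br; have [sr|/ltW rs] := leP s r; first exact: cov_le.
transitivity (\int[P]_w ((theta w * increment j r r' w) * (eta w * increment i s s' w))).
  by apply: eq_Rintegral => w _; rewrite mulrC.
rewrite (cov_le j i r0 rs rr' ss' r'T s'T br bs).
apply: eq_Rintegral => w _; apply: eq_Rintegral => u.
by rewrite inE/= in_itv/= => /andP[u0 _]; rewrite (bracketC j i)// (mulrC (piece r _ _ _ _)).
Qed.

End Covariance.

(** * Isometry and martingale property of finite families of integrands *)

Section Isometry.
Context (R : realType) (d : measure_display) (Om : measurableType d).
Context (P : probability Om R) (N : nat) (A : R -> 'M[R]_N) (X M : R -> Om -> 'cV[R]_N).
Hypothesis HX : rcll_markov_chain P X.
Hypothesis HA : rate_matrix A.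
Hypothesis HM : semimartingale_representation P A X M.
Local Notation F := (filtration P X).
Local Notation mu := (@lebesgue_measure R).
Local Notation strip a b := (`[a, b]%classic `*` [set: Om] : set (R * Om)).
Local Notation compensated := (compensated A X).
Local Notation bad := (bounded_adapted P X).
Local Notation increment := (increment A X).
Implicit Types (a b s t r K L : R) (i j : 'I_N) (w : Om).

Section ScalarFamily.
Variables (K : finType) (lo hi : K -> R) (ix : K -> 'I_N) (co : K -> Om -> R) (T : R).
Hypothesis lo0 : forall k, 0 <= lo k.
Hypothesis lohi : forall k, lo k <= hi k.
Hypothesis hiT : forall k, hi k <= T.
Hypothesis bco : forall k, bad (lo k) (co k).

Lemma measurable_piece k : measurable_fun (strip 0 T) (fun p => piece (lo k) (hi k) (co k) p.1 p.2).
Proof.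
apply: measurable_fun_if => //; first exact: measurable_strip.
- apply: measurable_and; [apply: measurable_fun_ltr|apply: measurable_fun_ler] => //;
   by apply: measurable_funTS; exact: measurable_fst.
- have h := filtration_measurable_fun HX (bco k).1.
  apply: measurable_funTS; apply: (measurableT_comp h); exact: measurable_snd.
Qed.

Lemma scalar_sqint : sqint P (fun w => \sum_k co k w * increment (ix k) (lo k) (hi k) w).
Proof.
apply: sqint_sum => k; apply: (bounded_adapted_sqint HX (t := hi k)).
apply: bounded_adaptedM; first exact: bounded_adaptedS (bco k).
exact: (bad_increment HX HA HM).
Qed.

(** Expanding the square leaves covariances of elementary integrals, with no
    order on their intervals: two simple processes with different times can
    therefore be treated as one family. *)
Lemma scalar_isometry :
  (\int[P]_w ((\sum_k co k w * increment (ix k) (lo k) (hi k) w) ^+ 2)%:E =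
  \int[P]_w \int[mu]_(u in `[0%R, T])
    (\sum_k \sum_l piece (lo k) (hi k) (co k) u w * piece (lo l) (hi l) (co l) u w
       * bracket (A u) (X u w) (ix k) (ix l))%:E)%E.
Proof.
have [K0 hK] := rate_bound_exists HA.
pose D k w := co k w * increment (ix k) (lo k) (hi k) w.
pose G k l p := piece (lo k) (hi k) (co k) p.1 p.2 * piece (lo l) (hi l) (co l) p.1 p.2
       * bracket (A p.1) (X p.1 p.2) (ix k) (ix l) : R.
have bD k : bad (hi k) (D k).
  apply: bounded_adaptedM; first exact: bounded_adaptedS (bco k).
  exact: (bad_increment HX HA HM).
have iD k l : P.-integrable setT (EFin \o (fun w => D k w * D l w)).
  by apply: sqintM_integrable; exact: (bounded_adapted_sqint HX (bD _)).
have mG k l : measurable_fun (strip 0 T) (G k l).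
  apply: measurable_funM; first by apply: measurable_funM; exact: measurable_piece.
  exact: (measurable_bracket HX HA).
have bG k l : exists L, forall u w, 0 <= u <= T -> `|G k l (u, w)| <= L.
  have [_ [L hL]] := bco k; have [_ [L' hL']] := bco l.
  have pb (k' : K) (B : R) u w : (forall w, `|co k' w| <= B) -> `|piece (lo k') (hi k') (co k') u w| <= B.
    move=> hB; rewrite /piece; case: ifP => _; first exact: hB.
    by rewrite normr0; apply: le_trans (hB w).
  exists (L * L' * (3 * K0)) => u w /andP[u0 _]; rewrite /G /= !normrM.
  by rewrite !ler_pM ?mulr_ge0// ?pb//; exact: (bracket_bound HX).
have iG k l w : mu.-integrable `[0, T] (EFin \o (fun u => G k l (u, w))).
  by have [L hL] := bG k l; exact: (bounded_integrable_time (mG k l) hL).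
have iEG k l : P.-integrable setT (EFin \o (fun w => \int[mu]_(u in `[0, T]) G k l (u, w))).
  have [L hL] := bG k l; have T0 : 0 <= T by apply: le_trans (hiT k); apply: le_trans (lohi k).
  have := integrable_mul_time HX T0 (bounded_adapted_cst P X T 1) (mG k l) hL.
  by apply: eq_integrable => // w _; rewrite /= mul1r.
rewrite (integral_sqr_EFin scalar_sqint).
have mI : measurable (`[0, T]%classic : set (measurableTypeR R)) by [].
have iGk k w : mu.-integrable `[0, T] (EFin \o (fun u => \sum_l G k l (u, w))).
  by apply: (integrable_sum_in mI) => l; exact: iG.
transitivity (\int[P]_w \int[mu]_(u in `[0, T]) (\sum_k \sum_l G k l (u, w)))%:E; last first.
  have EI w : \int[mu]_(u in `[0, T]) (\sum_k \sum_l G k l (u, w)) =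
      \sum_k \sum_l \int[mu]_(u in `[0, T]) G k l (u, w).
    transitivity (\sum_k \int[mu]_(u in `[0, T]) \sum_l G k l (u, w)).
      by apply: (Rintegral_sum mI) => k; exact: iGk.
    by apply: eq_bigr => k _; apply: (Rintegral_sum mI) => l; exact: iG.
  rewrite /Rintegral fineK.
    apply: eq_integral => w _; rewrite fineK//; apply: integrable_fin_num => //.
    exact: (integrable_sum_in mI _ (iGk ^~ w)).
  apply: integrable_fin_num => //.
  under eq_fun do rewrite -/(Rintegral _ _ _) EI.
  by apply: integrable_sum_in => // k; apply: integrable_sum_in.
congr EFin.
transitivity (\int[P]_w (\sum_k \sum_l D k w * D l w)).
  apply: eq_Rintegral => w _; rewrite expr2 mulr_suml; apply: eq_bigr => k _.
  by rewrite mulr_sumr.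
rewrite Rintegral_sum//; last by move=> k; apply: integrable_sum_in => //.
transitivity (\sum_k \sum_l \int[P]_w \int[mu]_(u in `[0, T]) G k l (u, w)).
  apply: eq_bigr => k _; rewrite Rintegral_sum//; apply: eq_bigr => l _.
  exact: (covariance HX HA HM).
symmetry.
transitivity (\int[P]_w \sum_k \sum_l \int[mu]_(u in `[0, T]) G k l (u, w)).
  apply: eq_Rintegral => w _.
  transitivity (\sum_k \int[mu]_(u in `[0, T]) \sum_l G k l (u, w)).
    by apply: (Rintegral_sum mI) => k; exact: iGk.
  by apply: eq_bigr => k _; apply: (Rintegral_sum mI) => l; exact: iG.
rewrite Rintegral_sum//; last by move=> k; apply: integrable_sum_in => //.
by apply: eq_bigr => k _; rewrite Rintegral_sum.
Qed.

(** Elementary integrands on the same coordinate add up to one component. *)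
Lemma sum_piece_form u w :
  \sum_k \sum_l piece (lo k) (hi k) (co k) u w * piece (lo l) (hi l) (co l) u w
       * bracket (A u) (X u w) (ix k) (ix l) =
  chain_form A X u w (\col_i \sum_(k | ix k == i) piece (lo k) (hi k) (co k) u w).
Proof.
have regroup (p : K -> R) (g : 'I_N -> R) :
    \sum_k p k * g (ix k) = \sum_i (\sum_(k | ix k == i) p k) * g i.
  rewrite (partition_big ix xpredT)//=; apply: eq_bigr => i _.
  by rewrite mulr_suml; apply: eq_bigr => k /eqP ->.
rewrite /chain_form bracket_formE.
set p := fun k => piece (lo k) (hi k) (co k) u w.
transitivity (\sum_k p k * \sum_j (\sum_(l | ix l == j) p l) * bracket (A u) (X u w) (ix k) j).
  apply: eq_bigr => k _; rewrite -regroup mulr_sumr; apply: eq_bigr => l _.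
  by rewrite mulrA.
rewrite (regroup p (fun i => \sum_j (\sum_(l | ix l == j) p l) * bracket (A u) (X u w) i j)).
by apply: eq_bigr => i _; rewrite mulr_sumr; apply: eq_bigr => j _; rewrite !mxE mulrA.
Qed.

End ScalarFamily.

(** Stopping an interval at times [a] and [b]: the increments from [a] to [b] of
    an integral process are integrals over clipped intervals. *)
Definition clip a b t := Num.max a (Num.min t b).

Lemma clip_diff (f : R -> R) a b t : a <= b ->
  f (Num.min t b) - f (Num.min t a) = f (clip a b t) - f a.
Proof.
move=> ab; rewrite /clip.
case: (leP t a) => ta.
  by rewrite (min_idPl (le_trans ta ab)) (max_idPl ta) !subrr.
case: (leP t b) => tb; first by rewrite (max_idPr (ltW ta)).
by rewrite (max_idPr ab).
Qed.

Lemma clip_ge a b t : a <= clip a b t. Proof. by rewrite le_max lexx. Qed.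

Lemma clip_le a b t : a <= b -> clip a b t <= b.
Proof. by move=> ab; rewrite ge_max ab ge_min lexx orbT. Qed.

Lemma clipS a b t t' : t <= t' -> clip a b t <= clip a b t'.
Proof. by move=> tt'; apply: le_max2 => //; exact: le_min2. Qed.

Section VectorFamily.
Variables (K : finType) (lo hi : K -> R) (cf : K -> Om -> 'cV[R]_N).
Hypothesis lo0 : forall k, 0 <= lo k.
Hypothesis lohi : forall k, lo k <= hi k.
Hypothesis bcf : forall k i, bad (lo k) (fun w => cf k w i 0).

Definition family_integral t w : R :=
  \sum_k ((cf k w)^T *m (M (Num.min (hi k) t) w - M (Num.min (lo k) t) w)) 0 0.

Definition family_value t w : 'cV[R]_N :=
  \sum_k (if lo k < t <= hi k then cf k w else 0).

Lemma measurable_martingale i t : 0 <= t -> measurable_fun setT (fun w => M t w i 0).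
Proof.
move=> t0; have [/(_ i)[mM _ _] _] := HM.
exact: (filtration_measurable_fun HX (mM t t0)).
Qed.

Lemma family_integralE t w : family_integral t w =
  \sum_(p : K * 'I_N) cf p.1 w p.2 0 *
    (M (Num.min (hi p.1) t) w p.2 0 - M (Num.min (lo p.1) t) w p.2 0).
Proof.
rewrite -(pair_bigA _ (fun k i => cf k w i 0 *
   (M (Num.min (hi k) t) w i 0 - M (Num.min (lo k) t) w i 0)))/=.
by apply: eq_bigr => k _; rewrite mxE; apply: eq_bigr => i _; rewrite !mxE.
Qed.

Lemma measurable_family_integral t : 0 <= t -> measurable_fun setT (family_integral t).
Proof.
move=> t0; rewrite (funext (family_integralE t)).
apply: measurable_sum => p; apply: measurable_funM.
  exact: (filtration_measurable_fun HX (bcf p.1 p.2).1).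
apply: measurable_funB; apply: measurable_martingale; rewrite le_min t0 andbT//.
exact: le_trans (lohi _).
Qed.

Lemma measurable_family_value a b i : 
  measurable_fun (strip a b) (fun p => family_value p.1 p.2 i 0).
Proof.
rewrite (_ : (fun p => _) = fun p : R * Om =>
    \sum_k (if lo k < p.1 <= hi k then cf k p.2 i 0 else 0)); last first.
  by apply/funext => p; rewrite summxE; apply: eq_bigr => k _; case: ifP; rewrite ?mxE.
apply: measurable_sum => k.
apply: measurable_fun_if => //; first exact: measurable_strip.
- apply: measurable_and; [apply: measurable_fun_ltr|apply: measurable_fun_ler] => //;
   by apply: measurable_funTS; exact: measurable_fst.
- have h := filtration_measurable_fun HX (bcf k i).1.
  apply: measurable_funTS; apply: (measurableT_comp h); exact: measurable_snd.
Qed.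

Section OnInterval.
Variables a b : R.
Hypothesis a0 : 0 <= a.
Hypothesis ab : a <= b.

Let lo' (p : K * 'I_N) := clip a b (lo p.1).
Let hi' (p : K * 'I_N) := clip a b (hi p.1).
Let co' (p : K * 'I_N) w := if lo p.1 < b then cf p.1 w p.2 0 else 0.

Let lo'0 p : 0 <= lo' p. Proof. exact: le_trans (clip_ge _ _ _). Qed.
Let lohi' p : lo' p <= hi' p. Proof. exact: clipS. Qed.
Let hi'b p : hi' p <= b. Proof. exact: clip_le. Qed.

Let bco' p : bad (lo' p) (co' p).
Proof.
rewrite /co'; have [lb|_] := ltP (lo p.1) b; last exact: bounded_adapted_cst.
apply: bounded_adaptedS (bcf p.1 p.2).
by rewrite /lo' /clip (min_idPl (ltW lb)) le_max lexx orbT.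
Qed.

Let S w := \sum_p co' p w * increment p.2 (lo' p) (hi' p) w.

Let SE w :
  (forall t i, 0 <= t -> M t w i 0 = compensated i t w) ->
  family_integral b w - family_integral a w = S w.
Proof.
move=> hM; rewrite !family_integralE -sumrB; apply: eq_bigr => p _.
have min0 t c : 0 <= t -> 0 <= c -> 0 <= Num.min t c by move=> *; rewrite le_min; apply/andP.
have hi0 k : 0 <= hi k := le_trans (lo0 k) (lohi k).
have b0 := le_trans a0 ab.
rewrite !(hM _ p.2) ?min0//.
transitivity (cf p.1 w p.2 0 * increment p.2 (lo' p) (hi' p) w).
  rewrite /increment -mulrBr; congr (_ * _).
  have h1 := clip_diff (fun t => compensated p.2 t w) (hi p.1) ab.
  have h2 := clip_diff (fun t => compensated p.2 t w) (lo p.1) ab.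
  rewrite /lo' /hi'; move: h1 h2 => /=.
  set x1 := compensated _ (clip _ _ (hi _)) _; set x2 := compensated _ (clip _ _ (lo _)) _.
  move=> h1 h2; have -> : x1 - x2 = (x1 - compensated p.2 a w) - (x2 - compensated p.2 a w) by ring.
  by rewrite -h1 -h2; ring.
rewrite /co'; case: ifPn => //; rewrite -leNgt => blo.
rewrite /increment /lo' /hi' /clip.
by rewrite (min_idPr blo) (min_idPr (le_trans blo (lohi _))) subrr mulr0 mul0r.
Qed.

Let valueE u w : \col_i \sum_(p | p.2 == i) piece (lo' p) (hi' p) (co' p) u w =
  if a < u <= b then family_value u w else 0.
Proof.
apply/colP => i; rewrite mxE.
transitivity (\sum_k piece (lo' (k, i)) (hi' (k, i)) (co' (k, i)) u w).
  rewrite (eq_bigl (fun p : K * 'I_N => true && (p.2 == i)))//.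
  rewrite -(pair_big xpredT (fun j => j == i) (fun k j => piece (lo' (k, j)) (hi' (k, j)) (co' (k, j)) u w))/=.
  by apply: eq_bigr => k _; rewrite big_pred1_eq.
have [/andP[au ub]|nau] := boolP (a < u <= b); last first.
  rewrite mxE big1// => k _; rewrite /piece; case: ifPn => // /andP[lu uh].
  by case/negP: nau; rewrite (le_lt_trans (clip_ge _ _ _) lu) (le_trans uh (clip_le _ ab)).
rewrite summxE; apply: eq_bigr => k _; rewrite /piece /co' /lo' /hi' /clip /=.
rewrite gt_max au gt_min le_max (leNgt u a) au/= le_min ub andbT.
rewrite (ltNge b u) ub orbF.
by case: ifP => [/andP[lu _]|]; rewrite ?mxE// (lt_le_trans lu ub).
Qed.

(** Clipping the intervals to [a, b] turns the increment of the integral into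
    an integral of scalar elementary pieces, up to a null event. *)
Lemma family_isometry :
  sqint P (fun w => family_integral b w - family_integral a w) /\
  (\int[P]_w ((family_integral b w - family_integral a w) ^+ 2)%:E =
   \int[P]_w \int[mu]_(u in `[a, b]) (chain_form A X u w (family_value u w))%:E)%E.
Proof.
have b0 := le_trans a0 ab.
have [B [mB PB hB]] := compensated_ae HM.
have mD : measurable_fun setT (fun w => family_integral b w - family_integral a w).
  by apply: measurable_funB; exact: measurable_family_integral.
have S2 : sqint P S := scalar_sqint (fun p : K * 'I_N => p.2) lo'0 lohi' bco'.
have E1 : (\int[P]_w ((family_integral b w - family_integral a w) ^+ 2)%:E =
    \int[P]_w ((S w) ^+ 2)%:E)%E.
  apply: ae_eq_integral => //.
  - by apply/measurable_EFinP; apply: measurable_funX.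
  - by apply/measurable_EFinP; apply: measurable_funX; exact: (sqint_measurable S2).
  - exists B; split => // w /= h; apply: contrapT => nB; apply: h => _.
    by rewrite SE// => t i t0; exact: hB.
split; first by split => //; rewrite E1; case: S2.
rewrite E1 (scalar_isometry (fun p : K * 'I_N => p.2) lo'0 lohi' hi'b bco'); apply: eq_integral => w _.
have mf (u1 u2 : R) : 0 <= u1 ->
    measurable_fun (`[u1, u2]%classic : set R) (fun u => (chain_form A X u w (family_value u w))%:E).
  move=> u10; apply/measurable_EFinP.
  have h := measurable_chain_form HX HA u10 (@measurable_family_value u1 u2).
  exact: (measurable_strip_time h w).
rewrite -(@integral_itv_obnd_cbnd _ a (BRight b)); last first.
  by apply: measurable_funS (mf a b a0) => // u; rewrite /= !in_itv/= => /andP[/ltW -> ->].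
rewrite [LHS]integral_mkcond [RHS]integral_mkcond; apply: eq_integral => u _.
rewrite !patchE sum_piece_form valueE.
have [/set_mem uab|nuab] := boolP (u \in (`]a, b]%classic : set R)).
  move: (uab); rewrite /= in_itv/= => /andP[au ub].
  by rewrite mem_set ?au ?ub//= in_itv/= ub (le_trans a0 (ltW au)).
case: ifPn => // _; case: ifPn => [uab|_].
  by case/negP: nuab; apply/mem_set; rewrite /= in_itv.
congr EFin; rewrite /chain_form bracket_formE big1// => i _; rewrite big1// => j _.
by rewrite !mxE !mul0r.
Qed.

Lemma family_martingale (B : set Om) : F a B ->
  (\int[P]_(w in B) (family_integral b w - family_integral a w)%:E = 0)%E.
Proof.
move=> FB; have b0 := le_trans a0 ab.
have mB := filtration_measurable HX FB.
have [C [mC PC hC]] := compensated_ae HM.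
have mD : measurable_fun setT (fun w => family_integral b w - family_integral a w).
  by apply: measurable_funB; exact: measurable_family_integral.
have S2 : sqint P S := scalar_sqint (fun p : K * 'I_N => p.2) lo'0 lohi' bco'.
transitivity (\int[P]_(w in B) (S w)%:E)%E.
  apply: ae_eq_integral => //.
  - by apply/measurable_EFinP; apply: measurable_funTS.
  - by apply/measurable_EFinP; apply: measurable_funTS; exact: (sqint_measurable S2).
  - exists C; split => // w /= h; apply: contrapT => nC; apply: h => _.
    by rewrite SE// => t i t0; exact: hC.
have bB : bad a (\1_B : Om -> R).
  split.
    apply: measurable_indic; rewrite /measurable/= (sigma_algebra_id (filtration_sigma P X a))//.
  by exists 1 => w; rewrite indicE; case: (_ \in _); rewrite ?normr1 ?normr0.
have bp p : bad (lo' p) (fun w => \1_B w * co' p w).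
  by apply: bounded_adaptedM => //; apply: bounded_adaptedS bB; exact: clip_ge.
have bi p : bad (hi' p) (fun w => \1_B w * co' p w * increment p.2 (lo' p) (hi' p) w).
  apply: bounded_adaptedM; first exact: bounded_adaptedS (bp p).
  exact: (bad_increment HX HA HM).
have ip p := bounded_adapted_integrable HX (bi p).
rewrite -integral_indicM.
transitivity (\int[P]_w (\sum_p \1_B w * co' p w * increment p.2 (lo' p) (hi' p) w))%:E.
  rewrite /Rintegral fineK; last first.
    by apply: integrable_fin_num => //; exact: integrable_sum_in.
  by apply: eq_integral => w _; rewrite mulr_sumr; under eq_bigr do rewrite mulrA.
rewrite Rintegral_sum// big1// => p _.
exact: (increment_orth HX HA HM).
Qed.

End OnInterval.

Lemma family_integral0 w : family_integral 0 w = 0.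
Proof.
rewrite /family_integral big1// => k _.
by rewrite !(min_idPr _) ?(le_trans (lo0 k) (lohi k))// subrr mulmx0 mxE.
Qed.

Lemma family_sqint t : 0 <= t -> sqint P (family_integral t).
Proof.
move=> t0; have [+ _] := family_isometry (lexx 0) t0.
by under eq_fun do rewrite family_integral0 subr0.
Qed.


End VectorFamily.
End Isometry.

(** * Iterated integrals and predictable processes *)

Section NonnegativeIntegrals.
Context (R : realType) (d : measure_display) (T : measurableType d).
Context (mu : {measure set T -> \bar R}) (D : set T).
Hypothesis mD : measurable D.
Local Open Scope ereal_scope.

Lemma integral_le_comb (c : R) (f g h : T -> \bar R) : (0 <= c)%R ->
  (forall x, D x -> 0 <= f x) -> (forall x, D x -> 0 <= g x) -> (forall x, D x -> 0 <= h x) ->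
  measurable_fun D f -> measurable_fun D g -> measurable_fun D h ->
  (forall x, D x -> f x <= c%:E * g x + c%:E * h x) ->
  \int[mu]_(x in D) f x <= c%:E * \int[mu]_(x in D) g x + c%:E * \int[mu]_(x in D) h x.
Proof.
move=> c0 f0 g0 h0 mf mg mh fgh.
have cg0 x : D x -> 0 <= c%:E * g x by move=> Dx; rewrite mule_ge0// ?lee_fin// g0.
have ch0 x : D x -> 0 <= c%:E * h x by move=> Dx; rewrite mule_ge0// ?lee_fin// h0.
rewrite -!ge0_integralZl// -ge0_integralD//; [|exact: measurable_funeM|exact: measurable_funeM].
apply: ge0_le_integral => //.
by apply: emeasurable_funD; exact: measurable_funeM.
Qed.

End NonnegativeIntegrals.

Section DoubleIntegrals.
Context (R : realType) (d : measure_display) (Om : measurableType d).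
Context (P : probability Om R).
Local Notation mu := (@lebesgue_measure R).
Local Notation strip a b := (`[a, b]%classic `*` [set: Om] : set (R * Om)).
Implicit Types (F G H : R * Om -> R) (a b : R).

Definition double_integral a b F : \bar R :=
  (\int[P]_w \int[mu]_(t in `[a, b]) (F (t, w))%:E)%E.

Lemma measurable_inner a b F : measurable_fun (strip a b) F ->
  (forall t w, a <= t <= b -> 0 <= F (t, w)) ->
  measurable_fun setT (fun w => \int[mu]_(t in `[a, b]) (F (t, w))%:E)%E.
Proof.
move=> mF F0; apply: (measurable_integral_time (F := EFin \o F)).
  exact/measurable_EFinP.
by move=> t w tab; rewrite /= lee_fin F0.
Qed.

Lemma inner_ge0 a b F w : (forall t w, a <= t <= b -> 0 <= F (t, w)) ->
  (0 <= \int[mu]_(t in `[a, b]) (F (t, w))%:E)%E.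
Proof. by move=> F0; apply: integral_ge0 => t; rewrite /= in_itv/= lee_fin; exact: F0. Qed.

Lemma double_integral_ge0 a b F : (forall t w, a <= t <= b -> 0 <= F (t, w)) ->
  (0 <= double_integral a b F)%E.
Proof. by move=> F0; apply: integral_ge0 => w _; exact: inner_ge0. Qed.

Lemma double_integral_comb c a b F G H : 0 <= c ->
  (forall t w, a <= t <= b -> 0 <= F (t, w)) ->
  (forall t w, a <= t <= b -> 0 <= G (t, w)) ->
  (forall t w, a <= t <= b -> 0 <= H (t, w)) ->
  measurable_fun (strip a b) F -> measurable_fun (strip a b) G -> measurable_fun (strip a b) H ->
  (forall t w, a <= t <= b -> F (t, w) <= c * G (t, w) + c * H (t, w)) ->
  (double_integral a b F <= c%:E * double_integral a b G + c%:E * double_integral a b H)%E.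
Proof.
move=> c0 F0 G0 H0 mF mG mH FGH.
apply: integral_le_comb => //; [by move=> w _; exact: inner_ge0..|exact: measurable_inner|
  exact: measurable_inner|exact: measurable_inner|].
move=> w _; apply: integral_le_comb => //.
1-3: by move=> t; rewrite /= in_itv/= lee_fin; auto.
1-3: by apply/measurable_EFinP; exact: (measurable_strip_time _ w).
by move=> t; rewrite /= in_itv/= -!EFinM -EFinD lee_fin; exact: FGH.
Qed.

Lemma double_integralS a b a' b' F : a' <= a -> b <= b' ->
  (forall t w, a' <= t <= b' -> 0 <= F (t, w)) ->
  measurable_fun (strip a' b') F ->
  (double_integral a b F <= double_integral a' b' F)%E.
Proof.
move=> aa bb F0 mF.
have sub : strip a b `<=` strip a' b'.
  move=> [t w] [/= + _]; rewrite in_itv/= => /andP[ta tb]; split => //=.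
  by rewrite in_itv/= (le_trans aa ta) (le_trans tb bb).
have F0' t w : a <= t <= b -> 0 <= F (t, w).
  by move=> /andP[ta tb]; apply: F0; rewrite (le_trans aa ta) (le_trans tb bb).
apply: ge0_le_integral => //.
- by move=> w _; exact: inner_ge0.
- by apply: measurable_inner => //; apply: measurable_funS mF => //; exact: measurable_strip.
- exact: measurable_inner.
move=> w _; apply: ge0_subset_integral => //.
- by apply/measurable_EFinP; exact: (measurable_strip_time mF w).
- by move=> t; rewrite /= in_itv/= lee_fin; exact: F0.
- move=> t; rewrite /= !in_itv/= => /andP[ta tb].
  by rewrite (le_trans aa ta) (le_trans tb bb).
Qed.

End DoubleIntegrals.

Section Predictable.
Context (R : realType) (d : measure_display) (Om : measurableType d).
Context (P : probability Om R) (N : nat) (X : R -> Om -> 'cV[R]_N).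
Hypothesis HX : rcll_markov_chain P X.

Lemma predictable_sigma : sigma_algebra setT (predictable_sets P X).
Proof. exact: smallest_sigma_algebra. Qed.

Lemma predictable_measurable : predictable_sets P X `<=` (measurable : set (set (R * Om))).
Proof.
apply: smallest_sub; first exact: sigma_algebra_measurable.
move=> C [[B FB ->]|[s [t [B [_ _ FB ->]]]]].
  apply: measurableX; first exact: measurable_set1.
  exact: (filtration_measurable HX FB).
apply: measurableX; first exact: measurable_itv.
exact: (filtration_measurable HX FB).
Qed.

Lemma predictable_strip (T : R) : 0 < T -> predictable_sets P X (`[0, T] `*` setT).
Proof.
move=> T0.
have FT t : filtration P X t setT.
  by case: (filtration_sigma P X t) => F0 FC _; rewrite -[setT]setD0; exact: FC.
have -> : `[0, T] `*` [set: Om] = ([set 0] `*` setT) `|` (`]0, T] `*` setT).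
  apply/seteqP; split => [[t w] [/= + _]|[t w] [[/= -> _]|[/= + _]]].
  - rewrite in_itv/= => /andP[]; rewrite le_eqVlt => /predU1P[<- _|t0 tT]; first by left.
    by right; split => //=; rewrite in_itv/= t0.
  - by split => //=; rewrite in_itv/= lexx ltW.
  - by rewrite in_itv/= => /andP[t0 tT]; split => //=; rewrite in_itv/= (ltW t0).
have [G0 GC GU] := predictable_sigma.
have GU2 (C D : set (R * Om)) : predictable_sets P X C -> predictable_sets P X D ->
    predictable_sets P X (C `|` D).
  move=> GC' GD; rewrite -bigcup2E; apply: GU => -[//|[//|n]]; exact: G0.
apply: GU2; apply: sub_sigma_algebra; first by left; exists setT.
by right; exists 0, T, setT.
Qed.

Lemma predictable_joint (T : R) (phi : R -> Om -> R) : 0 < T -> predictable P T X phi ->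
  measurable_fun (`[0, T]%classic `*` [set: Om] : set (R * Om)) (fun p => phi p.1 p.2).
Proof.
move=> T0 mphi; have := @measurable_wrt_fun R _ (R * Om)%type _ predictable_sigma predictable_measurable.
by apply => //; exact: predictable_strip.
Qed.

End Predictable.

(** * The stochastic integral *)

Section SimpleDifference.
Context (R : realType) (d : measure_display) (Om : measurableType d).
Context (P : probability Om R) (N : nat) (X M : R -> Om -> 'cV[R]_N).
Hypothesis HX : rcll_markov_chain P X.
Local Notation bad := (bounded_adapted P X).
Implicit Types H : simple_process R Om N.

Lemma simple_time_ge0 H k : simple_predictable P X H -> (k < simple_size H)%N ->
  0 <= simple_time H k.
Proof.
move=> [t0 tS _ _]; elim: k => [//|k IH] kn.
by apply: le_trans (IH (ltnW kn)) _; exact: tS (ltnW kn).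
Qed.

Lemma simple_coef_bad H (k : 'I_(simple_size H)) i : simple_predictable P X H ->
  bad (simple_time H k) (fun w => simple_coef H k w i 0).
Proof.
move=> [_ _ mc bc]; split; first exact: mc.
by have [K hK] := bc k (ltn_ord k); exists K.
Qed.

Variables H1 H2 : simple_process R Om N.
Hypothesis sp1 : simple_predictable P X H1.
Hypothesis sp2 : simple_predictable P X H2.
Local Notation I12 := ('I_(simple_size H1) + 'I_(simple_size H2))%type.

Definition pair_lo (k : I12) := match k with inl k => simple_time H1 k | inr k => simple_time H2 k end.
Definition pair_hi (k : I12) := match k with inl k => simple_time H1 k.+1 | inr k => simple_time H2 k.+1 end.
(** The difference of two simple integrals is the integral of a single finite
    family, indexed by the disjoint union of their intervals. *)
Definition pair_coef (k : I12) w := match k with inl k => simple_coef H1 k w | inr k => - simple_coef H2 k w end.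

Lemma pair_lo_ge0 k : 0 <= pair_lo k.
Proof. by case: k => k /=; apply: simple_time_ge0. Qed.

Lemma pair_lo_hi k : pair_lo k <= pair_hi k.
Proof. by case: k => k /=; [case: sp1|case: sp2] => _ + _ _; apply. Qed.

Lemma pair_coef_bad k i : bad (pair_lo k) (fun w => pair_coef k w i 0).
Proof.
case: k => k /=; first exact: simple_coef_bad.
have := bounded_adaptedB (bounded_adapted_cst P X _ 0) (simple_coef_bad k i sp2).
by congr bounded_adapted; apply/funext => w; rewrite !mxE sub0r.
Qed.

Lemma pair_integralE t w : family_integral M pair_lo pair_hi pair_coef t w =
  simple_integral M H1 t w - simple_integral M H2 t w.
Proof.
rewrite /family_integral big_sumType/=; congr (_ + _).
rewrite /simple_integral -sumrN; apply: eq_bigr => k _.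
by rewrite linearN/= mulNmx mxE.
Qed.

Lemma pair_valueE t w : family_value pair_lo pair_hi pair_coef t w =
  simple_value H1 t w - simple_value H2 t w.
Proof.
rewrite /family_value big_sumType/=; congr (_ + _).
by rewrite /simple_value -sumrN; apply: eq_bigr => k _; case: ifP; rewrite ?oppr0.
Qed.

End SimpleDifference.

Section StochasticIntegral.
Context (R : realType) (d : measure_display) (Om : measurableType d).
Context (P : probability Om R) (N : nat) (A : R -> 'M[R]_N) (X M : R -> Om -> 'cV[R]_N).
Hypothesis HX : rcll_markov_chain P X.
Hypothesis HA : rate_matrix A.
Hypothesis HM : semimartingale_representation P A X M.
Variable T : R.
Hypothesis T0 : 0 < T.
Local Notation F := (filtration P X).
Local Notation mu := (@lebesgue_measure R).
Local Notation strip a b := (`[a, b]%classic `*` [set: Om] : set (R * Om)).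
Local Notation form := (chain_form A X).
Implicit Types (a b s t : R).

Definition energy (C : R -> Om -> 'cV[R]_N) a b : \bar R :=
  double_integral P a b (fun p => form p.1 p.2 (C p.1 p.2)).

Local Notation En C a b := (energy C%R a%R b%R).

Lemma cvge0_lt (u : nat -> \bar R) (e : R) : u n @[n --> \oo] --> 0%E -> 0 < e ->
  \forall n \near \oo, (u n < e%:E)%E.
Proof.
move=> /fine_cvgP[ufin] /cvgrPdist_lt /(_ e) u0 e0.
near=> n; have un : u n \is a fin_num by near: n.
rewrite -(fineK un) lte_fin; apply: le_lt_trans (ler_norm _) _.
by rewrite -normrN -sub0r; near: n; exact: u0.
Unshelve. all: by end_near. Qed.

Lemma measurable_simple_value a b H i : simple_predictable P X H ->
  measurable_fun (strip a b) (fun p => simple_value H p.1 p.2 i 0).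
Proof.
move=> sp; have := @measurable_family_value _ _ _ _ _ _ HX
  'I_(simple_size H) (fun k => simple_time H k) (fun k => simple_time H k.+1)
  (fun k => simple_coef H k) (fun k i => simple_coef_bad k i sp) a b i.
exact.
Qed.

Lemma measurable_simple_integral t H : simple_predictable P X H -> 0 <= t ->
  measurable_fun setT (simple_integral M H t).
Proof.
move=> sp t0; have [_ tS _ _] := sp.
apply: (@measurable_family_integral _ _ _ _ _ _ _ M HX HM
  'I_(simple_size H) (fun k => simple_time H k) (fun k => simple_time H k.+1)
  (fun k => simple_coef H k)) => //.
- by move=> k; apply: (simple_time_ge0 sp).
- by move=> k; apply: tS.
- by move=> k i; apply: simple_coef_bad.
Qed.

Variables (Z1 Z2 : R -> Om -> 'cV[R]_N) (I1 I2 : R -> Om -> R).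
Hypothesis pZ1 : forall i, predictable P T X (fun t w => Z1 t w i 0).
Hypothesis pZ2 : forall i, predictable P T X (fun t w => Z2 t w i 0).
Hypothesis sI1 : stochastic_integral P T A X M Z1 I1.
Hypothesis sI2 : stochastic_integral P T A X M Z2 I2.

Local Notation I t w := (I1 t w - I2 t w).
Local Notation Z t w := (Z1 t w - Z2 t w).

Lemma stochastic_integral_adapted t : 0 <= t <= T -> measurable_wrt (F t) setT (fun w => I t w).
Proof. by move=> tT; apply: measurable_funB; [case: sI1 => -[h _] _|case: sI2 => -[h _] _]; exact: h. Qed.

Lemma stochastic_integral_measurable t : 0 <= t <= T -> measurable_fun setT (fun w => I t w).
Proof. by move=> tT; exact: (filtration_measurable_fun HX (stochastic_integral_adapted tT)). Qed.

Lemma measurable_integrand a b i : 0 <= a -> b <= T ->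
  measurable_fun (strip a b) (fun p => (Z p.1 p.2) i 0).
Proof.
move=> a0 bT.
have h : measurable_fun (strip 0 T) (fun p => (Z p.1 p.2) i 0).
  rewrite (_ : (fun p => _) = fun p : R * Om => Z1 p.1 p.2 i 0 - Z2 p.1 p.2 i 0); last first.
    by apply/funext => p; rewrite !mxE.
  apply: measurable_funB.
    exact: (predictable_joint HX T0 (pZ1 i)).
  exact: (predictable_joint HX T0 (pZ2 i)).
apply: measurable_funS h; first exact: measurable_strip.
move=> [t w] [/= + _]; rewrite in_itv/= => /andP[ta tb]; split => //=.
by rewrite in_itv/= (le_trans a0 ta) (le_trans tb bT).
Qed.

(** Simple processes approximating both integrands at once. *)
Lemma stochastic_integral_approx (a b e : R) : 0 <= a <= T -> 0 <= b <= T -> 0 < e ->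
  exists H1 H2, [/\ simple_predictable P X H1, simple_predictable P X H2,
    forall t, t = a \/ t = b ->
      (\int[P]_w ((simple_integral M H1 t w - simple_integral M H2 t w - I t w) ^+ 2)%:E <= e%:E)%E &
    (En (fun t w => simple_value H1 t w - simple_value H2 t w - Z t w) 0%R T <= e%:E)%E].
Proof.
move=> aT bT e0.
have [[mI1 rI1] [H1 [sp1 E1 J1]]] := sI1.
have [[mI2 rI2] [H2 [sp2 E2 J2]]] := sI2.
have e4 : 0 < e / 4 by rewrite divr_gt0.
have h1 := cvge0_lt (J1 a aT) e4; have h2 := cvge0_lt (J1 b bT) e4.
have h3 := cvge0_lt (J2 a aT) e4; have h4 := cvge0_lt (J2 b bT) e4.
have h5 := cvge0_lt E1 e4; have h6 := cvge0_lt E2 e4.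
have [n [[[j1a j1b] [j2a j2b]] [e1 e2]]] :=
  filter_ex (filterI (filterI (filterI h1 h2) (filterI h3 h4)) (filterI h5 h6)).
clear h1 h2 h3 h4 h5 h6.
exists (H1 n), (H2 n); split; [exact: sp1|exact: sp2| |].
- have main t : 0 <= t <= T ->
    (\int[P]_w ((simple_integral M (H1 n) t w - I1 t w) ^+ 2)%:E < (e / 4)%:E)%E ->
    (\int[P]_w ((simple_integral M (H2 n) t w - I2 t w) ^+ 2)%:E < (e / 4)%:E)%E ->
    (\int[P]_w ((simple_integral M (H1 n) t w - simple_integral M (H2 n) t w - I t w) ^+ 2)%:E <= e%:E)%E.
    move=> tT h1 h2; have /andP[t0 _] := tT.
    have m1 : measurable_fun setT (fun w => simple_integral M (H1 n) t w - I1 t w).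
      apply: measurable_funB; first exact: measurable_simple_integral.
      exact: (filtration_measurable_fun HX (mI1 t tT)).
    have m2 : measurable_fun setT (fun w => simple_integral M (H2 n) t w - I2 t w).
      apply: measurable_funB; first exact: measurable_simple_integral.
      exact: (filtration_measurable_fun HX (mI2 t tT)).
    apply: (@le_trans _ _ (2%:E * \int[P]_w ((simple_integral M (H1 n) t w - I1 t w) ^+ 2)%:E
        + 2%:E * \int[P]_w ((simple_integral M (H2 n) t w - I2 t w) ^+ 2)%:E)%E).
      apply: integral_le_comb => //.
      1-3: by move=> w _; rewrite lee_fin sqr_ge0.
      - apply/measurable_EFinP; apply: measurable_funX.
        apply: measurable_funB; first by apply: measurable_funB; exact: measurable_simple_integral.
        exact: stochastic_integral_measurable.
      - by apply/measurable_EFinP; apply: measurable_funX.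
      - by apply/measurable_EFinP; apply: measurable_funX.
      - move=> w _; rewrite -!EFinM -EFinD lee_fin.
        set x := simple_integral M (H1 n) t w; set y := simple_integral M (H2 n) t w.
        by have := sqr_ge0 ((x - I1 t w) + (y - I2 t w)); nra.
    have -> : (e%:E = 2%:E * (e / 4)%:E + 2%:E * (e / 4)%:E)%E.
      by rewrite -!EFinM -EFinD; congr EFin; field.
    by apply: leeD; apply: lee_wpmul2l => //; exact: ltW.
  by move=> t [->|->]; exact: main.
- have mk (H : simple_process R Om N) (Zk : R -> Om -> 'cV[R]_N) : simple_predictable P X H ->
     (forall i, predictable P T X (fun t w => Zk t w i 0)) ->
     forall i, measurable_fun (strip 0 T) (fun p => (simple_value H p.1 p.2 - Zk p.1 p.2) i 0).
    move=> sp pZ i.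
    rewrite (_ : (fun p => _) = fun p : R * Om => simple_value H p.1 p.2 i 0 - Zk p.1 p.2 i 0); last first.
      by apply/funext => p; rewrite !mxE.
    apply: measurable_funB; first exact: measurable_simple_value.
    exact: (predictable_joint HX T0 (pZ i)).
  have k1 := mk _ _ (sp1 n) pZ1; have k2 := mk _ _ (sp2 n) pZ2.
  have l0 : (0 : R) <= 0 by [].
  have r1 : (En (fun t w => simple_value (H1 n) t w - Z1 t w) 0%R T < (e / 4)%:E)%E.
    apply: le_lt_trans e1; rewrite le_eqVlt; apply/orP; left; apply/eqP.
    apply: eq_integral => w _; symmetry.
    exact: (integral_seminorm_sqr HX HA (C := fun t w => simple_value (H1 n) t w - Z1 t w) w l0 k1).
  have r2 : (En (fun t w => simple_value (H2 n) t w - Z2 t w) 0%R T < (e / 4)%:E)%E.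
    apply: le_lt_trans e2; rewrite le_eqVlt; apply/orP; left; apply/eqP.
    apply: eq_integral => w _; symmetry.
    exact: (integral_seminorm_sqr HX HA (C := fun t w => simple_value (H2 n) t w - Z2 t w) w l0 k2).
  have mf1 := measurable_chain_form HX HA (C := fun t w => simple_value (H1 n) t w - Z1 t w) l0 k1.
  have mf2 := measurable_chain_form HX HA (C := fun t w => simple_value (H2 n) t w - Z2 t w) l0 k2.
  have fge t w C : 0 <= t <= T -> 0 <= form t w C.
    by move=> /andP[t0 _]; exact: (chain_form_ge0 HX HA).
  apply: (@le_trans _ _ (2%:E * En (fun t w => simple_value (H1 n) t w - Z1 t w) 0%R T
     + 2%:E * En (fun t w => simple_value (H2 n) t w - Z2 t w) 0%R T)%E).
    apply: double_integral_comb => //.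
    1-3: by move=> t w /= /fge.
    + apply: (measurable_chain_form HX HA l0 (C := fun t w => simple_value (H1 n) t w - simple_value (H2 n) t w - Z t w)) => i.
      rewrite (_ : (fun p => _) = fun p : R * Om => (simple_value (H1 n) p.1 p.2 - Z1 p.1 p.2) i 0
          - (simple_value (H2 n) p.1 p.2 - Z2 p.1 p.2) i 0); last first.
        by apply/funext => p; rewrite !mxE; ring.
      exact: measurable_funB.
    + move=> t w /= /andP[t0 _].
      have -> : simple_value (H1 n) t w - simple_value (H2 n) t w - Z t w =
        (simple_value (H1 n) t w - Z1 t w) - (simple_value (H2 n) t w - Z2 t w).
        by apply/colP => i; rewrite !mxE; ring.
      exact: (chain_formB HX HA).
  have -> : (e%:E = 2%:E * (e / 4)%:E + 2%:E * (e / 4)%:E)%E.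
    by rewrite -!EFinM -EFinD; congr EFin; field.
  apply: leeD; apply: lee_wpmul2l.
  - by rewrite lee_fin.
  - exact: (ltW r1).
  - by rewrite lee_fin.
  - exact: (ltW r2).
Qed.

Section Pair.
Variables H1 H2 : simple_process R Om N.
Hypothesis sp1 : simple_predictable P X H1.
Hypothesis sp2 : simple_predictable P X H2.
Local Notation J t w := (simple_integral M H1 t w - simple_integral M H2 t w).

Lemma simple_difference_sqint t : 0 <= t -> sqint P (fun w => J t w).
Proof.
move=> t0.
have := family_sqint HX HA HM (pair_lo_ge0 sp1 sp2) (pair_lo_hi sp1 sp2) (pair_coef_bad sp1 sp2) t0.
by rewrite (funext (pair_integralE M H1 H2 t)).
Qed.

Lemma simple_difference_isometry a b : 0 <= a -> a <= b ->
  (\int[P]_w ((J b w - J a w) ^+ 2)%:E =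
   En (fun t w => simple_value H1 t w - simple_value H2 t w) a b)%E.
Proof.
move=> a0 ab.
have [_] := family_isometry HX HA HM (pair_lo_ge0 sp1 sp2) (pair_lo_hi sp1 sp2)
  (pair_coef_bad sp1 sp2) a0 ab.
under eq_integral do rewrite !pair_integralE.
by move=> ->; apply: eq_integral => w _; apply: eq_integral => u _; rewrite pair_valueE.
Qed.

Lemma simple_difference_martingale a b (B : set Om) : 0 <= a -> a <= b -> F a B ->
  (\int[P]_(w in B) (J b w - J a w)%:E = 0)%E.
Proof.
move=> a0 ab FB.
have := family_martingale HX HA HM (pair_lo_ge0 sp1 sp2) (pair_lo_hi sp1 sp2)
  (pair_coef_bad sp1 sp2) a0 ab FB.
by under eq_integral do rewrite !pair_integralE.
Qed.

Lemma measurable_simple_difference a b i :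
  measurable_fun (strip a b) (fun p => (simple_value H1 p.1 p.2 - simple_value H2 p.1 p.2) i 0).
Proof.
rewrite (_ : (fun p => _) = fun p : R * Om => simple_value H1 p.1 p.2 i 0
    - simple_value H2 p.1 p.2 i 0); last by apply/funext => p; rewrite !mxE.
by apply: measurable_funB; exact: measurable_simple_value.
Qed.

End Pair.

Lemma stochastic_integral_sqint t : 0 <= t <= T -> sqint P (fun w => I t w).
Proof.
move=> tT; have /andP[t0 _] := tT.
have [H1 [H2 [sp1 sp2 /(_ t (or_introl erefl)) e1 _]]] := stochastic_integral_approx tT tT ltr01.
have sJ := simple_difference_sqint sp1 sp2 t0.
have sJI : sqint P (fun w => simple_integral M H1 t w - simple_integral M H2 t w - I t w).
  split; last exact: le_lt_trans e1 (ltry _).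
  apply: measurable_funB; first exact: (sqint_measurable sJ).
  exact: stochastic_integral_measurable.
have := sqintB sJ sJI; congr (sqint P); apply/funext => w; ring.
Qed.

(** The increments of the two sides of the approximation are as close as their
    values at the two ends. *)
Lemma approx_increment a b (e : R) : 0 <= a -> a <= b -> b <= T -> 0 < e ->
  exists H1 H2, [/\ simple_predictable P X H1, simple_predictable P X H2,
    (\int[P]_w ((simple_integral M H1 b w - simple_integral M H2 b w
        - (simple_integral M H1 a w - simple_integral M H2 a w) - (I b w - I a w)) ^+ 2)%:E
      <= (4 * e)%:E)%E &
    (En (fun t w => simple_value H1 t w - simple_value H2 t w - Z t w) 0 T <= e%:E)%E].
Proof.
move=> a0 ab bT e0.
have aT : 0 <= a <= T by rewrite a0 (le_trans ab).
have bT' : 0 <= b <= T by rewrite (le_trans a0).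
have [H1 [H2 [sp1 sp2 J E]]] := stochastic_integral_approx aT bT' e0.
exists H1, H2; split => //.
have sI t (tT : 0 <= t <= T) : sqint P (fun w =>
    simple_integral M H1 t w - simple_integral M H2 t w - I t w).
  apply: sqintB; last exact: stochastic_integral_sqint.
  by apply: simple_difference_sqint => //; case/andP: tT.
have J1 := J a (or_introl erefl); have J2 := J b (or_intror erefl).
apply: (@le_trans _ _ (2%:E * \int[P]_w ((simple_integral M H1 b w - simple_integral M H2 b w - I b w) ^+ 2)%:E
     + 2%:E * \int[P]_w ((simple_integral M H1 a w - simple_integral M H2 a w - I a w) ^+ 2)%:E)%E).
  apply: integral_le_comb => //.
  1-3: by move=> w _; rewrite lee_fin sqr_ge0.
  - apply/measurable_EFinP; apply: measurable_funX.
    have := sqint_measurable (sqintB (sI b bT') (sI a aT)).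
    by congr measurable_fun; apply/funext => w; ring.
  - by apply/measurable_EFinP; apply: measurable_funX; exact: (sqint_measurable (sI b bT')).
  - by apply/measurable_EFinP; apply: measurable_funX; exact: (sqint_measurable (sI a aT)).
  - move=> w _; rewrite -!EFinM -EFinD lee_fin.
    set x := simple_integral M H1 b w - _ ; set y := simple_integral M H1 a w - _.
    by have := sqr_ge0 ((x - I b w) + (y - I a w)); nra.
have -> : ((4 * e)%:E = 2%:E * e%:E + 2%:E * e%:E)%E.
  by rewrite -!EFinM -EFinD; congr EFin; ring.
by apply: leeD; apply: lee_wpmul2l.
Qed.

(** The mean over an event is within any distance of that of a simple integral,
    which vanishes. *)
Lemma stochastic_integral_martingale s t (B : set Om) : 0 <= s -> s <= t -> t <= T -> F s B ->
  (\int[P]_(w in B) (I t w - I s w)%:E = 0)%E.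
Proof.
move=> s0 st tT FB; have mB := filtration_measurable HX FB.
have sT : 0 <= s <= T by rewrite s0 (le_trans st).
have tT' : 0 <= t <= T by rewrite (le_trans s0).
have sf : sqint P (fun w => I t w - I s w) by apply: sqintB; exact: stochastic_integral_sqint.
have fB : P.-integrable B (EFin \o (fun w => I t w - I s w)).
  by apply: (integrableS measurableT) => //; exact: sqint_integrable.
have fin := integrable_fin_num mB fB.
rewrite -(fineK fin); congr EFin; set r := fine _.
(* the event has measure at most 1, so the error of the mean is at most that in L^2 *)
have r2 (e : R) : 0 < e -> r ^+ 2 <= 4 * e.
  move=> e0.
  have [H1 [H2 [sp1 sp2 Je _]]] := approx_increment s0 st tT e0.
  have sJ t' : 0 <= t' -> sqint P (fun w => simple_integral M H1 t' w - simple_integral M H2 t' w).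
    exact: simple_difference_sqint.
  have sg := sqintB (sJ t (le_trans s0 st)) (sJ s s0).
  have gB : P.-integrable B (EFin \o (fun w => simple_integral M H1 t w - simple_integral M H2 t w
        - (simple_integral M H1 s w - simple_integral M H2 s w))).
    by apply: (integrableS measurableT) => //; exact: sqint_integrable.
  have sh := sqintB sg sf.
  have hB : P.-integrable B (EFin \o (fun w => simple_integral M H1 t w - simple_integral M H2 t w
        - (simple_integral M H1 s w - simple_integral M H2 s w) - (I t w - I s w))).
    by apply: (integrableS measurableT) => //; exact: sqint_integrable.
  have rE : (- r)%:E = (\int[P]_(w in B) (simple_integral M H1 t w - simple_integral M H2 t w
        - (simple_integral M H1 s w - simple_integral M H2 s w) - (I t w - I s w))%:E)%E.
    under eq_integral do rewrite EFinB.
    rewrite integralB// (simple_difference_martingale sp1 sp2 s0 st FB) sub0e.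
    by rewrite EFinN /r fineK.
  rewrite -lee_fin -sqrrN; apply: le_trans _ Je.
  apply: (le_trans _ (sqr_integral_prob P (sqint_measurable sh))).
  have -> : ((- r) ^+ 2)%:E = (`|(- r)%:E| ^+ 2)%E.
    by rewrite abse_EFin -EFin_expe real_normK// num_real.
  rewrite !expe2; have n0 : (0 <= `|(- r)%:E|)%E by [].
  have le1 : (`|(- r)%:E| <= \int[P]_w `|simple_integral M H1 t w - simple_integral M H2 t w
        - (simple_integral M H1 s w - simple_integral M H2 s w) - (I t w - I s w)|%:E)%E.
    rewrite rE; apply: le_trans (le_abse_integral P mB (measurable_int _ hB)) _.
    apply: ge0_subset_integral => //.
    by apply/measurable_EFinP; apply: measurableT_comp => //; exact: (sqint_measurable sh).
  by apply: lee_pmul.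
apply/eqP; rewrite -sqrf_eq0 eq_le sqr_ge0 andbT.
apply/ler_addgt0Pr => e e0; rewrite add0r.
have := r2 (e / 4); rewrite divr_gt0// => /(_ isT) h.
by apply: le_trans h _; rewrite le_eqVlt; apply/orP; left; apply/eqP; field.
Qed.

(** The isometry for the approximating simple processes, with the constant 4
    from two triangle inequalities: only the upper bound is wanted, and no limit
    of the energies has to be taken. *)
Lemma energy_le_increment a b : 0 <= a -> a <= b -> b <= T ->
  (En (fun t w => Z t w) a b <= 4%:E * \int[P]_w ((I b w - I a w) ^+ 2)%:E)%E.
Proof.
move=> a0 ab bT; apply/lee_addgt0Pr => e e0.
(* 2 * (2 * 4 + 1) = 18 copies of the error are used *)
have e18 : 0 < e / 18 by rewrite divr_gt0.
have [H1 [H2 [sp1 sp2 Je Ee]]] := approx_increment a0 ab bT e18.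
have aT : 0 <= a <= T by rewrite a0 (le_trans ab).
have bT' : 0 <= b <= T by rewrite (le_trans a0).
have l0 : (0 : R) <= 0 by [].
have fge (c e' t : R) w C : 0 <= c -> c <= t <= e' -> 0 <= form t w C.
  by move=> c0 /andP[ct _]; apply: (chain_form_ge0 HX HA); exact: le_trans ct.
have mH i c e' := measurable_simple_difference sp1 sp2 (a := c) (b := e') i.
have mHZ c e' : 0 <= c -> e' <= T -> forall i, measurable_fun (strip c e')
    (fun p => (simple_value H1 p.1 p.2 - simple_value H2 p.1 p.2 - Z p.1 p.2) i 0).
  move=> c0 eT i; rewrite (_ : (fun p => _) = fun p : R * Om =>
      (simple_value H1 p.1 p.2 - simple_value H2 p.1 p.2) i 0 - (Z p.1 p.2) i 0); last first.
    by apply/funext => p; rewrite !mxE.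
  by apply: measurable_funB; [exact: mH|exact: measurable_integrand].
apply: (@le_trans _ _ (2%:E * En (fun t w => simple_value H1 t w - simple_value H2 t w) a b
   + 2%:E * En (fun t w => simple_value H1 t w - simple_value H2 t w - Z t w) a b)%E).
  apply: double_integral_comb => //.
  1-3: by move=> t w /=; exact: fge.
  - by apply: (measurable_chain_form HX HA a0 (C := fun t w => Z t w)) => i; exact: measurable_integrand.
  - by apply: (measurable_chain_form HX HA a0 (C := fun t w => simple_value H1 t w - simple_value H2 t w)) => i; exact: mH.
  - by apply: (measurable_chain_form HX HA a0 (C := fun t w => simple_value H1 t w - simple_value H2 t w - Z t w)); exact: mHZ.
  - move=> t w /= /andP[at_ _].
    rewrite -{1}[Z1 t w - Z2 t w](subKr (simple_value H1 t w - simple_value H2 t w)).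
    by apply: (chain_formB HX HA); exact: le_trans at_.
have E2 : (En (fun t w => simple_value H1 t w - simple_value H2 t w - Z t w) a b <= (e / 18)%:E)%E.
  apply: le_trans Ee; apply: double_integralS => //.
  - by move=> t w /=; exact: fge.
  - by apply: (measurable_chain_form HX HA l0 (C := fun t w => simple_value H1 t w - simple_value H2 t w - Z t w)); exact: mHZ.
have E1 : (En (fun t w => simple_value H1 t w - simple_value H2 t w) a b
    <= 2%:E * \int[P]_w ((I b w - I a w) ^+ 2)%:E + 2%:E * (4 * (e / 18))%:E)%E.
  rewrite -(simple_difference_isometry sp1 sp2 a0 ab).
  have sI : sqint P (fun w => I b w - I a w) by apply: sqintB; exact: stochastic_integral_sqint.
  have sJ : sqint P (fun w => simple_integral M H1 b w - simple_integral M H2 b w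
        - (simple_integral M H1 a w - simple_integral M H2 a w)).
    by apply: sqintB; apply: simple_difference_sqint => //; exact: le_trans ab.
  apply: (@le_trans _ _ (2%:E * \int[P]_w ((I b w - I a w) ^+ 2)%:E
     + 2%:E * \int[P]_w ((simple_integral M H1 b w - simple_integral M H2 b w
        - (simple_integral M H1 a w - simple_integral M H2 a w) - (I b w - I a w)) ^+ 2)%:E)%E).
    apply: integral_le_comb => //.
    1-3: by move=> w _; rewrite lee_fin sqr_ge0.
    1-3: apply/measurable_EFinP; apply: measurable_funX.
    + exact: (sqint_measurable sJ).
    + exact: (sqint_measurable sI).
    + exact: (sqint_measurable (sqintB sJ sI)).
    + move=> w _; rewrite -!EFinM -EFinD lee_fin.
      set x := _ - (simple_integral M H1 a w - _); set y := I b w - I a w.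
      by have := sqr_ge0 (x - y - y); nra.
  by rewrite leeD2l// lee_wpmul2l.
apply: (@le_trans _ _ (2%:E * (2%:E * \int[P]_w ((I b w - I a w) ^+ 2)%:E
    + 2%:E * (4 * (e / 18))%:E) + 2%:E * (e / 18)%:E)%E).
  by apply: leeD; apply: lee_wpmul2l.
set Xi := (\int[P]_w ((I b w - I a w) ^+ 2)%:E)%E.
have X0 : (0 <= Xi)%E by apply: integral_ge0 => w _; rewrite lee_fin sqr_ge0.
rewrite ge0_muleDr; [|by rewrite mule_ge0// lee_fin|].
  rewrite muleA -!EFinM -addeA -EFinD (_ : 2 * 2 = 4 :> R); last by ring.
  by rewrite (_ : 2 * (2 * (4 * (e / 18))) + 2 * (e / 18) = e)//; field.
by rewrite -EFinM lee_fin !mulr_ge0// ltW.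
Qed.

End StochasticIntegral.

(** * Measurability of the driver along a pair of processes *)

Section PreimageSigma.
Context d (T : measurableType d) (U : Type) (D : set T) (phi : T -> U).
Hypothesis mD : measurable D.

Lemma preimage_sigma : sigma_algebra setT [set C : set U | measurable (D `&` phi @^-1` C)].
Proof.
split => [|C mC|C mC] /=.
- by rewrite preimage_set0 setI0.
- rewrite (_ : D `&` _ = D `\` (D `&` phi @^-1` C)); first exact: measurableD.
  apply/seteqP; split => [x [Dx [_ nC]]|x [Dx h]]; split => //.
    by move=> [_ /nC].
  by split => // Cx; apply: h.
- by rewrite preimage_bigcup setI_bigcupr; exact: bigcupT_measurable.
Qed.

Lemma preimage_generated (G : set (set U)) :
  (forall B, G B -> measurable (D `&` phi @^-1` B)) ->
  forall C, <<s G >> C -> measurable (D `&` phi @^-1` C).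
Proof. by move=> h C; apply: (smallest_sub preimage_sigma). Qed.

End PreimageSigma.

Section RationalBoxes.
Context (R : realType) (N : nat).
Implicit Types (O : set (R * 'cV[R]_N)).

Definition rational_box (q : rat * 'cV[rat]_N * nat) : set (R * 'cV[R]_N) :=
  [set x : R * 'cV[R]_N | `|x.1 - ratr q.1.1| < q.2.+1%:R^-1 /\
           forall i, `|x.2 i 0 - ratr (q.1.2 i 0)| < q.2.+1%:R^-1].

(** The product of the line and of the column vectors has a countable base, so
    its Borel sets are generated by products of measurable sets. *)
Lemma open_rational_boxes O : open O ->
  O = \bigcup_(q in [set q | rational_box q `<=` O]) rational_box q.
Proof.
move=> oO; apply/seteqP; split => [x Ox|x [q /= qO]]; last exact: qO.
have /nbhs_ballP[e /= e0 he] : nbhs x O by exact: open_nbhs_nbhs.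
have [n ne] : exists n : nat, n.+1%:R^-1 < e / 2 :> R.
  have : n.+1%:R^-1 @[n --> \oo] --> (0 : R) by exact: cvg_harmonic.
  move=> /cvgrPdist_lt /(_ (e / 2)); rewrite divr_gt0// => /(_ isT) [n _ /(_ n (leqnn n))].
  by rewrite sub0r normrN ger0_norm// => h; exists n.
have rat_near (r : R) : exists q : rat, `|r - ratr q| < n.+1%:R^-1.
  have /rat_in_itvoo[q] : r < r + n.+1%:R^-1 by rewrite ltrDl invr_gt0.
  rewrite in_itv/= => /andP[q1 q2]; exists q.
  by rewrite ltr0_norm ?subr_lt0// opprB ltrBlDl.
have [q1 hq1] := rat_near x.1.
have /choice[q2 hq2] := fun i => rat_near (x.2 i 0).
exists (q1, \col_i q2 i, n); last by split => //= i; rewrite mxE; exact: hq2.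
move=> y [/= y1 y2]; apply: he.
have tri (u v r : R) : `|u - r| < n.+1%:R^-1 -> `|v - r| < n.+1%:R^-1 -> `|u - v| < e.
  move=> h1 h2; have : `|u - v| <= `|u - r| + `|v - r|.
    by rewrite -(normrN (v - r)) opprB; apply: le_trans (ler_normD _ _); rewrite addrA subrK.
  move: h1 h2 ne; set k := _^-1 => h1 h2 ne h3.
    by apply: le_lt_trans h3 _; rewrite [e]splitr ltrD// (lt_trans _ ne).
split; first exact: tri hq1 y1.
split=> // i j; rewrite (ord1 j) /ball/=.
by apply: tri (hq2 i) _; have := y2 i; rewrite mxE.
Qed.

End RationalBoxes.

Section Composition.
Context (R : realType) (d : measure_display) (Om : measurableType d).
Context (P : probability Om R) (N : nat) (X : R -> Om -> 'cV[R]_N).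
Hypothesis HX : rcll_markov_chain P X.
Variables (T : R) (f : R -> Om -> R -> 'cV[R]_N -> R).
Hypothesis T0 : 0 < T.
Hypothesis Hf : predictable_borel P T X f.
Variables (Y : R -> Om -> R) (Z : R -> Om -> 'cV[R]_N).
Local Notation strip := (`[0, T]%classic `*` [set: Om] : set (R * Om)).
Hypothesis mY : measurable_fun strip (fun p => Y p.1 p.2).
Hypothesis mZ : forall i, measurable_fun strip (fun p => Z p.1 p.2 i 0).

Lemma measurable_preimage_open (O : set (R * 'cV[R]_N)) : open O ->
  measurable (strip `&` (fun p => (Y p.1 p.2, Z p.1 p.2)) @^-1` O).
Proof.
move=> oO; rewrite (open_rational_boxes oO) preimage_bigcup setI_bigcupr.
rewrite bigcup_mkcond; apply: countable_bigcupT_measurable; first exact: countableP.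
move=> q; case: ifP => // _.
have lt_m (g : R * Om -> R) (r e : R) : measurable_fun strip g ->
    measurable (strip `&` [set p | `|g p - r| < e]).
  move=> mg.
  have h : measurable_fun strip (fun p => `|g p - r|).
    by apply: measurableT_comp => //; exact: measurable_funB.
  rewrite (_ : _ `&` _ = strip `&` (fun p => `|g p - r|) @^-1` `]-oo, e[%classic).
    by apply: h => //; exact: measurable_strip.
  by apply/seteqP; split => p [? /=]; rewrite ?in_itv/= => ?; split => //=; rewrite in_itv.
pose Ai i := strip `&` [set p | `|Z p.1 p.2 i 0 - ratr (q.1.2 i 0)| < q.2.+1%:R^-1].
have mAi i : measurable (Ai i) by exact: lt_m.
rewrite (_ : _ `&` _ = (strip `&` [set p | `|Y p.1 p.2 - ratr q.1.1| < q.2.+1%:R^-1])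
    `\` \bigcup_i (strip `\` Ai i)).
  apply: measurableD; first exact: lt_m.
  apply: countable_bigcupT_measurable; first exact: countableP.
  by move=> i; apply: measurableD; [exact: measurable_strip|exact: mAi].
apply/seteqP; split => [p [sp [/= h1 h2]]|p [[sp h1] h2]].
  by split => // -[i _ [_ nA]]; apply: nA; split => //=.
split => //; split => // i; apply: contrapT => h3; apply: h2; exists i => //.
by split => // -[].
Qed.

(** Composition with the predictable-Borel driver, checked on the generators of
    its sigma-field. *)
Lemma measurable_driver : measurable_fun strip (fun p => f p.1 p.2 (Y p.1 p.2) (Z p.1 p.2)).
Proof.
move=> mD U mU; rewrite setIC.
pose phi (p : R * Om) := (p, (Y p.1 p.2, Z p.1 p.2)).
have key C : predictable_borel_sets P X C -> measurable (strip `&` phi @^-1` C).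
  apply: preimage_generated => // B [B1 [B2 [pB1 oB2 ->]]].
  rewrite (_ : _ `&` _ = B1 `&` (strip `&` (fun p => (Y p.1 p.2, Z p.1 p.2)) @^-1` B2)); last first.
    by apply/seteqP; split => [p [? [? ?]]|p [? [? ?]]].
  apply: measurableI; first exact: (predictable_measurable HX pB1).
  apply: preimage_generated oB2 => //; exact: measurable_preimage_open.
have sB : sigma_algebra setT (predictable_borel_sets P X) by exact: smallest_sigma_algebra.
have pD : predictable_borel_sets P X (strip `*` setT).
  apply: sub_sigma_algebra; exists strip, setT; split => //; first exact: predictable_strip.
  by apply: sub_sigma_algebra; exact: openT.
have /key : predictable_borel_sets P X ((strip `*` setT) `&`
    (fun p => f p.1.1 p.1.2 p.2.1 p.2.2) @^-1` U).
  have := Hf _ mU; rewrite /measurable/= (sigma_algebra_id sB); apply.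
  exact: pD.
rewrite (_ : _ `&` _ = strip `&` phi @^-1` ((strip `*` setT) `&`
    (fun p => f p.1.1 p.1.2 p.2.1 p.2.2) @^-1` U))//.
by apply/seteqP; split => [p [? ?]|p [? [[? ?] ?]]].
Qed.

End Composition.

(** * Extended squares, time integrals and almost sure comparisons *)

Section ExtendedSquares.
Context (R : realType).
Local Open Scope ereal_scope.
Implicit Types x y : \bar R.

Lemma sqre_add_le x y : 0 <= x -> 0 <= y ->
  (x + y) ^+ 2 <= 2%:E * x ^+ 2 + 2%:E * y ^+ 2.
Proof.
move: x y => [x| |] [y| |] //; rewrite ?lee_fin => x0 y0.
- by have := sqr_ge0 (x - y)%R; rewrite expr2; nra.
- by rewrite [X in _ + 2%:E * X](_ : _ = +oo) ?gt0_muley ?lte_fin// ?addey ?leey// expe2 mulyy.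
- by rewrite [X in 2%:E * X](_ : _ = +oo) ?gt0_muley ?lte_fin// ?addye ?leey// expe2 mulyy.
- by rewrite [X in 2%:E * X](_ : _ = +oo) ?gt0_muley ?lte_fin// ?addye ?leey// expe2 mulyy.
Qed.

Lemma sqre_le x y : 0 <= x -> x <= y -> x ^+ 2 <= y ^+ 2.
Proof. by move=> x0 xy; rewrite !expe2 lee_pmul. Qed.

End ExtendedSquares.

Section TimeSquares.
Context (R : realType).
Local Notation mu := (@lebesgue_measure R).
Implicit Types (h k : R -> R) (a b : R).

Lemma time_sqr_integrable h a b : measurable_fun (`[a, b]%classic : set R) h ->
  (\int[mu]_(t in `[a, b]) ((h t) ^+ 2)%:E < +oo)%E -> mu.-integrable `[a, b] (EFin \o h).
Proof.
move=> mh hoo.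
have mh2 : measurable_fun (`[a, b]%classic : set R) (fun t => (h t) ^+ 2).
  by apply: measurable_funX.
have i2 : mu.-integrable `[a, b] (EFin \o (fun t => (h t) ^+ 2)).
  apply/integrableP; split; first exact/measurable_EFinP.
  by under eq_integral do rewrite /= ger0_norm ?sqr_ge0//.
have i1 : mu.-integrable `[a, b] (EFin \o (fun=> 1)).
  by apply: (@bounded_integrable_itv _ (fun=> 1) a b 1) => // u _; rewrite normr1.
have mI : measurable (`[a, b]%classic : set (measurableTypeR R)) by [].
have i3 := integrableD_in mI i1 i2.
apply: (le_integrable mI _ _ i3); first exact/measurable_EFinP.
move=> t _ /=; rewrite lee_fin (ger0_norm (addr_ge0 ler01 (sqr_ge0 _))).
rewrite -(real_normK (num_real (h t))).
by have := sqr_ge0 (`|h t| - 1); nra.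
Qed.

Lemma time_sqr_integral_le h a b : a < b -> measurable_fun (`[a, b]%classic : set R) h ->
  ((\int[mu]_(t in `[a, b]) `|h t|%:E) ^+ 2 <=
   (b - a)%:E * \int[mu]_(t in `[a, b]) ((h t) ^+ 2)%:E)%E.
Proof.
move=> ab mh; apply: sqr_integral_le => //; last by rewrite subr_gt0.
by rewrite /= lebesgue_measure_itv/= lte_fin ab -EFinB.
Qed.

End TimeSquares.

Section AlmostSure.
Context (R : realType) (d : measure_display) (Om : measurableType d).
Context (P : probability Om R).
Local Notation mu := (@lebesgue_measure R).

Lemma ae_lty (F : Om -> \bar R) : measurable_fun setT F -> (forall w, 0 <= F w)%E ->
  (\int[P]_w F w < +oo)%E -> {ae P, forall w, (F w < +oo)%E}.
Proof.
move=> mF F0 Foo.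
have iF : P.-integrable setT F.
  by apply/integrableP; split => //; under eq_integral do rewrite gee0_abs//.
have := integrable_ae measurableT iF; apply: filterS => w /(_ I).
by rewrite ge0_fin_numE.
Qed.

Lemma ge0_ae_le (F G : Om -> \bar R) : measurable_fun setT F -> measurable_fun setT G ->
  (forall w, 0 <= F w)%E -> (forall w, 0 <= G w)%E ->
  {ae P, forall w, (F w <= G w)%E} -> (\int[P]_w F w <= \int[P]_w G w)%E.
Proof.
move=> mF mG F0 G0 FG; apply: ae_ge0_le_integral => //.
by apply: filterS FG => w h _.
Qed.

End AlmostSure.

(** * The equation of one solution *)

Section OneSolution.
Context (R : realType) (d : measure_display) (Om : measurableType d).
Context (P : probability Om R) (N : nat) (A : R -> 'M[R]_N) (X : R -> Om -> 'cV[R]_N).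
Hypothesis HX : rcll_markov_chain P X.
Hypothesis HA : rate_matrix A.
Variables (T c c1 c2 : R) (f : R -> Om -> R -> 'cV[R]_N -> R).
Hypothesis T0 : 0 < T.
Hypothesis c1c : c1 <= c.
Hypothesis c2c : c2 <= c.
Hypothesis Hf : predictable_borel P T X f.
Hypothesis Hlip : lipschitz_driver P T A X f c1 c2.
Local Notation mu := (@lebesgue_measure R).
Local Notation strip a b := (`[a, b]%classic `*` [set: Om] : set (R * Om)).
Local Notation form := (chain_form A X).
Implicit Types (a b s t : R) (w : Om).

Lemma adapted_rcll_joint (Y : R -> Om -> R) : adapted_rcll P T X Y ->
  measurable_fun (strip 0 T) (fun p => Y p.1 p.2).
Proof.
move=> [aY rY]; apply: measurable_right_continuous => [t tT|w t tT|].
- exact: (filtration_measurable_fun HX (aY t tT)).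
- by have [r _] := rY w; exact: r.
- exact: ltW.
Qed.

Lemma form_sqrt t w C : 0 <= t -> Num.sqrt (form t w C) ^+ 2 = form t w C.
Proof. by move=> t0; rewrite sqr_sqrtr// (chain_form_ge0 HX HA). Qed.

Lemma seminorm_form t w C : 0 <= t -> ~ jump_times X w t ->
  seminorm A X t w C = Num.sqrt (form t w C).
Proof.
move=> t0 nJ; rewrite -(seminorm_sqr HX HA C t0 nJ) sqrtr_sqr.
by symmetry; apply: ger0_norm; exact: sqrtr_ge0.
Qed.

(** The Lipschitz condition with the current state of the chain: off the jump
    times both seminorms agree. *)
Lemma lipschitz_form : {ae P, forall w t v1 v2 z1 z2, 0 <= t <= T -> ~ jump_times X w t ->
  `|f t w v1 z1 - f t w v2 z2| <= c * `|v1 - v2| + c * Num.sqrt (form t w (z1 - z2))}.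
Proof.
apply: filterS Hlip => w h t v1 v2 z1 z2 tT nJ; have /andP[t0 _] := tT.
apply: le_trans (h t v1 v2 z1 z2 tT) _; rewrite seminorm_form//.
by apply: lerD; rewrite ler_wpM2r// sqrtr_ge0.
Qed.

Lemma finite_energy_form (Z : R -> Om -> 'cV[R]_N) :
  (forall i, measurable_fun (strip 0 T) (fun p => Z p.1 p.2 i 0)) ->
  finite_energy P T (fun t w => seminorm A X t w (Z t w)) ->
  (double_integral P 0 T (fun p => form p.1 p.2 (Z p.1 p.2)) < +oo)%E.
Proof.
move=> mZ; rewrite /finite_energy /double_integral.
by under eq_integral do rewrite (integral_seminorm_sqr HX HA (C := Z) _ (lexx 0) mZ).
Qed.

Lemma ae_inner_finite (F : R * Om -> R) : measurable_fun (strip 0 T) F ->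
  (forall t w, 0 <= t <= T -> 0 <= F (t, w)) ->
  (double_integral P 0 T F < +oo)%E ->
  {ae P, forall w, (\int[mu]_(t in `[0%R, T]) (F (t, w))%:E < +oo)%E}.
Proof.
move=> mF F0 Foo; apply: ae_lty Foo; first exact: measurable_inner.
by move=> w; exact: inner_ge0.
Qed.

Lemma ae_countable_le (w : Om) (F G : R -> R) a b : 0 <= a ->
  measurable_fun (`[a, b]%classic : set R) F -> measurable_fun (`[a, b]%classic : set R) G ->
  (forall t, a <= t <= b -> 0 <= F t) -> (forall t, a <= t <= b -> 0 <= G t) ->
  (forall t, a <= t <= b -> ~ jump_times X w t -> F t <= G t) ->
  (\int[mu]_(t in `[a, b]) (F t)%:E <= \int[mu]_(t in `[a, b]) (G t)%:E)%E.
Proof.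
move=> a0 mF mG F0 G0 FG; apply: ae_ge0_le_integral => //;
  [exact/measurable_EFinP|exact/measurable_EFinP|].
have cJ := countable_jump_times HX w.
exists (jump_times X w); split; [|exact: countable_lebesgue_measure0|].
  by apply: countable_measurable.
move=> t /= h; apply: contrapT => nJ; apply: h; rewrite /= in_itv/= lee_fin => tab.
exact: FG.
Qed.

Variables (Y phi : R -> Om -> R) (Z : R -> Om -> 'cV[R]_N).
Hypothesis aY : adapted_rcll P T X Y.
Hypothesis eY : finite_energy P T Y.
Hypothesis pZ : forall i, predictable P T X (fun t w => Z t w i 0).
Hypothesis eZ : finite_energy P T (fun t w => seminorm A X t w (Z t w)).
Hypothesis ef : finite_energy P T (fun t w => f t w 0 0).
Hypothesis pphi : predictable P T X phi.
Hypothesis ephi : finite_energy P T phi.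

Definition driver t w := f t w (Y t w) (Z t w) + phi t w.

Lemma measurable_driver_strip : measurable_fun (strip 0 T) (fun p => driver p.1 p.2).
Proof.
apply: measurable_funD; last exact: (predictable_joint HX T0 pphi).
apply: (measurable_driver HX T0 Hf (adapted_rcll_joint aY)) => i.
exact: (predictable_joint HX T0 (pZ i)).
Qed.

(** Cauchy-Schwarz bounds the driver by quantities with finite energy:
    [f(t,0,0)], [Y], the form of [Z] and [phi]. Integrability makes it possible to
    subtract the equations and to cut their integrals. *)
Lemma driver_integrable : {ae P, forall w,
  mu.-integrable `[0, T] (EFin \o (fun t => driver t w))}.
Proof.
have mY := adapted_rcll_joint aY.
have mZ i := predictable_joint HX T0 (pZ i).
have mphi := predictable_joint HX T0 pphi.
have mf0 : measurable_fun (strip 0 T) (fun p => f p.1 p.2 0 0).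
  apply: (measurable_driver HX T0 Hf (Y := fun _ _ => 0) (Z := fun _ _ => 0)) => // i.
have mform := measurable_chain_form HX HA (C := Z) (lexx 0) mZ.
have sq (g : R * Om -> R) : measurable_fun (strip 0 T) g -> measurable_fun (strip 0 T) (fun p => (g p) ^+ 2).
  by move=> mg; apply: measurable_funX.
have a1 := ae_inner_finite (sq _ mY) (fun t w _ => sqr_ge0 _) eY.
have a2 := ae_inner_finite (sq _ mphi) (fun t w _ => sqr_ge0 _) ephi.
have a3 := ae_inner_finite (sq _ mf0) (fun t w _ => sqr_ge0 _) ef.
have f0 t w : 0 <= t <= T -> 0 <= form t w (Z t w).
  by move=> /andP[t0 _]; exact: (chain_form_ge0 HX HA).
have a4 := ae_inner_finite mform f0 (finite_energy_form mZ eZ).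
have a5 := lipschitz_form.
apply: filterS2 (filterI a1 a2) (filterI (filterI a3 a4) a5) => w [h1 h2] [[h3 h4] h5].
apply: time_sqr_integrable; first exact: (measurable_strip_time measurable_driver_strip w).
have mt (g : R * Om -> R) : measurable_fun (strip 0 T) g ->
    measurable_fun (`[0, T]%classic : set R) (fun t => g (t, w)).
  by move=> mg; exact: (measurable_strip_time mg w).
pose Q t := 4 * (f t w 0 0) ^+ 2 + 8 * c ^+ 2 * (Y t w) ^+ 2 + 8 * c ^+ 2 * form t w (Z t w)
   + 4 * (phi t w) ^+ 2.
have mI : measurable (`[0, T]%classic : set (measurableTypeR R)) by [].
have ige (g : R -> R) : measurable_fun (`[0, T]%classic : set R) g ->
   (forall t, 0 <= t <= T -> 0 <= g t) -> (\int[mu]_(t in `[0%R, T]) (g t)%:E < +oo)%E ->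
   mu.-integrable `[0, T] (EFin \o g).
  move=> mg g0 goo; apply/integrableP; split; first exact/measurable_EFinP.
  suff -> : (\int[mu]_(t in `[0%R, T]) `|(EFin \o g) t| = \int[mu]_(t in `[0%R, T]) (g t)%:E)%E by [].
  apply: eq_integral => t; rewrite inE/= in_itv/= => tT.
  by rewrite ger0_norm// g0.
have iQ : mu.-integrable `[0, T] (EFin \o Q).
  apply: (integrableD_in mI); last first.
    apply: (integrableZ_in mI); apply: ige => //.
      by apply: measurable_funX; exact: (mt _ mphi).
    by move=> t _; exact: sqr_ge0.
  apply: (integrableD_in mI); last first.
    apply: (integrableZ_in mI); apply: ige => //; last by move=> t; exact: f0.
    exact: (mt _ mform).
  apply: (integrableD_in mI).
    apply: (integrableZ_in mI); apply: ige => //.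
      by apply: measurable_funX; exact: (mt _ mf0).
    by move=> t _; exact: sqr_ge0.
  apply: (integrableZ_in mI); apply: ige => //.
    by apply: measurable_funX; exact: (mt _ mY).
  by move=> t _; exact: sqr_ge0.
have Q0 t : 0 <= t <= T -> 0 <= Q t.
  move=> tT; have := f0 t w tT; rewrite /Q => h.
  have p4 : (0 : R) <= 4 by [].
  have c20 : 0 <= 8 * c ^+ 2 by rewrite mulr_ge0// sqr_ge0.
  exact: (addr_ge0 (addr_ge0 (addr_ge0 (mulr_ge0 p4 (sqr_ge0 _)) (mulr_ge0 c20 (sqr_ge0 _)))
    (mulr_ge0 c20 h)) (mulr_ge0 p4 (sqr_ge0 _))).
have Qoo : (\int[mu]_(t in `[0%R, T]) (Q t)%:E < +oo)%E.
  have /integrableP[_] := iQ.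
  suff -> : (\int[mu]_(t in `[0%R, T]) `|(EFin \o Q) t| = \int[mu]_(t in `[0%R, T]) (Q t)%:E)%E by [].
  apply: eq_integral => t; rewrite inE/= in_itv/= => tT.
  by rewrite ger0_norm// Q0.
apply: le_lt_trans Qoo; apply: (@ae_countable_le w) => //.
- by apply: measurable_funX; exact: (mt _ measurable_driver_strip).
- by apply/measurable_EFinP; exact: (measurable_int mu iQ).
- by move=> t _; exact: sqr_ge0.
move=> t tT nJ; have /andP[t0 _] := tT.
have := h5 t (Y t w) 0 (Z t w) 0 tT nJ; rewrite !subr0 /driver /Q.
have := form_sqrt w (Z t w) t0; set s := Num.sqrt _ => s2.
have s0 : 0 <= s by exact: sqrtr_ge0.
rewrite -s2; set u := f t w (Y t w) _; set v := f t w 0 0; set ph := phi t w.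
rewrite -(real_normK (num_real (Y t w))); set n := `|Y t w| => h.
have D2 : (u - v) ^+ 2 <= (c * n + c * s) ^+ 2.
  rewrite -(real_normK (num_real (u - v))) lerXn2r ?nnegrE//.
  exact: le_trans h.
have e1 : (u + ph) ^+ 2 <= 2 * u ^+ 2 + 2 * ph ^+ 2 by have := sqr_ge0 (u - ph); nra.
have e2 : u ^+ 2 <= 2 * v ^+ 2 + 2 * (u - v) ^+ 2 by have := sqr_ge0 (u - v - v); nra.
have e3 : (c * n + c * s) ^+ 2 <= 2 * (c ^+ 2 * n ^+ 2) + 2 * (c ^+ 2 * s ^+ 2).
  by have := sqr_ge0 (c * n - c * s); nra.
have e4 := sqr_ge0 ph.
have -> : 8 * c ^+ 2 * n ^+ 2 = 8 * (c ^+ 2 * n ^+ 2) by rewrite mulrA.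
have -> : 8 * c ^+ 2 * s ^+ 2 = 8 * (c ^+ 2 * s ^+ 2) by rewrite mulrA.
move: D2 e1 e2 e3 e4; clear.
move: ((u + ph) ^+ 2) (u ^+ 2) (ph ^+ 2) ((u - v) ^+ 2) ((c * n + c * s) ^+ 2).
move: (c ^+ 2 * n ^+ 2) (c ^+ 2 * s ^+ 2) (v ^+ 2) => *; lra.
Qed.

End OneSolution.

(** * The backward estimate *)

Lemma ge0_integral_comb3 (R : realType) (d : measure_display) (T : measurableType d)
  (mu : {measure set T -> \bar R}) (k l : R) (f g h : T -> \bar R) : 0 <= k -> 0 <= l ->
  (forall x, 0 <= f x)%E -> (forall x, 0 <= g x)%E -> (forall x, 0 <= h x)%E ->
  measurable_fun setT f -> measurable_fun setT g -> measurable_fun setT h ->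
  (\int[mu]_x (k%:E * f x + k%:E * g x + l%:E * h x) =
   k%:E * \int[mu]_x f x + k%:E * \int[mu]_x g x + l%:E * \int[mu]_x h x)%E.
Proof.
move=> k0 l0 f0 g0 h0 mf mg mh.
have kf x : (0 <= k%:E * f x)%E by rewrite mule_ge0.
have kg x : (0 <= k%:E * g x)%E by rewrite mule_ge0.
have lh x : (0 <= l%:E * h x)%E by rewrite mule_ge0.
have mkf : measurable_fun setT (fun x => k%:E * f x)%E by exact: measurable_funeM.
have mkg : measurable_fun setT (fun x => k%:E * g x)%E by exact: measurable_funeM.
have mlh : measurable_fun setT (fun x => l%:E * h x)%E by exact: measurable_funeM.
rewrite ge0_integralD//; last 2 first.
- by move=> x _; rewrite adde_ge0.
- exact: emeasurable_funD.
by rewrite ge0_integralD// !ge0_integralZl.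
Qed.

Section DoubleIntegralCut.
Context (R : realType) (d : measure_display) (Om : measurableType d).
Context (P : probability Om R).
Local Notation mu := (@lebesgue_measure R).
Local Notation strip a b := (`[a, b]%classic `*` [set: Om] : set (R * Om)).
Implicit Types (G : R * Om -> R) (a b e : R).

Lemma double_integral_cut a b e G : a <= b -> b <= e ->
  (forall t w, a <= t <= e -> 0 <= G (t, w)) -> measurable_fun (strip a e) G ->
  (double_integral P a e G <= double_integral P a b G + double_integral P b e G)%E.
Proof.
move=> ab be G0 mG.
have G0l t w : a <= t <= b -> 0 <= G (t, w).
  by move=> /andP[at_ tb]; rewrite G0// at_ (le_trans tb).
have G0r t w : b <= t <= e -> 0 <= G (t, w).
  by move=> /andP[bt te]; rewrite G0// te (le_trans ab).
have mGl : measurable_fun (strip a b) G.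
  apply: measurable_funS mG; first exact: measurable_strip.
  move=> [t w] [/= + _]; rewrite in_itv/= => /andP[at_ tb]; split => //=.
  by rewrite in_itv/= at_ (le_trans tb).
have mGr : measurable_fun (strip b e) G.
  apply: measurable_funS mG; first exact: measurable_strip.
  move=> [t w] [/= + _]; rewrite in_itv/= => /andP[bt te]; split => //=.
  by rewrite in_itv/= te (le_trans ab).
rewrite /double_integral -ge0_integralD//; last first.
- exact: measurable_inner.
- by move=> w _; exact: inner_ge0.
- exact: measurable_inner.
- by move=> w _; exact: inner_ge0.
apply: ge0_le_integral => //.
- by move=> w _; exact: inner_ge0.
- exact: measurable_inner.
- by apply: emeasurable_funD; exact: measurable_inner.
move=> w _.
have mE : measurable_fun `[a, e] (EFin \o (fun t => G (t, w))).
  by apply/measurable_EFinP; exact: (measurable_strip_time mG w).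
have split_itv : `[a, e]%classic = `[a, b]%classic `|` `]b, e]%classic :> set R.
  by apply: itv_bndbnd_setU; rewrite bnd_simp.
rewrite [X in (\int[mu]_(t in X) _)%E]split_itv ge0_integral_setU//=.
- apply: leeD2l; apply: ge0_subset_integral => //.
  + by apply/measurable_EFinP; exact: (measurable_strip_time mGr w).
  + by move=> t; rewrite /= in_itv/= lee_fin; exact: G0r.
  + by move=> t; rewrite /= !in_itv/= => /andP[/ltW -> ->].
- exact: (eq_ind _ (fun D : set R => measurable_fun D _) mE _ split_itv).
- move=> t; rewrite /= !in_itv/= => -[/andP[at_ tb]|/andP[bt te]]; rewrite lee_fin; apply: G0.
    by rewrite at_ (le_trans tb).
  by rewrite te (le_trans ab)// ltW.
- apply/disj_setPS => t [/=]; rewrite !in_itv/= => /andP[_ tb] /andP[bt _].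
  by move: (lt_le_trans bt tb); rewrite ltxx.
Qed.

Lemma double_integral_point a G : (double_integral P a a G = 0)%E.
Proof.
rewrite /double_integral; apply: integral0_eq => w _.
by rewrite set_itv1 integral_set1.
Qed.

End DoubleIntegralCut.

(** The length [T / step_count] is at most 1 and at most [1 / (856 c^2)]. *)
Definition step_count (R : realType) (T c : R) : nat :=
  (Num.truncn (T + 856 * (c ^+ 2 * T))).+1.

Section BackwardEstimate.
Context (R : realType) (d : measure_display) (Om : measurableType d).
Context (P : probability Om R) (T c : R) (F : R -> set (set Om)).
Local Notation mu := (@lebesgue_measure R).
Local Notation strip a b := (`[a, b]%classic `*` [set: Om] : set (R * Om)).
Implicit Types (a b s t : R) (w : Om).
Hypothesis sF : forall t, 0 <= t <= T -> sigma_algebra setT (F t).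
Hypothesis FM : forall t, 0 <= t <= T -> F t `<=` measurable.
Hypothesis FS : forall s t, 0 <= s -> s <= t -> t <= T -> F s `<=` F t.
Variables (y I : R -> Om -> R) (q : R * Om -> R) (psi : Om -> \bar R).
Hypothesis Iad : forall t, 0 <= t <= T -> measurable_wrt (F t) setT (I t).
Hypothesis Isq : forall t, 0 <= t <= T -> sqint P (I t).
Hypothesis Imart : forall s t B, 0 <= s -> s <= t -> t <= T -> F s B ->
  (\int[P]_(w in B) (I t w - I s w)%:E = 0)%E.
Hypothesis Ir : forall w t, 0 <= t < T -> I s w @[s --> t^'+] --> I t w.
Hypothesis yad : forall t, 0 <= t <= T -> measurable_wrt (F t) setT (y t).
Hypothesis ym : measurable_fun (strip 0 T) (fun p => y p.1 p.2).
Hypothesis qm : measurable_fun (strip 0 T) q.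
Hypothesis q0 : forall t w, 0 <= t <= T -> 0 <= q (t, w).
Local Notation y2 := (fun p : R * Om => (y p.1 p.2) ^+ 2).
Local Notation DI a b G := (double_integral P a%R b%R G%R).
Hypothesis yoo : (DI 0 T y2 < +oo)%E.
Hypothesis qoo : (DI 0 T q < +oo)%E.
Hypothesis qI : forall a b, 0 <= a -> a <= b -> b <= T ->
  (DI a b q <= 4%:E * \int[P]_w ((I b w - I a w) ^+ 2)%:E)%E.
Hypothesis psim : measurable_fun setT psi.
Hypothesis psi0 : forall w, (0 <= psi w)%E.

(** The bound of [(int_a^b |g|)^2] obtained from the Lipschitz condition, where
    [q] is the squared size of the integrand and [psi] the square of
    [int_0^T |phi1 - phi2|]. *)
Definition driver_bound a b w : \bar R :=
  ((4 * c ^+ 2 * (b - a))%:E * (\int[mu]_(t in `[a, b]) ((y t w) ^+ 2)%:E)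
   + (4 * c ^+ 2 * (b - a))%:E * (\int[mu]_(t in `[a, b]) (q (t, w))%:E)
   + 2%:E * psi w)%E.

Hypothesis driver_boundP : forall a b, 0 <= a -> a < b -> b <= T ->
  {ae P, forall w t, a <= t <= b ->
     (((y t w - y b w + (I b w - I t w)) ^+ 2)%:E <= driver_bound a b w)%E}.

Let y_measurable t : 0 <= t <= T -> measurable_fun setT (y t).
Proof.
move=> tT; apply: (measurable_wrt_fun (sF tT) (FM tT) _ (yad tT)).
exact: (sub_sigma_algebraT (sF tT)).
Qed.

Let stripS a b (G : R * Om -> R) : 0 <= a -> b <= T -> measurable_fun (strip 0 T) G ->
  measurable_fun (strip a b) G.
Proof.
move=> a0 bT; apply: measurable_funS; first exact: measurable_strip.
move=> [t w] [/= + _]; rewrite in_itv/= => /andP[ta tb]; split => //=.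
by rewrite in_itv/= (le_trans a0 ta) (le_trans tb bT).
Qed.

Let y2m : measurable_fun (strip 0 T) y2.
Proof. by apply: measurable_funX. Qed.

Let sub_itv a b t : 0 <= a -> b <= T -> a <= t <= b -> 0 <= t <= T.
Proof. by move=> a0 bT /andP[/(le_trans a0) -> /le_trans ->]. Qed.

Section Interval.
Variables (a b : R).
Hypothesis a0 : 0 <= a.
Hypothesis ab : a < b.
Hypothesis bT : b <= T.

Let aT : 0 <= a <= T. Proof. by rewrite a0 (le_trans (ltW ab)). Qed.
Let bT' : 0 <= b <= T. Proof. by rewrite bT (le_trans a0 (ltW ab)). Qed.

Let iy w := (\int[mu]_(t in `[a, b]) ((y t w) ^+ 2)%:E)%E.
Let iq w := (\int[mu]_(t in `[a, b]) (q (t, w))%:E)%E.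
Let k := 4 * c ^+ 2 * (b - a).
Let k0 : (0 <= k%:E)%E.
Proof. by rewrite lee_fin; apply: mulr_ge0; [rewrite mulr_ge0 ?sqr_ge0|rewrite subr_ge0 ltW]. Qed.

Let iy0 w : (0 <= iy w)%E.
Proof. by apply: integral_ge0 => t _; rewrite lee_fin sqr_ge0. Qed.

Let q0ab t w : a <= t <= b -> 0 <= q (t, w).
Proof. by move=> tab; apply: q0; exact: (sub_itv a0 bT tab). Qed.

Let iq0 w : (0 <= iq w)%E.
Proof. exact: inner_ge0. Qed.

Let miy : measurable_fun setT iy.
Proof.
apply: (measurable_inner (F := y2)); first exact: (stripS a0 bT y2m).
by move=> t w _; exact: sqr_ge0.
Qed.

Let miq : measurable_fun setT iq.
Proof. by apply: measurable_inner => //; exact: stripS. Qed.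

Lemma driver_bound_ge0 w : (0 <= driver_bound a b w)%E.
Proof. by rewrite !adde_ge0// mule_ge0//; [exact: iy0|exact: iq0]. Qed.

Lemma measurable_driver_bound : measurable_fun setT (driver_bound a b).
Proof.
apply: emeasurable_funD; last exact: measurable_funeM.
by apply: emeasurable_funD; exact: measurable_funeM.
Qed.

Lemma integral_driver_bound : (\int[P]_w driver_bound a b w =
  k%:E * DI a b y2 + k%:E * DI a b q + 2%:E * \int[P]_w psi w)%E.
Proof.
exact: ge0_integral_comb3.
Qed.

Let eta := (\int[P]_w ((y b w) ^+ 2)%:E)%E.
Let Gam := (\int[P]_w driver_bound a b w)%E.
Let eta0 : (0 <= eta)%E. Proof. by apply: integral_ge0 => w _; rewrite lee_fin sqr_ge0. Qed.
Let Gam0 : (0 <= Gam)%E. Proof. by apply: integral_ge0 => w _; exact: driver_bound_ge0. Qed.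

Let sqre_measurable (g : Om -> R) : measurable_fun setT g ->
  measurable_fun setT (fun w => ((g w) ^+ 2)%:E).
Proof. by move=> mg; apply/measurable_EFinP; apply: measurable_funX. Qed.

(** The orthogonality of [y_a] and [I_b - I_a] is the heart of the proof:
    the sum of the two is [y_b] plus the integral of the driver, and it has a
    larger mean square than its martingale part. If the right side is infinite
    there is nothing to prove; if it is finite then so is the mean square of [y_a]. *)
Lemma martingale_increment_le : (\int[P]_w ((I b w - I a w) ^+ 2)%:E <= 2%:E * eta + 2%:E * Gam)%E.
Proof.
have [->|] := eqVneq eta +oo%E.
  by rewrite gt0_muley ?lte_fin// addye ?leey// gt_eqF// (lt_le_trans (ltNyr 0))// mule_ge0.
rewrite -ltey => etaoo; have [->|] := eqVneq Gam +oo%E.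
  rewrite [X in (_ + X)%E]gt0_muley ?lte_fin// addey ?leey// gt_eqF//.
  by rewrite (lt_le_trans (ltNyr 0))// mule_ge0.
rewrite -ltey => Gamoo.
have sI : sqint P (fun w => I b w - I a w) by apply: sqintB; exact: Isq.
pose U w := y a w + (I b w - I a w).
have mU : measurable_fun setT U.
  by apply: measurable_funD; [exact: y_measurable|exact: (sqint_measurable sI)].
have mb : measurable_fun setT (fun w => ((y b w) ^+ 2)%:E) by apply: sqre_measurable; exact: y_measurable.
have UE : (\int[P]_w ((U w) ^+ 2)%:E <= 2%:E * eta + 2%:E * Gam)%E.
  have ge w : (0 <= 2%:E * ((y b w) ^+ 2)%:E)%E by rewrite mule_ge0 ?lee_fin ?sqr_ge0.
  have ge' w : (0 <= 2%:E * driver_bound a b w)%E by rewrite mule_ge0 ?driver_bound_ge0.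
  have mb2 : measurable_fun setT (fun w => 2%:E * ((y b w) ^+ 2)%:E)%E by exact: measurable_funeM.
  have mG2 : measurable_fun setT (fun w => 2%:E * driver_bound a b w)%E.
    by apply: measurable_funeM; exact: measurable_driver_bound.
  apply: (@le_trans _ _ (\int[P]_w (2%:E * ((y b w) ^+ 2)%:E + 2%:E * driver_bound a b w))%E).
    apply: ge0_ae_le.
    - exact: sqre_measurable.
    - exact: emeasurable_funD.
    - by move=> w; rewrite lee_fin sqr_ge0.
    - by move=> w; rewrite adde_ge0.
    apply: filterS (driver_boundP a0 ab bT) => w /(_ a); rewrite lexx ltW// => /(_ isT) h.
    have : ((U w ^+ 2)%:E <= 2%:E * ((y b w) ^+ 2)%:E + 2%:E * ((U w - y b w) ^+ 2)%:E)%E.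
      rewrite -!EFinM -EFinD lee_fin; have := sqr_ge0 (U w - y b w - y b w); nra.
    move=> /le_trans; apply; apply: leeD2l; apply: lee_wpmul2l; first by [].
    by rewrite (_ : U w - y b w = y a w - y b w + (I b w - I a w)) // /U; ring.
  rewrite ge0_integralD// !ge0_integralZl//.
  - exact: measurable_driver_bound.
  - by move=> w _; exact: driver_bound_ge0.
  - by move=> w _; rewrite lee_fin sqr_ge0.
apply: (le_trans _ UE).
have sU : sqint P U.
  split; first exact: mU.
  by apply: (le_lt_trans UE); apply: lte_add_pinfty; apply: lte_mul_pinfty.
have sya : sqint P (y a).
  have := sqintB sU sI; congr sqint; apply/funext => w; rewrite /U; ring.
have iyI := sqintM_integrable sya sI.
have orth : (\int[P]_w (y a w * (I b w - I a w))%:E = 0)%E.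
  apply: (orth_measurable_wrt (sF aT) (FM aT) _ _ (yad aT) iyI).
    exact: (sqint_integrable sI).
  by move=> B FB; apply: Imart => //; exact: ltW.
have iU := sqint_sqr sU.
have -> : (\int[P]_w ((U w) ^+ 2)%:E =
    \int[P]_w ((U w) ^+ 2 - 2 * (y a w * (I b w - I a w)))%:E)%E.
  under [RHS]eq_integral do rewrite EFinB.
  rewrite integralB//; last exact: (integrableZ_EFin 2 iyI).
  under [X in (_ - X)%E]eq_integral do rewrite EFinM.
  by rewrite integralZl// orth mule0 sube0.
apply: ge0_ae_le.
- by apply: sqre_measurable; exact: (sqint_measurable sI).
- apply/measurable_EFinP; apply: measurable_funB; first by apply: measurable_funX.
  apply: measurable_funM => //; apply: measurable_funM; first exact: y_measurable.
  exact: (sqint_measurable sI).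
- by move=> w; rewrite lee_fin sqr_ge0.
- by move=> w; rewrite lee_fin /U; have := sqr_ge0 (y a w); have := sqr_ge0 (I b w - I a w); nra.
- by apply: aeW => w; rewrite lee_fin /U; have := sqr_ge0 (y a w); nra.
Qed.


Hypothesis short : b - a <= 1.
Hypothesis small : 856 * (c ^+ 2 * (b - a)) <= 1.

Let H := (\int[P]_w psi w)%E.
Let H0 : (0 <= H)%E. Proof. exact: integral_ge0. Qed.
Let V := DI a b q.
Let V0 : (0 <= V)%E. Proof. exact: double_integral_ge0. Qed.
Let Voo : (V < +oo)%E.
Proof. by apply: le_lt_trans qoo; apply: double_integralS. Qed.
Let e := DI a b y2.
Let y20 t w (_ : a <= t <= b) : 0 <= y2 (t, w) := sqr_ge0 _.
Let e0 : (0 <= e)%E. Proof. exact: double_integral_ge0. Qed.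
Let eoo : (e < +oo)%E.
Proof. by apply: le_lt_trans yoo; apply: double_integralS => // t w _; exact: sqr_ge0. Qed.

(** From [y_t = y_b + int_t^b g - (I_b - I_t)] the bound
    [S = 3 y_b^2 + 3 driver_bound + 12 S0] dominates [y_t^2] on the interval, where
    [S0] is Doob's bound of [(I_t - I_a)^2]. With [G] the mean of [driver_bound],
    the mean of [S] is at most [99 (E y_b^2 + G)] and the energy of [q] at most
    [8 (E y_b^2 + G)]. Since [G] is [4 c^2 (b - a)] times the energies of [y] and
    [q], plus [2 E psi], the hypothesis [small] makes [107 G] at most half of the
    left side plus [214 E psi]. *)
Lemma short_interval_estimate : exists S : Om -> \bar R,
  [/\ measurable_fun setT S, forall w, (0 <= S w)%E,
      {ae P, forall w t, a <= t <= b -> (((y t w) ^+ 2)%:E <= S w)%E} &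
      (\int[P]_w S w + DI a b q <= 428%:E * (\int[P]_w ((y b w) ^+ 2)%:E + \int[P]_w psi w))%E].
Proof.
(* with infinite data the constant bound +oo will do *)
have [etaH|] := eqVneq (eta + H)%E +oo%E.
  exists (fun=> +oo%E); split; [exact: measurable_cst|by []|by apply: aeW => w t _; exact: leey|].
  by rewrite etaH gt0_muley; [exact: leey|rewrite lte_fin ltr0n].
rewrite -ltey => etaHoo.
have etaoo : (eta < +oo)%E by apply: le_lt_trans etaHoo; exact: leeDl.
have Hoo : (H < +oo)%E by apply: le_lt_trans etaHoo; exact: leeDr.
pose m t w := I t w - I a w.
have sub t : a <= t <= b -> 0 <= t <= T by exact: sub_itv.
have ms t : a <= t <= b -> sqint P (m t).
  by move=> tab; apply: sqintB; apply: Isq => //; exact: sub.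
have mad t : a <= t <= b -> measurable_wrt (F t) setT (m t).
  move=> tab; apply: measurable_funB; first by apply: Iad; exact: sub.
  apply: (measurable_wrtS (sF aT) (sF (sub t tab)) _ (Iad aT)).
  by have /andP[at_ tb] := tab; apply: FS => //; exact: le_trans bT.
have mmart s t B : a <= s -> s <= t -> t <= b -> F s B ->
    (\int[P]_(w in B) (m t w - m s w)%:E = 0)%E.
  move=> as_ st tb FB; under eq_integral do rewrite /m opprB addrA subrK.
  by apply: Imart => //; [exact: le_trans as_|exact: le_trans bT].
have mr w t : a <= t < b -> m s w @[s --> t^'+] --> m t w.
  move=> /andP[at_ tb]; apply: cvgB; last exact: cvg_cst.
  by apply: Ir; rewrite (le_trans a0 at_) (lt_le_trans tb).
have sFab t : a <= t <= b -> sigma_algebra setT (F t) by move=> /sub; exact: sF.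
have FMab t : a <= t <= b -> F t `<=` measurable by move=> /sub; exact: FM.
have FSab s t : a <= s -> s <= t -> t <= b -> F s `<=` F t.
  by move=> as_ st tb; apply: FS => //; [exact: le_trans as_|exact: le_trans bT].
have [S0 [mS0 S00 S0m S0E]] := doob_maximal_inequality (ltW ab) sFab FMab FSab mad ms mmart mr.
pose S w := (3%:E * ((y b w) ^+ 2)%:E + 3%:E * driver_bound a b w + 12%:E * S0 w)%E.
have yb0 w : (0 <= ((y b w) ^+ 2)%:E)%E by rewrite lee_fin sqr_ge0.
have G0 := driver_bound_ge0.
have mG := measurable_driver_bound.
have myb : measurable_fun setT (fun w => ((y b w) ^+ 2)%:E) by apply: sqre_measurable; exact: y_measurable.
have mS : measurable_fun setT S.
  by apply: emeasurable_funD; [apply: emeasurable_funD|]; exact: measurable_funeM.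
have SS w : (0 <= S w)%E by rewrite !adde_ge0// mule_ge0.
have yS : {ae P, forall w t, a <= t <= b -> (((y t w) ^+ 2)%:E <= S w)%E}.
  apply: filterS (driver_boundP a0 ab bT) => w h t tab.
  set x := y t w - y b w + (I b w - I t w).
  apply: (@le_trans _ _ (3%:E * ((y b w) ^+ 2)%:E + 3%:E * (x ^+ 2)%:E +
    (6%:E * ((m t w) ^+ 2)%:E + 6%:E * ((m b w) ^+ 2)%:E))%E).
    rewrite -!EFinM -!EFinD lee_fin.
    have -> : y t w = x + y b w + m t w - m b w by rewrite /x /m; ring.
    move: x (y b w) (m t w) (m b w) => x u v z.
    have := sqr_ge0 (x - u); have := sqr_ge0 (x + z - v); have := sqr_ge0 (u + z - v).
    have := sqr_ge0 (v + z); nra.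
  apply: leeD; first by apply: leeD2l; apply: lee_wpmul2l => //; exact: h.
  have -> : (12%:E = 6%:E + 6%:E :> \bar R)%E by rewrite -EFinD; congr (_%:E); lra.
  rewrite ge0_muleDl//; apply: leeD; apply: lee_wpmul2l => //; apply: S0m => //.
  by rewrite lexx ltW.
have ES : (\int[P]_w S w = 3%:E * eta + 3%:E * Gam + 12%:E * \int[P]_w S0 w)%E.
  exact: ge0_integral_comb3.
have eS : (e <= \int[P]_w S w)%E.
  apply: ge0_ae_le => //.
  apply: filterS yS => w h.
  apply: (@le_trans _ _ (\int[mu]_(t in `[a, b]) S w)%E).
    apply: ge0_le_integral => //.
    - by move=> t _; rewrite lee_fin sqr_ge0.
    - by apply/measurable_EFinP; exact: (measurable_strip_time (stripS a0 bT y2m) w).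
  rewrite integral_cst//= lebesgue_measure_itv/= lte_fin ab -EFinB.
  rewrite -[leRHS]mule1; apply: lee_wpmul2l => //; exact: SS.
have GE : Gam = (k%:E * e + k%:E * V + 2%:E * H)%E by exact: integral_driver_bound.
have D1 := martingale_increment_le.
set D := (\int[P]_w ((I b w - I a w) ^+ 2)%:E)%E in D1.
have V4 : (V <= 4%:E * D)%E by apply: qI => //; exact: ltW.
have S4 : (\int[P]_w S0 w <= 4%:E * D)%E by [].
exists S; split => //.
rewrite -/V -/eta -/H.
have D0 : (0 <= D)%E by apply: integral_ge0 => w _; rewrite lee_fin sqr_ge0.
have Goo : (Gam < +oo)%E.
  by rewrite GE !lte_add_pinfty// lte_mul_pinfty.
have Doo : (D < +oo)%E.
  by apply: (le_lt_trans D1); rewrite lte_add_pinfty// lte_mul_pinfty.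
have S0oo : (\int[P]_w S0 w < +oo)%E.
  by apply: (le_lt_trans S4); rewrite lte_mul_pinfty.
have S0ge : (0 <= \int[P]_w S0 w)%E by exact: integral_ge0.
move: ES GE D1 V4 S4 eS.
have fin (x : \bar R) : (0 <= x)%E -> (x < +oo)%E -> exists2 r, 0 <= r & x = r%:E.
  by case: x => [r||]// r0 _; exists r.
have [r_D r_D0 ->] := fin _ D0 Doo.
have [r_S r_S0 ->] := fin _ S0ge S0oo.
have [r_G r_G0 ->] := fin _ Gam0 Goo.
have [r_V r_V0 ->] := fin _ V0 Voo.
have [r_e r_e0 ->] := fin _ e0 eoo.
have [r_H r_H0 ->] := fin _ H0 Hoo.
have [r_y r_y0 ->] := fin _ eta0 etaoo.
move=> ->; rewrite -!EFinM -!EFinD !lee_fin => GE0 h1 h2 h3 h4. have GE := EFin_inj GE0; clear GE0.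
(* 107 = 99 + 8; half of the left side absorbs 107 k times the energies *)
have k107 : 214 * k <= 1 by move: small; rewrite /k; lra.
have kX : 214 * (k * (r_e + r_V)) <= r_e + r_V.
  rewrite mulrA -[leRHS]mul1r ler_wpM2r//; exact: addr_ge0.
rewrite mulrDr in kX; move: kX GE; set ke := k * r_e; set kV := k * r_V => kX GE.
lra.
Qed.

End Interval.

Hypothesis T0 : 0 < T.
Local Notation data := (\int[P]_w ((y T w) ^+ 2)%:E + \int[P]_w psi w)%E.

(** The estimate on [a, T]. The mean of [psi] is kept on the left so that one
    step of the induction multiplies [K] by a constant. *)
Definition bounded_from (K : R) a := exists S : Om -> \bar R,
  [/\ measurable_fun setT S, forall w, (0 <= S w)%E,
      {ae P, forall w t, a <= t <= T -> (((y t w) ^+ 2)%:E <= S w)%E} &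
      (\int[P]_w S w + DI a T q + \int[P]_w psi w <= K%:E * data)%E].

Lemma bounded_from_terminal : bounded_from 1 T.
Proof.
have TT : 0 <= T <= T by rewrite lexx ltW.
exists (fun w => ((y T w) ^+ 2)%:E); split.
- by apply/measurable_EFinP; apply: measurable_funX; exact: y_measurable.
- by move=> w; rewrite lee_fin sqr_ge0.
- by apply: aeW => w t; rewrite -eq_le => /eqP <-.
- by rewrite double_integral_point adde0 mul1e.
Qed.

Lemma bounded_from_step (K a b : R) : 0 <= K -> 0 <= a -> a < b -> b <= T ->
  b - a <= 1 -> 856 * (c ^+ 2 * (b - a)) <= 1 ->
  bounded_from K b -> bounded_from (429 * K) a.
Proof.
move=> K0 a0 ab bT short small [S [mS S0 yS SE]].
have [S' [mS' S'0 yS' S'E]] := short_interval_estimate a0 ab bT short small.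
have bT' : 0 <= b <= T by rewrite bT (le_trans a0 (ltW ab)).
have q0aT t w : a <= t <= T -> 0 <= q (t, w).
  by move=> tab; apply: q0; exact: (sub_itv a0 (lexx T) tab).
have q0ab t w : a <= t <= b -> 0 <= q (t, w).
  by move=> tab; apply: q0; exact: (sub_itv a0 bT tab).
have q0bT t w : b <= t <= T -> 0 <= q (t, w).
  by move=> /andP[bt tT]; apply: q0; rewrite tT (le_trans _ bt)// (le_trans a0)// ltW.
exists (fun w => S w + S' w)%E; split.
- exact: emeasurable_funD.
- by move=> w; rewrite adde_ge0.
- apply: filterS2 yS yS' => w h h' t /andP[at_ tT]; have [tb|bt] := leP t b.
    by apply: (le_trans (h' t _)); [rewrite at_|exact: leeDr].
  by apply: (le_trans (h t _)); [rewrite ltW|exact: leeDl].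
have bE : (\int[P]_w ((y b w) ^+ 2)%:E <= \int[P]_w S w)%E.
  apply: ge0_ae_le => //.
  - by apply/measurable_EFinP; apply: measurable_funX; exact: y_measurable.
  - by move=> w; rewrite lee_fin sqr_ge0.
  - by apply: filterS yS => w h; apply: h; rewrite lexx.
have qE : (DI a T q <= DI a b q + DI b T q)%E.
  by apply: double_integral_cut => //; [exact: ltW|exact: stripS].
rewrite ge0_integralD//.
have V0 : (0 <= DI a b q)%E by exact: double_integral_ge0.
have W0 : (0 <= DI b T q)%E by exact: double_integral_ge0.
have H0 : (0 <= \int[P]_w psi w)%E by exact: integral_ge0.
have E0 : (0 <= \int[P]_w S w)%E by exact: integral_ge0.
have E0' : (0 <= \int[P]_w S' w)%E by exact: integral_ge0.
apply: (@le_trans _ _ (429%:E * (\int[P]_w S w + DI b T q + \int[P]_w psi w))%E); last first.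
  by rewrite EFinM -muleA; apply: lee_wpmul2l; [rewrite lee_fin ler0n|exact: SE].
move: bE qE S'E E0 E0' H0 V0 W0.
move: (\int[P]_w S w)%E (\int[P]_w S' w)%E (\int[P]_w psi w)%E (DI a b q) (DI b T q) (DI a T q)
  (\int[P]_w ((y b w) ^+ 2)%:E)%E => u u' h v v' v'' z zu vv u'v u0 u'0 h0 v0 v'0.
have -> : 429%:E = (1 + 428%:E : \bar R)%E by rewrite -EFinD; congr (_%:E); lra.
have := ler0n R 428.
move: 428 u'v => k u'v k0.
have {}u'v : (u' + v <= k%:E * (u + h))%E.
  by apply: (le_trans u'v); apply: lee_wpmul2l => //; exact: leeD2r.
apply: (@le_trans _ _ (u + h + (u' + v) + v')%E).
  rewrite (_ : u + h + (u' + v) + v' = u + u' + (v + v') + h)%E.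
    by apply: leeD2r; exact: leeD2l.
  by rewrite [in RHS]addeAC !addeA; congr (_ + _ + _)%E; rewrite addeAC.
rewrite ge0_muleDl// mul1e.
apply: (@le_trans _ _ (u + h + k%:E * (u + h) + v')%E).
  by apply: leeD2r; exact: leeD2l.
rewrite addeAC; apply: leeD; first by rewrite addeAC.
by apply: lee_wpmul2l => //; apply: leeD2r; exact: leeDl.
Qed.

Local Notation steps := (step_count T c).

Lemma bounded_from_grid k : (k <= steps)%N ->
  bounded_from (429 ^+ k) (T - k%:R * (T / steps%:R)).
Proof.
have lt_steps : T + 856 * (c ^+ 2 * T) < steps%:R.
  have /truncn_itv/andP[_ h] : 0 <= T + 856 * (c ^+ 2 * T); last exact: h.
  apply: addr_ge0; first exact: ltW.
  exact: (mulr_ge0 (ler0n _ 856) (mulr_ge0 (sqr_ge0 c) (ltW T0))).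
have s0 : (0 : R) < steps%:R by [].
set D := T / steps%:R; have D0 : 0 < D by rewrite divr_gt0.
have cT0 : 0 <= c ^+ 2 * T by rewrite mulr_ge0 ?sqr_ge0// ltW.
elim: k => [_|k IH ks].
  by rewrite expr0 mul0r subr0; exact: bounded_from_terminal.
have DT : T = steps%:R * D by rewrite /D mulrCA divff ?mulr1// gt_eqF.
have kD : k.+1%:R * D <= T by rewrite [leRHS]DT ler_wpM2r ?ler_nat// ltW.
rewrite exprS; apply: (@bounded_from_step _ _ (T - k%:R * D)).
- exact: (exprn_ge0 k (ler0n R 429)).
- by rewrite subr_ge0.
- by rewrite -natr1; lra.
- by rewrite gerBl mulr_ge0// ltW.
- rewrite (_ : _ - _ = D); last by rewrite -natr1; ring.
  by rewrite /D ler_pdivrMr// mul1r; lra.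
- rewrite (_ : T - k%:R * D - _ = D); last by rewrite -natr1; ring.
  have -> : 856 * (c ^+ 2 * D) = 856 * (c ^+ 2 * T) / steps%:R by rewrite /D !mulrA.
  rewrite ler_pdivrMr// mul1r; apply/ltW/(le_lt_trans _ lt_steps).
  by rewrite lerDr; exact: ltW.
- by apply: IH; exact: ltnW.
Qed.

(** The last point of the grid of [step_count] intervals is 0. *)
Theorem backward_estimate : exists S : Om -> \bar R,
  [/\ measurable_fun setT S, forall w, (0 <= S w)%E,
      {ae P, forall w t, 0 <= t <= T -> (((y t w) ^+ 2)%:E <= S w)%E} &
      (\int[P]_w S w + DI 0 T q <= (429 ^+ steps)%:E * data)%E].
Proof.
have := bounded_from_grid (leqnn steps).
rewrite mulrCA divff ?mulr1 ?subrr ?pnatr_eq0// => -[S [mS S0 yS SE]].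
exists S; split => //; apply: le_trans SE; apply: leeDl.
exact: integral_ge0.
Qed.

End BackwardEstimate.

(** * The difference of two solutions *)

Section RunningSupremum.
Context (R : realType) (d : measure_display) (Om : measurableType d) (a b : R).
Variable Y : R -> Om -> R.
Hypothesis ab : a <= b.
Hypothesis mY : forall t, a <= t <= b -> measurable_fun setT (Y t).
Hypothesis rY : forall w t, a <= t < b -> Y s w @[s --> t^'+] --> Y t w.

(** By right continuity the supremum over the interval is the one over the
    countably many grid points. *)
Lemma measurable_sup_right_continuous :
  measurable_fun setT (fun w => ereal_sup [set ((Y t w) ^+ 2)%:E | t in `[a, b]]).
Proof.
pose nk m : nat * nat := odflt (0, 0)%N (unpickle m).
pose u w m := ((Y (grid a b (nk m).1 (nk m).2) w) ^+ 2)%:E.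
have -> : (fun w => ereal_sup [set ((Y t w) ^+ 2)%:E | t in `[a, b]]) = fun w => esups (u w) 0%N.
  apply/funext => w; apply/eqP; rewrite eq_le; apply/andP; split; apply/ereal_supP.
    move=> _ [t /= tab <-]; rewrite in_itv/= in tab.
    have cY : Y (grid a b n (grid_succ a n t)) w @[n --> \oo] --> Y t w.
      apply: (grid_succ_cvg (y := Y ^~ w)) => // tb.
      by apply: rY; rewrite tb andbT; case/andP: tab.
    have cY2 : ((Y (grid a b n (grid_succ a n t)) w) ^+ 2)%:E @[n --> \oo] --> ((Y t w) ^+ 2)%:E.
      by apply: cvg_EFin; [exact: nearW|under eq_fun do rewrite /= expr2; rewrite expr2; exact: cvgM].
    rewrite -(cvg_lim _ cY2)//; apply: lime_le; first by apply/cvg_ex; exists ((Y t w) ^+ 2)%:E.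
    apply: nearW => n; apply: ereal_sup_ubound; exists (pickle (n, grid_succ a n t)) => //.
    by rewrite /u /nk pickleK.
  move=> _ [m _ <-]; apply: ereal_sup_ubound; exists (grid a b (nk m).1 (nk m).2) => //=.
  by rewrite in_itv/=; exact: grid_itv.
apply: (measurable_fun_esups (f := fun m w => u w m)) => m.
by apply/measurable_EFinP; apply: measurable_funX; apply: mY; exact: grid_itv.
Qed.

End RunningSupremum.

Section Difference.
Context (R : realType) (d : measure_display) (Om : measurableType d).
Context (P : probability Om R) (N : nat) (A : R -> 'M[R]_N) (X M : R -> Om -> 'cV[R]_N).
Hypothesis HX : rcll_markov_chain P X.
Hypothesis HA : rate_matrix A.
Hypothesis HM : semimartingale_representation P A X M.
Variables (T c c1 c2 : R) (f : R -> Om -> R -> 'cV[R]_N -> R).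
Hypothesis T0 : 0 < T.
Hypothesis c0 : 0 < c.
Hypothesis c1c : c1 <= c.
Hypothesis c2c : c2 <= c.
Hypothesis Hf : predictable_borel P T X f.
Hypothesis Hlip : lipschitz_driver P T A X f c1 c2.
Hypothesis ef : finite_energy P T (fun t w => f t w 0 0).
Local Notation mu := (@lebesgue_measure R).
Local Notation strip a b := (`[a, b]%classic `*` [set: Om] : set (R * Om)).
Local Notation form := (chain_form A X).
Implicit Types (a b s t : R) (w : Om).
Variables (xi1 xi2 : Om -> R) (phi1 phi2 : R -> Om -> R).
Variables (Y1 Y2 : R -> Om -> R) (Z1 Z2 : R -> Om -> 'cV[R]_N) (I1 I2 : R -> Om -> R).
Hypothesis pphi1 : predictable P T X phi1.
Hypothesis pphi2 : predictable P T X phi2.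
Hypothesis ephi1 : finite_energy P T phi1.
Hypothesis ephi2 : finite_energy P T phi2.
Hypothesis LY1 : L2_adapted P T X Y1.
Hypothesis LY2 : L2_adapted P T X Y2.
Hypothesis PZ1 : P2_predictable P T A X Z1.
Hypothesis PZ2 : P2_predictable P T A X Z2.
Hypothesis sI1 : stochastic_integral P T A X M Z1 I1.
Hypothesis sI2 : stochastic_integral P T A X M Z2 I2.
Hypothesis eq1 : {ae P, forall w t, 0 <= t <= T ->
  Y1 t w = xi1 w + (\int[mu]_(s in `[t, T]) driver f Y1 phi1 Z1 s w) - (I1 T w - I1 t w)}.
Hypothesis eq2 : {ae P, forall w t, 0 <= t <= T ->
  Y2 t w = xi2 w + (\int[mu]_(s in `[t, T]) driver f Y2 phi2 Z2 s w) - (I2 T w - I2 t w)}.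

Let aY1 : adapted_rcll P T X Y1. Proof. by case: LY1. Qed.
Let aY2 : adapted_rcll P T X Y2. Proof. by case: LY2. Qed.
Let pZ1 i : predictable P T X (fun t w => Z1 t w i 0). Proof. by case: PZ1. Qed.
Let pZ2 i : predictable P T X (fun t w => Z2 t w i 0). Proof. by case: PZ2. Qed.

Local Notation y t w := (Y1 t w - Y2 t w).
Local Notation I t w := (I1 t w - I2 t w).
Local Notation Z t w := (Z1 t w - Z2 t w).
Let g t w := driver f Y1 phi1 Z1 t w - driver f Y2 phi2 Z2 t w.
Let q (p : R * Om) := form p.1 p.2 (Z p.1 p.2).
Let Phi w := (\int[mu]_(t in `[0%R, T]) `|phi1 t w - phi2 t w|%:E)%E.

Lemma measurable_driver_difference : measurable_fun (strip 0 T) (fun p => g p.1 p.2).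
Proof.
apply: measurable_funB.
  exact: (measurable_driver_strip HX T0 Hf aY1 pZ1 pphi1).
exact: (measurable_driver_strip HX T0 Hf aY2 pZ2 pphi2).
Qed.

(** The two equations on [t, T] and on [b, T], subtracted. *)
Lemma difference_equation : {ae P, forall w t b, 0 <= t -> t <= b -> b <= T ->
  y t w - y b w + (I b w - I t w) = \int[mu]_(s in `[t, b]) g s w /\
  mu.-integrable `[0, T] (EFin \o (fun s => g s w))}.
Proof.
have [_ eY1] := LY1; have [_ eY2] := LY2; have [_ eZ1] := PZ1; have [_ eZ2] := PZ2.
have i1 := driver_integrable HX HA T0 c1c c2c Hf Hlip aY1 eY1 pZ1 eZ1 ef pphi1 ephi1.
have i2 := driver_integrable HX HA T0 c1c c2c Hf Hlip aY2 eY2 pZ2 eZ2 ef pphi2 ephi2.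
apply: filterS2 (filterI eq1 i1) (filterI eq2 i2) => w [e1 h1] [e2 h2] t b t0 tb bT.
have mI : measurable (`[0, T]%classic : set (measurableTypeR R)) by [].
have ig : mu.-integrable `[0, T] (EFin \o (fun s => g s w)) by exact: (integrableB_in mI h1 h2).
split => //.
have tT : t <= T := le_trans tb bT.
have sub : `[t, T]%classic `<=` (`[0, T]%classic : set R).
  by move=> s; rewrite /= !in_itv/= => /andP[ts ->]; rewrite (le_trans t0).
have j1 : mu.-integrable `[t, T] (EFin \o (fun s => driver f Y1 phi1 Z1 s w)).
  by apply: (integrableS _ _ _ h1) => //; exact: sub.
have j2 : mu.-integrable `[t, T] (EFin \o (fun s => driver f Y2 phi2 Z2 s w)).
  by apply: (integrableS _ _ _ h2) => //; exact: sub.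
have sub' : `[t, b]%classic `<=` (`[t, T]%classic : set R).
  by move=> s; rewrite /= !in_itv/= => /andP[-> sb]; rewrite (le_trans sb).
have k1 : mu.-integrable `[t, b] (EFin \o (fun s => driver f Y1 phi1 Z1 s w)).
  by apply: (integrableS _ _ _ j1) => //; exact: sub'.
have k2 : mu.-integrable `[t, b] (EFin \o (fun s => driver f Y2 phi2 Z2 s w)).
  by apply: (integrableS _ _ _ j2) => //; exact: sub'.
rewrite /g RintegralB//.
have tT' : 0 <= t <= T by rewrite t0.
have bT' : 0 <= b <= T by rewrite bT (le_trans t0).
have tbT : t <= b <= T by rewrite tb.
rewrite (e1 t tT') (e2 t tT') (e1 b bT') (e2 b bT').
by rewrite (Rintegral_itv_cut tbT j1) (Rintegral_itv_cut tbT j2); ring.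
Qed.


Let my : measurable_fun (strip 0 T) (fun p => y p.1 p.2).
Proof. apply: measurable_funB; [exact: (adapted_rcll_joint HX T0 aY1)|exact: (adapted_rcll_joint HX T0 aY2)]. Qed.

Let mZ i : measurable_fun (strip 0 T) (fun p => (Z p.1 p.2) i 0).
Proof. exact: (measurable_integrand HX T0 pZ1 pZ2 i (lexx 0) (lexx T)). Qed.

Let mq : measurable_fun (strip 0 T) q.
Proof. exact: (measurable_chain_form HX HA (C := fun t w => Z t w) (lexx 0) mZ). Qed.

Let q0 t w : 0 <= t <= T -> 0 <= q (t, w).
Proof. by move=> /andP[t0 _]; exact: (chain_form_ge0 HX HA). Qed.

Let mphi : measurable_fun (strip 0 T) (fun p => phi1 p.1 p.2 - phi2 p.1 p.2).
Proof. by apply: measurable_funB; [exact: (predictable_joint HX T0 pphi1)|exact: (predictable_joint HX T0 pphi2)]. Qed.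

Let Phi0 w : (0 <= Phi w)%E.
Proof. by apply: integral_ge0 => t _; rewrite lee_fin. Qed.

Let mPhi : measurable_fun setT Phi.
Proof.
apply: (measurable_inner (F := fun p : R * Om => `|phi1 p.1 p.2 - phi2 p.1 p.2|)) => //.
by apply: measurableT_comp.
Qed.

(** The Lipschitz condition bounds the difference of the drivers by
    [c |y| + c |z| + |phi1 - phi2|] off the jump times; the first two terms are
    integrated over [a, b] and squared, the last one over the whole of [0, T]. *)
Lemma driver_difference_bound a b : 0 <= a -> a < b -> b <= T ->
  {ae P, forall w t, a <= t <= b ->
    (((y t w - y b w + (I b w - I t w)) ^+ 2)%:E <=
      driver_bound c (fun t w => y t w) q (fun w => (Phi w) ^+ 2) a b w)%E}.
Proof.
move=> a0 ab bT.
have lip := lipschitz_form HX HA c1c c2c Hlip.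
apply: filterS2 difference_equation lip => w de lw t /andP[at_ tb].
have t0 : 0 <= t := le_trans a0 at_.
have [-> ig] := de t b t0 tb bT.
have subT s : a <= s <= b -> 0 <= s <= T by move=> /andP[/(le_trans a0) -> /le_trans ->].
have subI : (`[a, b]%classic : set R) `<=` `[0, T]%classic.
  by move=> s; rewrite /= !in_itv/=; exact: subT.
have mt (h : R * Om -> R) : measurable_fun (strip 0 T) h ->
    measurable_fun (`[a, b]%classic : set R) (fun s => h (s, w)).
  by move=> mh; apply: measurable_funS (measurable_strip_time mh w).
have igt : mu.-integrable `[t, b] (EFin \o (fun s => g s w)).
  apply: (integrableS _ _ _ ig) => // s; rewrite /= !in_itv/= => /andP[ts sb].
  by rewrite (le_trans t0 ts) (le_trans sb).
have mg : measurable_fun (`[a, b]%classic : set R) (fun s => g s w).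
  exact: (mt _ measurable_driver_difference).
(* the part of the Lipschitz bound that carries the factor b - a *)
pose k s := c * `|y s w| + c * Num.sqrt (q (s, w)).
have k0 s : 0 <= k s.
  by rewrite addr_ge0// mulr_ge0 ?sqrtr_ge0 ?(ltW c0).
have mk : measurable_fun (`[a, b]%classic : set R) k.
  apply: measurable_funD; apply: measurable_funM => //.
    by apply: measurableT_comp => //; exact: (mt _ my).
  by apply: measurableT_comp; [exact: (continuous_measurable_fun (@sqrt_continuous R))|exact: (mt _ mq)].
have mp : measurable_fun (`[a, b]%classic : set R) (fun s => phi1 s w - phi2 s w) by exact: (mt _ mphi).
set G := (\int[mu]_(s in `[a, b]) `|g s w|%:E)%E.
have G0 : (0 <= G)%E by apply: integral_ge0 => s _; rewrite lee_fin.
have gG : (((\int[mu]_(s in `[t, b]) g s w) ^+ 2)%:E <= G ^+ 2)%E.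
  rewrite -(real_normK (num_real (\int[mu]_(s in _) _))) EFin_expe; apply: sqre_le; first by rewrite lee_fin.
  apply: (@le_trans _ _ (\int[mu]_(s in `[t, b]) `|g s w|%:E)%E).
    have := le_normr_Rintegral _ igt => /(_ (measurable_itv _)).
    rewrite -lee_fin => /le_trans; apply; rewrite /Rintegral fineK//.
    apply: integrable_fin_num => //; exact: integrable_norm.
  apply: ge0_subset_integral => //.
    by apply/measurable_EFinP; apply: measurableT_comp.
  by move=> s; rewrite /= !in_itv/= => /andP[/(le_trans at_) -> ->].
apply: (le_trans gG).
have GkP : (G <= \int[mu]_(s in `[a, b]) (k s)%:E + Phi w)%E.
  apply: (@le_trans _ _ (\int[mu]_(s in `[a, b]) (k s + `|phi1 s w - phi2 s w|)%:E)%E).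
    apply: (@ae_countable_le _ _ _ _ _ _ HX w) => //.
    - by apply: measurableT_comp.
    - by apply: measurable_funD => //; apply: measurableT_comp.
    - by move=> s _; rewrite addr_ge0.
    move=> s sab nJ; rewrite /g /driver.
    rewrite (_ : _ - _ = (f s w (Y1 s w) (Z1 s w) - f s w (Y2 s w) (Z2 s w)) + (phi1 s w - phi2 s w)); last by ring.
    apply: (le_trans (ler_normD _ _)); rewrite lerD2r.
    exact: (lw s _ _ _ _ (subT s sab) nJ).
  under eq_integral do rewrite EFinD.
  rewrite ge0_integralD//; [|by move=> s _; rewrite lee_fin|exact/measurable_EFinP|by apply/measurable_EFinP; apply: measurableT_comp].
  apply: leeD2l; apply: ge0_subset_integral => //.
  apply/measurable_EFinP; apply: measurableT_comp => //.
  exact: (measurable_strip_time mphi w).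
set K := (\int[mu]_(s in `[a, b]) (k s)%:E)%E in GkP.
have K0 : (0 <= K)%E by apply: integral_ge0 => s _; rewrite lee_fin.
apply: (le_trans (sqre_le G0 GkP)).
apply: (le_trans (sqre_add_le K0 (Phi0 w))).
rewrite /driver_bound; apply: leeD2r.
have K2 : (K ^+ 2 <= (b - a)%:E * \int[mu]_(s in `[a, b]) ((k s) ^+ 2)%:E)%E.
  have := time_sqr_integral_le ab mk; rewrite (_ : (\int[mu]_(s in _) `|k s|%:E = K)%E)//.
  by apply: eq_integral => s _; rewrite ger0_norm.
have k2 : (\int[mu]_(s in `[a, b]) ((k s) ^+ 2)%:E <= (2 * c ^+ 2)%:E * \int[mu]_(s in `[a, b]) ((y s w) ^+ 2)%:E
    + (2 * c ^+ 2)%:E * \int[mu]_(s in `[a, b]) (q (s, w))%:E)%E.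
  apply: integral_le_comb => //.
  - by rewrite mulr_ge0// sqr_ge0.
  - by move=> s _; rewrite lee_fin sqr_ge0.
  - by move=> s _; rewrite lee_fin sqr_ge0.
  - by move=> s; rewrite /= in_itv/= lee_fin => /subT; exact: q0.
  - by apply/measurable_EFinP; apply: measurable_funX.
  - by apply/measurable_EFinP; apply: measurable_funX; exact: (mt _ my).
  - by apply/measurable_EFinP; exact: (mt _ mq).
  move=> s; rewrite /= in_itv/= => /subT sT; rewrite -!EFinM -EFinD lee_fin /k.
  rewrite -[X in _ <= _ + _ * X](@sqr_sqrtr _ (q (s, w))) ?q0//.
  rewrite -(real_normK (num_real (y s w))).
  move: (`|y s w|) (Num.sqrt (q (s, w))) => u v.
  have := sqr_ge0 (c * u - c * v); nra.
apply: (@le_trans _ _ (2%:E * ((b - a)%:E * ((2 * c ^+ 2)%:E * \int[mu]_(s in `[a, b]) ((y s w) ^+ 2)%:E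
    + (2 * c ^+ 2)%:E * \int[mu]_(s in `[a, b]) (q (s, w))%:E)))%E).
  apply: lee_wpmul2l => //; apply: (le_trans K2); apply: lee_wpmul2l => //.
  by rewrite lee_fin subr_ge0 ltW.
have u0 : (0 <= \int[mu]_(s in `[a, b]) ((y s w) ^+ 2)%:E)%E.
  by apply: integral_ge0 => s _; rewrite lee_fin sqr_ge0.
have v0 : (0 <= \int[mu]_(s in `[a, b]) (q (s, w))%:E)%E.
  by apply: integral_ge0 => s; rewrite /= in_itv/= lee_fin => /subT; exact: q0.
have cc : 0 <= 2 * c ^+ 2 by rewrite mulr_ge0// sqr_ge0.
rewrite muleA ge0_muleDr ?mule_ge0 ?lee_fin//.
rewrite !muleA -!EFinM; have -> : 2 * (b - a) * (2 * c ^+ 2) = 4 * c ^+ 2 * (b - a) by ring.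
exact: lexx.
Qed.


Hypothesis Lxi1 : L2_terminal P T X xi1.
Hypothesis Lxi2 : L2_terminal P T X xi2.

(** The differences [y], [I] and the form of [z] satisfy the hypotheses of
    [backward_estimate]. *)
Theorem difference_estimate :
  (\int[P]_w (ereal_sup [set ((y t w) ^+ 2)%:E | t in `[0%R, T]]
      + \int[mu]_(t in `[0%R, T]) ((seminorm A X t w (Z t w)) ^+ 2)%:E)
   <= (429 ^+ step_count T c)%:E * \int[P]_w (((xi1 w - xi2 w) ^+ 2)%:E + (Phi w) ^+ 2))%E.
Proof.
have [[aY1t rY1] eY1] := LY1; have [[aY2t rY2] eY2] := LY2.
have [[_ rI1] _] := sI1; have [[_ rI2] _] := sI2.
have TT : 0 <= T <= T by rewrite lexx ltW.
have my2 : measurable_fun (strip 0 T) (fun p => (y p.1 p.2) ^+ 2) by apply: measurable_funX.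
have sq2 (x1 x2 : R) : (x1 - x2) ^+ 2 <= 2 * x1 ^+ 2 + 2 * x2 ^+ 2.
  by have := sqr_ge0 (x1 + x2); nra.
have yoo : (double_integral P 0%R T%R (fun p => (y p.1 p.2) ^+ 2)%R < +oo)%E.
  apply: (@le_lt_trans _ _ (2%:E * double_integral P 0%R T%R (fun p => (Y1 p.1 p.2) ^+ 2)%R
      + 2%:E * double_integral P 0%R T%R (fun p => (Y2 p.1 p.2) ^+ 2)%R)%E).
    apply: double_integral_comb => //; try by move=> t w _; exact: sqr_ge0.
    - by apply: measurable_funX; exact: (adapted_rcll_joint HX T0 aY1).
    - by apply: measurable_funX; exact: (adapted_rcll_joint HX T0 aY2).
  by apply: lte_add_pinfty; apply: lte_mul_pinfty.
have qI s t : 0 <= s -> s <= t -> t <= T ->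
    (double_integral P s t q <= 4%:E * \int[P]_w ((I t w - I s w) ^+ 2)%:E)%E.
  by move=> *; exact: (energy_le_increment HX HA HM T0 pZ1 pZ2 sI1 sI2).
have TT0 : 0 <= T by exact: ltW.
have qoo : (double_integral P 0%R T%R q < +oo)%E.
  apply: (le_lt_trans (qI 0 T (lexx 0) TT0 (lexx T))); apply: lte_mul_pinfty => //.
  apply: (proj2 (sqintB _ _)); apply: (stochastic_integral_sqint HX HA HM T0 pZ1 pZ2 sI1 sI2) => //.
  by rewrite lexx.

have sF t : 0 <= t <= T -> sigma_algebra setT (filtration P X t) by move=> _; exact: filtration_sigma.
have FM t : 0 <= t <= T -> filtration P X t `<=` measurable by move=> _; exact: filtration_measurable.
have FS s t : 0 <= s -> s <= t -> t <= T -> filtration P X s `<=` filtration P X t.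
  by move=> _ st _; exact: filtrationS.
have Iad t : 0 <= t <= T -> measurable_wrt (filtration P X t) setT (fun w => I t w).
  exact: (stochastic_integral_adapted sI1 sI2).
have Isq t : 0 <= t <= T -> sqint P (fun w => I t w).
  exact: (stochastic_integral_sqint HX HA HM T0 pZ1 pZ2 sI1 sI2).
have Imart s t B : 0 <= s -> s <= t -> t <= T -> filtration P X s B ->
    (\int[P]_(w in B) (I t w - I s w)%:E = 0)%E.
  exact: (stochastic_integral_martingale HX HA HM T0 pZ1 pZ2 sI1 sI2).
have Ir w t : 0 <= t < T -> I s w @[s --> t^'+] --> I t w.
  by move=> tT; apply: cvgB; [exact: (rI1 w).1|exact: (rI2 w).1].
have yr w t : 0 <= t < T -> y s w @[s --> t^'+] --> y t w.
  by move=> tT; apply: cvgB; [exact: (rY1 w).1|exact: (rY2 w).1].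
have yad t : 0 <= t <= T -> measurable_wrt (filtration P X t) setT (fun w => y t w).
  by move=> tT; apply: measurable_funB; [exact: aY1t|exact: aY2t].
have yms t : 0 <= t <= T -> measurable_fun setT (fun w => y t w).
  by move=> tT; exact: (filtration_measurable_fun HX (yad t tT)).
have Phi20 w : (0 <= (Phi w) ^+ 2)%E by rewrite expe2 mule_ge0.
have mPhi2 : measurable_fun setT (fun w => (Phi w) ^+ 2)%E.
  rewrite (_ : (fun w => _) = fun w => Phi w * Phi w)%E; first exact: emeasurable_funM.
  by apply/funext => w; rewrite expe2.
have [S [mS S0 yS SE]] := backward_estimate sF FM FS Iad Isq Imart Ir yad my mq q0 yoo qoo qI
  mPhi2 Phi20 driver_difference_bound T0.

have yT : {ae P, forall w, y T w = xi1 w - xi2 w}.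
  apply: filterS2 eq1 eq2 => w /(_ T TT) -> /(_ T TT) ->.
  by rewrite set_itv1 !Rintegral_set1; ring.
have mxi : measurable_fun setT (fun w => xi1 w - xi2 w).
  by apply: measurable_funB; [case: Lxi1|case: Lxi2] => m _; exact: (filtration_measurable_fun HX m).
have dataE : (\int[P]_w ((y T w) ^+ 2)%:E <= \int[P]_w ((xi1 w - xi2 w) ^+ 2)%:E)%E.
  apply: ge0_ae_le.
  - by apply/measurable_EFinP; apply: measurable_funX; exact: yms.
  - by apply/measurable_EFinP; apply: measurable_funX.
  - by move=> w; rewrite lee_fin sqr_ge0.
  - by move=> w; rewrite lee_fin sqr_ge0.
  - by apply: filterS yT => w ->.
have msup := measurable_sup_right_continuous TT0 yms yr.
have sup0 w : (0 <= ereal_sup [set ((y t w) ^+ 2)%:E | t in `[0%R, T]])%E.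
  apply: (@le_trans _ _ ((y 0 w) ^+ 2)%:E); first by rewrite lee_fin sqr_ge0.
  by apply: ereal_sup_ubound; exists 0 => //=; rewrite in_itv/= lexx ltW.
have JE w : (\int[mu]_(t in `[0%R, T]) ((seminorm A X t w (Z t w)) ^+ 2)%:E =
    \int[mu]_(t in `[0%R, T]) (q (t, w))%:E)%E.
  exact: (integral_seminorm_sqr HX HA (C := fun t w => Z t w) w (lexx 0) mZ).
have mJ : measurable_fun setT (fun w => \int[mu]_(t in `[0%R, T]) (q (t, w))%:E)%E.
  exact: measurable_inner.
have J0 w : (0 <= \int[mu]_(t in `[0%R, T]) (q (t, w))%:E)%E by exact: inner_ge0.
have -> : (\int[P]_w (ereal_sup [set ((y t w) ^+ 2)%:E | t in `[0%R, T]]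
      + \int[mu]_(t in `[0%R, T]) ((seminorm A X t w (Z t w)) ^+ 2)%:E)
  = \int[P]_w (ereal_sup [set ((y t w) ^+ 2)%:E | t in `[0%R, T]]
      + \int[mu]_(t in `[0%R, T]) (q (t, w))%:E))%E.
  by apply: eq_integral => w _; rewrite JE.
rewrite ge0_integralD//.
apply: (@le_trans _ _ (\int[P]_w S w + double_integral P 0%R T%R q)%E).
  apply: leeD2r; apply: ge0_ae_le => //.
  apply: filterS yS => w h; apply/ereal_supP => _ [t /= tT <-].
  by apply: h; rewrite in_itv in tT.
apply: (le_trans SE); apply: lee_wpmul2l; first by rewrite lee_fin; exact: (exprn_ge0 _ (ler0n R 429)).
rewrite ge0_integralD//; first exact: leeD2r.
  by move=> w _; rewrite lee_fin sqr_ge0.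
by apply/measurable_EFinP; apply: measurable_funX.
Qed.

End Difference.

(** * The stability estimate *)

Theorem proposition4p2 (R : realType) (T c : R) (hT : 0 < T) (hc : 0 < c) :
  exists2 Cbar : R, 0 < Cbar &
  forall (d : measure_display) (Om : measurableType d) (P : probability Om R)
    (N : nat) (A : R -> 'M[R]_N) (X M : R -> Om -> 'cV[R]_N)
    (f : R -> Om -> R -> 'cV[R]_N -> R) (c1 c2 : R)
    (xi1 xi2 : Om -> R) (phi1 phi2 : R -> Om -> R)
    (Y1 Y2 : R -> Om -> R) (Z1 Z2 : R -> Om -> 'cV[R]_N),
  rcll_markov_chain P X ->
  rate_matrix A ->
  semimartingale_representation P A X M ->
  predictable_borel P T X f ->
  0 < c1 -> 0 < c2 -> c = Num.max c1 c2 ->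
  lipschitz_driver P T A X f c1 c2 ->
  finite_energy P T (fun t w => f t w 0 0) ->
  L2_terminal P T X xi1 ->
  L2_terminal P T X xi2 ->
  predictable P T X phi1 -> finite_energy P T phi1 ->
  predictable P T X phi2 -> finite_energy P T phi2 ->
  bsde_solution P T A X M (fun t w v z => f t w v z + phi1 t w) xi1 Y1 Z1 ->
  bsde_solution P T A X M (fun t w v z => f t w v z + phi2 t w) xi2 Y2 Z2 ->
  (\int[P]_w (ereal_sup [set ((Y1 t w - Y2 t w) ^+ 2)%:E | t in `[0%R, T]]
      + \int[@lebesgue_measure R]_(t in `[0%R, T])
          ((seminorm A X t w (Z1 t w - Z2 t w)) ^+ 2)%:E)
   <= Cbar%:E *
      \int[P]_w (((xi1 w - xi2 w) ^+ 2)%:E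
        + (\int[@lebesgue_measure R]_(t in `[0%R, T])
             `|phi1 t w - phi2 t w|%:E) ^+ 2))%E.

Proof.
exists (429 ^+ step_count T c); first exact: (exprn_gt0 _ (ltr0Sn R 428)).
move=> d Om P N A X M f c1 c2 xi1 xi2 phi1 phi2 Y1 Y2 Z1 Z2 HX HA HM Hf c10 c20 cE Hlip ef
  Lxi1 Lxi2 pphi1 ephi1 pphi2 ephi2 [LY1 PZ1 [I1 sI1 eq1]] [LY2 PZ2 [I2 sI2 eq2]].
have c1c : c1 <= c by rewrite cE le_max lexx.
have c2c : c2 <= c by rewrite cE le_max lexx orbT.
exact: (difference_estimate HX HA HM hT hc c1c c2c Hf Hlip ef pphi1 pphi2 ephi1 ephi2
  LY1 LY2 PZ1 PZ2 sI1 sI2 eq1 eq2 Lxi1 Lxi2).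
Qed.
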